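(* Let $\Gamma$ be any countable discrete group and $(X,\mu)$ a standard probability space. Then the space $\mathrm{A}_{\sim_s}(\Gamma,X,\mu)$ is isomorphic to a compact convex subset of a Banach space; that is, there are a Banach space $E$, a norm-compact convex set $S\subseteq E$ and a homeomorphism $\Theta:\mathrm{A}_{\sim_s}(\Gamma,X,\mu)\to S$ such that $\Theta(tx+(1-t)y)=t\Theta(x)+(1-t)\Theta(y)$ for all $x,y\in\mathrm{A}_{\sim_s}(\Gamma,X,\mu)$ and $t\in[0,1]$.
   Context: A probability space is a standard Borel space with a Borel probability measure (atoms allowed, possibly countable or finite); it is a standard probability space if the measure is nonatomic. A measure-preserving action $\Gamma\curvearrowright^a(Y,\nu)$ is a Borel action preserving $\nu$, two actions being identified if they agree almost everywhere; $\gamma^a$ denotes the transformation given by $\gamma\in\Gamma$. $\mathrm{A}(\Gamma,X,\mu)$ is the set of measure-preserving actions of $\Gamma$ on $(X,\mu)$. Sums: if $a_i$ ($1\le i\le m$) are measure-preserving actions on $(Y_i,\nu_i)$ and $\alpha_i\ge0$, $\sum\alpha_i=1$, then $\sum_i\alpha_ia_i$ is the action on $\bigsqcup_iY_i$ with the measure $A\mapsto\sum_i\alpha_i\nu_i(A\cap Y_i)$ which acts as $a_i$ on $Y_i$. Stable weak containment: for actions $a$ on $(X,\mu)$ and $b$ on $(Y,\nu)$, $a\prec_sb$ if for all measurable $A_1,\dots,A_k\subseteq X$, finite $F\subseteq\Gamma$ and $\epsilon>0$ there are $m\geq 1$, positive reals $\alpha_1,\dots,\alpha_m$ with $\sum\alpha_i=1$,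 and measurable subsets $B_1,\dots,B_k$ of the underlying space of the action $c=\sum_{l=1}^m\alpha_lb$ (on $m$ disjoint copies of $Y$, with measure $\nu'=\sum_l\alpha_l\nu$) such that $|\mu(\gamma^aA_i\cap A_j)-\nu'(\gamma^{c}B_i\cap B_j)|<\epsilon$ for all $\gamma\in F$, $i,j\le k$. $a\sim_sb$ means $a\prec_sb$ and $b\prec_sa$. $\mathrm{A}_{\sim_s}(\Gamma,X,\mu)$ is the quotient of $\mathrm{A}(\Gamma,X,\mu)$ by $\sim_s$. Topology: fix an enumeration $(\gamma_i)_{i\ge1}$ of $\Gamma$ (with repetitions if $\Gamma$ is finite). For an action $a$ on $(Y,\nu)$ and a measurable partition $\mathcal A=\{A_1,\dots,A_k\}$ of $Y$ let $M^{\mathcal A}_{n,k}(a)\in[0,1]^{n\times k\times k}$ have $(p,q,r)$ coordinate $\nu(\gamma_p^aA_q\cap A_r)$, let $C_{n,k}(a)$ be the closure of the set of all $M^{\mathcal A}_{n,k}(a)$, and let $d(a,b)=\sum_{n,k=1}^\infty2^{-(n+k)}d_H(C_{n,k}(a),C_{n,k}(b))$, where $d_H$ is the Hausdorff distance (from the supremum metric). Let $\iota$ be the trivial action of $\Gamma$ on a standard probability space. Then $d_s(a,b)=d(a\times\iota,b\times\iota)$ defines a metric on $\mathrm{A}_{\sim_s}(\Gamma,X,\mu)$, which carries the resulting topology. Convex structure: $t[a]_s+(1-t)[b]_s$ is the stable weak equivalence class of $ta+(1-t)b$ (transported to $(X,\mu)$ by any isomorphism of probability spaces); this is well defined. *)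

(* Defs.v *)
From HB Require Import structures.
From mathcomp Require Import all_boot all_order all_algebra.
From mathcomp Require Import all_classical all_reals all_analysis.

Set Implicit Arguments.
Unset Strict Implicit.
Unset Printing Implicit Defensive.

Import Order.TTheory GRing.Theory Num.Theory.
Import numFieldNormedType.Exports.

Local Open Scope classical_set_scope.
Local Open Scope ring_scope.

Definition polish (R : realType) (P : completePseudoMetricType R) : Prop :=
  hausdorff_space P /\ exists2 D : set P, countable D & dense D.

Definition standard_borel (R : realType) d (X : measurableType d) : Prop :=
  exists (P : completePseudoMetricType R) (f : X -> P),
    [/\ polish P, bijective f &
        forall A : set X, measurable A <-> <<s [set U : set P | open U] >> (f @` A)].

(* For a Borel measure on a standard Borel space, nonatomic means that every
   singleton is null. *)
Definition standard_probability (R : realType) d (X : measurableType d)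
    (mu : probability X R) : Prop :=
  standard_borel R X /\ (forall x : X, mu [set x] = 0%E).

Section actions.
Context (R : realType) (G : groupType).

(* Actions that agree almost everywhere are not identified here: they are
   stably weakly equivalent, so they are identified in [stable_space]. *)
Record mpaction d (X : measurableType d) (mu : probability X R) := MPAction {
  act :> G -> X -> X ;
  act1 : forall x, act 1%g x = x ;
  actM : forall g h x, act (g * h)%g x = act g (act h x) ;
  act_measurable : forall g, measurable_fun setT (act g) ;
  act_preserving : forall g A, measurable A -> mu (act g @^-1` A) = mu A }.

HB.instance Definition _ d (X : measurableType d) (mu : probability X R) :=
  gen_eqMixin (mpaction mu).
HB.instance Definition _ d (X : measurableType d) (mu : probability X R) :=
  gen_choiceMixin (mpaction mu).

Section action_theory.
Context d (X : measurableType d) (mu : probability X R) (a : mpaction mu).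

Lemma actK g : cancel (a g) (a g^-1%g).
Proof. by move=> x; rewrite -actM mulVg act1. Qed.

Lemma actKV g : cancel (a g^-1%g) (a g).
Proof. by move=> x; rewrite -actM mulgV act1. Qed.

Lemma act_image g (A : set X) : a g @` A = a g^-1%g @^-1` A.
Proof.
apply/seteqP; split => [_ [x Ax <-]|x Ax] /=; first by rewrite actK.
by exists (a g^-1%g x) => //; rewrite actKV.
Qed.

Lemma measurable_act_image g (A : set X) : measurable A -> measurable (a g @` A).
Proof.
move=> mA; rewrite act_image -[X in measurable X]setTI.
exact: act_measurable.
Qed.

End action_theory.

Section product_action.
Context d1 d2 (X : measurableType d1) (Y : measurableType d2).
Context (mu : probability X R) (nu : probability Y R).
Context (a : mpaction mu) (b : mpaction nu).

Let pact g (z : X * Y) : X * Y := (a g z.1, b g z.2).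

Let pact1 z : pact 1%g z = z.
Proof. by case: z => x y; rewrite /pact !act1. Qed.

Let pactM g h z : pact (g * h)%g z = pact g (pact h z).
Proof. by rewrite /pact !actM. Qed.

Let pact_measurable g : measurable_fun setT (pact g).
Proof.
apply/measurable_fun_pairP; split.
- exact: (measurableT_comp (act_measurable a g) measurable_fst).
- exact: (measurableT_comp (act_measurable b g) measurable_snd).
Qed.

Let pact_preserving g A : measurable A ->
  (mu \x nu)%E (pact g @^-1` A) = (mu \x nu)%E A.
Proof.
move=> mA; rewrite -[LHS]/(pushforward (mu \x nu)%E (pact g) A).
have mg := pact_measurable g.
apply/esym.
apply: (product_measure_unique (m' := pushforward (mu \x nu)%E (pact g))) => //.
move=> B C mB mC.
rewrite -[LHS]/((mu \x nu)%E ((a g @^-1` B) `*` (b g @^-1` C))).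
have mB' : measurable (a g @^-1` B).
  by rewrite -[X in measurable X]setTI; exact: act_measurable.
have mC' : measurable (b g @^-1` C).
  by rewrite -[X in measurable X]setTI; exact: act_measurable.
rewrite product_measure1E//.
by congr (_ * _)%E; [exact: (act_preserving a)|exact: (act_preserving b)].
Qed.

Definition prod_action : mpaction (mu \x nu)%E :=
  MPAction pact1 pactM pact_measurable pact_preserving.

End product_action.

Section trivial_action.
Context d (X : measurableType d) (mu : probability X R).

Let tact (g : G) (x : X) : X := x.

Let tact_measurable g : measurable_fun setT (tact g).
Proof. exact: measurable_id. Qed.

Definition trivial_action : mpaction mu :=
  @MPAction _ X mu tact (fun=> erefl) (fun _ _ _ => erefl) tact_measurable
    (fun _ _ _ => erefl).

End trivial_action.

End actions.

Definition disjoint_union d (m : nat) (Y : 'I_m.+1 -> measurableType d) : Type :=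
  {i : 'I_m.+1 & Y i}.

Section disjoint_union_measurable.
Context d (m : nat) (Y : 'I_m.+1 -> measurableType d).

HB.instance Definition _ := Choice.copy (disjoint_union Y) {i : 'I_m.+1 & Y i}.
HB.instance Definition _ := isPointed.Build (disjoint_union Y)
  (existT (fun i => Y i) ord0 point).

Definition embed (i : 'I_m.+1) (y : Y i) : disjoint_union Y :=
  existT (fun i => Y i) i y.

Definition union_measurable : set (set (disjoint_union Y)) :=
  [set A | forall i, measurable (@embed i @^-1` A)].

Lemma union_measurable0 : union_measurable set0.
Proof. by move=> i; rewrite preimage_set0. Qed.

Lemma union_measurableC A : union_measurable A -> union_measurable (~` A).
Proof. by move=> mA i; rewrite preimage_setC; apply: measurableC; exact: mA. Qed.

Lemma union_measurable_bigcup (F : (set (disjoint_union Y))^nat) :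
  (forall k, union_measurable (F k)) -> union_measurable (\bigcup_k F k).
Proof.
move=> mF i; rewrite preimage_bigcup; apply: bigcup_measurable => k _.
exact: mF.
Qed.

HB.instance Definition _ := isMeasurable.Build d (disjoint_union Y)
  union_measurable0 union_measurableC union_measurable_bigcup.

Lemma measurable_unionP (A : set (disjoint_union Y)) :
  measurable A <-> forall i, measurable (@embed i @^-1` A).
Proof. by []. Qed.

Lemma measurable_embed i : measurable_fun setT (@embed i).
Proof. by move=> _ A mA; rewrite setTI; exact: mA. Qed.

End disjoint_union_measurable.

Record weights (R : realType) (m : nat) := Weights {
  wt :> 'I_m -> R ;
  wt_ge0 : forall i, 0 <= wt i ;
  wt_sum1 : \sum_i wt i = 1 }.

Section sum_measure.
Context (R : realType) d (m : nat) (Y : 'I_m.+1 -> measurableType d).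
Context (alpha : weights R m.+1) (nu : forall i, probability (Y i) R).
Local Open Scope ereal_scope.

Definition sum_measure (A : set (disjoint_union Y)) : \bar R :=
  \sum_(i < m.+1) (alpha i)%:E * nu i (@embed d m Y i @^-1` A).

Let sum_measure0 : sum_measure set0 = 0.
Proof.
by rewrite /sum_measure big1// => i _; rewrite preimage_set0 measure0 mule0.
Qed.

Let sum_measure_ge0 A : 0 <= sum_measure A.
Proof.
by apply: sume_ge0 => i _; rewrite mule_ge0// lee_fin; exact: wt_ge0.
Qed.

Let sum_measure_sigma_additive : semi_sigma_additive sum_measure.
Proof.
move=> F mF tF mUF; rewrite [X in _ --> X](_ : _ =
    lim ((fun n => \sum_(0 <= i < n) sum_measure (F i)) @ \oo)).
  by apply: is_cvg_ereal_nneg_natsum => k _; exact: sum_measure_ge0.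
rewrite nneseries_sum//; last first.
  by move=> i j _; rewrite mule_ge0// lee_fin; exact: wt_ge0.
apply: eq_bigr => /= i _; rewrite nneseriesZl//; congr (_ * _).
rewrite preimage_bigcup; apply: measure_semi_bigcup.
- by move=> k; exact: mF.
- apply/trivIsetP => j k _ _ jk; rewrite -preimage_setI.
  by move/trivIsetP : tF => /(_ _ _ _ _ jk) ->//; rewrite preimage_set0.
- by rewrite -preimage_bigcup; exact: mUF.
Qed.

HB.instance Definition _ := isMeasure.Build _ _ _ sum_measure
  sum_measure0 sum_measure_ge0 sum_measure_sigma_additive.

Let sum_measure_setT : sum_measure setT = 1.
Proof.
rewrite /sum_measure; under eq_bigr => i _.
  rewrite preimage_setT probability_setT mule1; over.
by rewrite sumEFin wt_sum1.
Qed.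

HB.instance Definition _ := Measure_isProbability.Build _ _ _ sum_measure
  sum_measure_setT.

End sum_measure.

Section sum_action.
Context (R : realType) (G : groupType) (d : measure_display) (m : nat).
Context (Y : 'I_m.+1 -> measurableType d) (alpha : weights R m.+1).
Context (nu : forall i, probability (Y i) R).
Context (a : forall i, mpaction G (nu i)).

Let sact g (z : disjoint_union Y) : disjoint_union Y :=
  @embed d m Y (projT1 z) (a (projT1 z) g (projT2 z)).

Let sact1 z : sact 1%g z = z.
Proof. by case: z => i y; rewrite /sact /= act1. Qed.

Let sactM g h z : sact (g * h)%g z = sact g (sact h z).
Proof. by rewrite /sact /= actM. Qed.

Let sact_preimage g A i :
  @embed d m Y i @^-1` (sact g @^-1` A) = a i g @^-1` (@embed d m Y i @^-1` A).
Proof. by []. Qed.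

Let sact_measurable g : measurable_fun setT (sact g).
Proof.
move=> _ A mA; rewrite setTI; apply/measurable_unionP => i; rewrite sact_preimage.
rewrite -[X in measurable X]setTI.
exact: (act_measurable (a i) g measurableT (mA i)).
Qed.

Let sact_preserving g A : measurable A ->
  sum_measure alpha nu (sact g @^-1` A) = sum_measure alpha nu A.
Proof.
move=> mA; apply: eq_bigr => i _; by rewrite sact_preimage (act_preserving (a i)).
Qed.

Definition sum_action : mpaction G (sum_measure alpha nu) :=
  MPAction sact1 sactM sact_measurable sact_preserving.

Lemma sum_action_image g A i :
  @embed d m Y i @^-1` (sum_action g @` A) = a i g @` (@embed d m Y i @^-1` A).
Proof. by rewrite !act_image. Qed.

End sum_action.

Section stable_weak_containment.
Context (R : realType) (G : groupType).

(* The action \sum_l alpha_l b on m.+1 disjoint copies of Y. *)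
Definition multiple d (Y : measurableType d) (nu : probability Y R)
    (b : mpaction G nu) m (alpha : weights R m.+1) :
    mpaction G (sum_measure alpha (fun=> nu)) :=
  sum_action alpha (fun=> b).

Definition stably_weakly_contained d1 d2 (X : measurableType d1)
    (Y : measurableType d2) (mu : probability X R) (nu : probability Y R)
    (a : mpaction G mu) (b : mpaction G nu) : Prop :=
  forall (k : nat) (A : 'I_k -> set X) (F : set G) (eps : R),
    (forall i, measurable (A i)) -> finite_set F -> 0 < eps ->
    exists (m : nat) (alpha : weights R m.+1)
        (B : 'I_k -> set (disjoint_union (fun _ : 'I_m.+1 => Y))),
      [/\ forall l, 0 < alpha l, forall i, measurable (B i) &
          forall g i j, F g ->
            `|fine (mu (a g @` A i `&` A j)) -
              fine (sum_measure alpha (fun=> nu)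
                (multiple b alpha g @` B i `&` B j))| < eps].

Definition stably_weakly_equivalent d1 d2 (X : measurableType d1)
    (Y : measurableType d2) (mu : probability X R) (nu : probability Y R)
    (a : mpaction G mu) (b : mpaction G nu) : Prop :=
  stably_weakly_contained a b /\ stably_weakly_contained b a.

End stable_weak_containment.

Section stable_equivalence.
Context (R : realType) (G : groupType).

Lemma fine_sum_measure d m (Y : 'I_m.+1 -> measurableType d)
    (alpha : weights R m.+1) (nu : forall i, probability (Y i) R)
    (A : set (disjoint_union Y)) : measurable A ->
  fine (sum_measure alpha nu A) =
    \sum_i alpha i * fine (nu i (@embed d m Y i @^-1` A)).
Proof.
move=> mA; rewrite /sum_measure -sum_fine => [|i _]; last first.
  by rewrite fin_numM// fin_num_measure//; exact: mA.
by apply: eq_bigr => i _; rewrite fineM// fin_num_measure//; exact: mA.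
Qed.

Let one_weight : weights R 1.
Proof. by exists (fun=> 1) => //; rewrite big_ord1. Defined.

Lemma stably_weakly_contained_refl d (X : measurableType d)
  (mu : probability X R) (a : mpaction G mu) : stably_weakly_contained a a.
Proof.
move=> k A F eps mA _ eps0.
exists 0%N, one_weight, (fun i => [set z | A i (projT2 z)]).
split => // [|g i j _]; first by move=> i; apply/measurable_unionP => l; exact: mA.
rewrite fine_sum_measure ?big_ord1/=; last first.
  have mA' i' : measurable [set z : disjoint_union (fun _ : 'I_1 => X) |
      A i' (projT2 z)] by apply/measurable_unionP => l; exact: mA.
  by apply: measurableI (mA' j);
    exact: (measurable_act_image (multiple a one_weight) g (mA' i)).
rewrite preimage_setI (sum_action_image one_weight (fun=> a)).
rewrite [X in _ - X](_ : _ = fine (mu (a g @` A i `&` A j))) ?subrr ?normr0//.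
exact: mul1r.
Qed.

Lemma product_weights m n (alpha : weights R m.+1) (beta : weights R n.+1) :
  exists N (h : 'I_N.+1 -> 'I_m.+1 * 'I_n.+1) (gamma : weights R N.+1),
    bijective h /\ forall p, gamma p = alpha (h p).1 * beta (h p).2.
Proof.
pose J := ('I_m.+1 * 'I_n.+1)%type.
have NE : #|{: J}|.-1.+1 = #|{: J}|.
  by rewrite prednK// card_prod !card_ord.
pose h (p : 'I_(#|{: J}|.-1.+1)) : J := enum_val (cast_ord NE p).
have bh : bijective h.
  exists (fun q => cast_ord (esym NE) (enum_rank q)) => x.
    by rewrite /h enum_valK cast_ordK.
  by rewrite /h cast_ordKV enum_rankK.
have ge0 p : 0 <= alpha (h p).1 * beta (h p).2 by rewrite mulr_ge0// wt_ge0.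
have sum1 : \sum_p alpha (h p).1 * beta (h p).2 = 1.
  rewrite -[LHS](reindex h (P := predT) (F := fun q => alpha q.1 * beta q.2))//=;
    last exact: onW_bij.
  rewrite -(pair_bigA _ (fun i j => alpha i * beta j))/=.
  under eq_bigr do rewrite -mulr_sumr wt_sum1 mulr1.
  by rewrite wt_sum1.
by exists (#|{: J}|.-1), h, (Weights ge0 sum1).
Qed.

Lemma stably_weakly_contained_trans d1 d2 d3 (X : measurableType d1)
    (Y : measurableType d2) (Z : measurableType d3) (mu : probability X R)
    (nu : probability Y R) (xi : probability Z R) (a : mpaction G mu)
    (b : mpaction G nu) (c : mpaction G xi) :
  stably_weakly_contained a b -> stably_weakly_contained b c ->
  stably_weakly_contained a c.
Proof.
move=> ab bc k A F eps mA finF eps0.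
have eps20 : 0 < eps / 2 by rewrite divr_gt0.
have [m [alpha [B [alpha0 mB abP]]]] := ab k A F (eps / 2) mA finF eps20.
pose K := ('I_k * 'I_m.+1)%type.
pose B' (p : 'I_#|{: K}|) : set Y :=
  @embed d2 m (fun=> Y) (enum_val p).2 @^-1` B (enum_val p).1.
have mB' p : measurable (B' p) by exact: mB.
have [n [beta [C [beta0 mC bcP]]]] := bc _ B' F (eps / 2) mB' finF eps20.
have [N [h [gamma [bh gammaE]]]] := product_weights alpha beta.
pose C' i p := @embed d3 n (fun=> Z) (h p).2 @^-1` C (enum_rank (i, (h p).1)).
pose D i : set (disjoint_union (fun _ : 'I_N.+1 => Z)) :=
  [set z | C' i (projT1 z) (projT2 z)].
have mD i : measurable (D i).
  apply/measurable_unionP => p.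
  by have /measurable_unionP/(_ (h p).2) := mC (enum_rank (i, (h p).1)).
exists N, gamma, D; split => // [p|g i j Fg].
  by rewrite gammaE mulr_gt0.
have mImg (e : measure_display) (W : measurableType e) (P : probability W R)
    (u : mpaction G P) E E' : measurable E -> measurable E' ->
    measurable (u g @` E `&` E').
  by move=> mE mE'; apply: measurableI => //; exact: measurable_act_image.
have {abP} := abP g i j Fg.
rewrite !fine_sum_measure; [|exact: mImg|exact: mImg].
pose v l := fine (nu (b g @` B' (enum_rank (i, l)) `&` B' (enum_rank (j, l)))).
rewrite (eq_bigr (fun l => alpha l * v l)) => [abP|l _]; last first.
  by rewrite preimage_setI sum_action_image /v /B' !enum_rankK.
pose w l := \sum_q beta q * fine (xi (c g @`
    (@embed d3 n (fun=> Z) q @^-1` C (enum_rank (i, l))) `&`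
    (@embed d3 n (fun=> Z) q @^-1` C (enum_rank (j, l))))).
have -> : \sum_p gamma p * fine (xi (@embed d3 N (fun=> Z) p @^-1`
    (multiple c gamma g @` D i `&` D j))) = \sum_l alpha l * w l.
  under [RHS]eq_bigr do rewrite /w mulr_sumr.
  rewrite pair_bigA/= (reindex h)/=; last exact: onW_bij.
  apply: eq_bigr => p _.
  by rewrite gammaE mulrA preimage_setI sum_action_image.
have vw l : `|v l - w l| < eps / 2.
  have := bcP g (enum_rank (i, l)) (enum_rank (j, l)) Fg.
  rewrite fine_sum_measure; last exact: mImg.
  under [X in _ - X]eq_bigr do rewrite preimage_setI sum_action_image.
  by [].
rewrite [X in `|X - _|](_ : _ = fine (mu (a g @` A i `&` A j)) -
  \sum_l alpha l * v l + \sum_l alpha l * v l); last by rewrite subrK.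
rewrite -addrA (le_lt_trans (ler_normD _ _))//.
rewrite [ltRHS]splitr ltr_leD//.
rewrite -sumrB (le_trans (ler_norm_sum _ _ _))//.
have -> : eps / 2 = \sum_l alpha l * (eps / 2) by rewrite -mulr_suml wt_sum1 mul1r.
apply: ler_sum => l _.
rewrite -mulrBr normrM ger0_norm ?wt_ge0// ler_wpM2l ?wt_ge0//.
exact: ltW (vw l).
Qed.

Lemma stably_weakly_equivalent_refl d (X : measurableType d)
  (mu : probability X R) (a : mpaction G mu) : stably_weakly_equivalent a a.
Proof. by split; exact: stably_weakly_contained_refl. Qed.

Lemma stably_weakly_equivalent_sym d1 d2 (X : measurableType d1)
    (Y : measurableType d2) (mu : probability X R) (nu : probability Y R)
    (a : mpaction G mu) (b : mpaction G nu) :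
  stably_weakly_equivalent a b -> stably_weakly_equivalent b a.
Proof. by case. Qed.

Lemma stably_weakly_equivalent_trans d1 d2 d3 (X : measurableType d1)
    (Y : measurableType d2) (Z : measurableType d3) (mu : probability X R)
    (nu : probability Y R) (xi : probability Z R) (a : mpaction G mu)
    (b : mpaction G nu) (c : mpaction G xi) :
  stably_weakly_equivalent a b -> stably_weakly_equivalent b c ->
  stably_weakly_equivalent a c.
Proof.
move=> [ab ba] [bc cb]; split; first exact: (stably_weakly_contained_trans ab).
exact: (stably_weakly_contained_trans cb).
Qed.

End stable_equivalence.

Section stable_relation.
Context (R : realType) (G : groupType) d (X : measurableType d).
Context (mu : probability X R).

Definition stable_rel : rel (mpaction G mu) :=
  fun a b => `[< stably_weakly_equivalent a b >].

Let stable_rel_refl : reflexive stable_rel.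
Proof. by move=> a; apply/asboolP; exact: stably_weakly_equivalent_refl. Qed.

Let stable_rel_sym : symmetric stable_rel.
Proof.
by move=> a b; apply/asboolP/asboolP; exact: stably_weakly_equivalent_sym.
Qed.

Let stable_rel_trans : transitive stable_rel.
Proof.
move=> b a c /asboolP ab /asboolP bc; apply/asboolP.
exact: stably_weakly_equivalent_trans ab bc.
Qed.

Canonical stable_equiv_rel :=
  EquivRel stable_rel stable_rel_refl stable_rel_sym stable_rel_trans.

End stable_relation.

Section hausdorff_distance.
Context (R : realType) (V : normedModType R).
Implicit Types (A B C : set V) (x y z : V) (M : R).

Definition dist_to x A : R := inf [set `|x - y| | y in A].

Definition hausdorff_dist A B : R :=
  Num.max (sup [set dist_to x B | x in A]) (sup [set dist_to y A | y in B]).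

Let nonempty_bounded M A := A !=set0 /\ forall x, A x -> `|x| <= M.

Let dist_to_lb x A : has_lbound [set `|x - y| | y in A].
Proof. by exists 0 => _ [y _ <-]. Qed.

Lemma dist_to_ge0 x A : A !=set0 -> 0 <= dist_to x A.
Proof.
move=> [y Ay]; apply: lb_le_inf; first by exists `|x - y|, y.
by move=> _ [z _ <-].
Qed.

Lemma dist_to_le x y A : A y -> dist_to x A <= `|x - y|.
Proof. by move=> Ay; apply: ge_inf => //; exists y. Qed.

Lemma dist_to_lip x y A : A !=set0 -> dist_to x A <= `|x - y| + dist_to y A.
Proof.
move=> [z0 Az0]; rewrite -lerBlDl; apply: lb_le_inf; first by exists `|y - z0|, z0.
move=> _ [z Az <-]; rewrite lerBlDl (le_trans (dist_to_le x Az))//.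
by rewrite -[x - z](subrKA y) ler_normD.
Qed.

Let dist_to_bounded M A B x : nonempty_bounded M A -> nonempty_bounded M B ->
  A x -> dist_to x B <= M + M.
Proof.
move=> [_ bA] [[y By] bB] Ax; rewrite (le_trans (dist_to_le x By))//.
by rewrite (le_trans (ler_normB _ _))// lerD//; [exact: bA|exact: bB].
Qed.

Let hausdorff_ub M A B : nonempty_bounded M A -> nonempty_bounded M B ->
  has_ubound [set dist_to x B | x in A].
Proof.
by move=> bA bB; exists (M + M) => _ [x Ax <-]; exact: dist_to_bounded bA bB Ax.
Qed.

Lemma hausdorff_distC A B : hausdorff_dist A B = hausdorff_dist B A.
Proof. by rewrite /hausdorff_dist maxC. Qed.

Lemma hausdorff_distP M A B e :
  nonempty_bounded M A -> nonempty_bounded M B ->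
  hausdorff_dist A B <= e <->
  (forall x, A x -> dist_to x B <= e) /\ (forall y, B y -> dist_to y A <= e).
Proof.
move=> bA bB; rewrite /hausdorff_dist ge_max; split=> [/andP[Ae Be]|[Ae Be]].
  split=> [x Ax|y By]; [apply: le_trans Ae|apply: le_trans Be].
    by apply: ub_le_sup; [exact: hausdorff_ub bB|exists x].
  by apply: ub_le_sup; [exact: hausdorff_ub bA|exists y].
apply/andP; split; apply: ge_sup.
- by case: bA => -[x Ax] _; exists (dist_to x B), x.
- by move=> _ [x Ax <-]; exact: Ae.
- by case: bB => -[x Bx] _; exists (dist_to x A), x.
- by move=> _ [x Bx <-]; exact: Be.
Qed.

Lemma hausdorff_dist_ge0 M A B :
  nonempty_bounded M A -> nonempty_bounded M B -> 0 <= hausdorff_dist A B.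
Proof.
move=> bA bB; have [/(_ (lexx _))[+ _] _] := hausdorff_distP (hausdorff_dist A B) bA bB.
case: (bA) => -[x Ax] _ /(_ x Ax); apply: le_trans.
by apply: dist_to_ge0; case: bB.
Qed.

Lemma hausdorff_dist_bounded M A B :
  nonempty_bounded M A -> nonempty_bounded M B -> hausdorff_dist A B <= M + M.
Proof.
by move=> bA bB; apply/(hausdorff_distP _ bA bB); split=> x;
  [exact: dist_to_bounded bA bB|exact: dist_to_bounded bB bA].
Qed.

Lemma hausdorff_distxx M A : nonempty_bounded M A -> hausdorff_dist A A = 0.
Proof.
move=> bA; apply/eqP; rewrite eq_le (hausdorff_dist_ge0 bA bA) andbT.
apply/(hausdorff_distP _ bA bA).
by split=> x Ax; rewrite (le_trans (dist_to_le x Ax))// subrr normr0.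
Qed.

Let triangle_half M A B C x :
  nonempty_bounded M A -> nonempty_bounded M B -> nonempty_bounded M C ->
  A x -> dist_to x C <= hausdorff_dist A B + hausdorff_dist B C.
Proof.
move=> bA bB bC Ax.
have [/(_ (lexx _))[AB _] _] := hausdorff_distP (hausdorff_dist A B) bA bB.
have [/(_ (lexx _))[BC _] _] := hausdorff_distP (hausdorff_dist B C) bB bC.
rewrite -lerBlDr; apply: le_trans (AB _ Ax).
case: (bB) => -[y0 By0] _; apply: lb_le_inf; first by exists `|x - y0|, y0.
move=> _ [y By <-]; rewrite lerBlDr.
apply: le_trans (dist_to_lip x y _) _; first by case: bC.
by rewrite lerD2l BC.
Qed.

Lemma hausdorff_dist_triangle M A B C :
  nonempty_bounded M A -> nonempty_bounded M B -> nonempty_bounded M C ->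
  hausdorff_dist A C <= hausdorff_dist A B + hausdorff_dist B C.
Proof.
move=> bA bB bC; apply/(hausdorff_distP _ bA bC); split=> [x Ax|z Cz].
  exact: triangle_half bA bB bC Ax.
rewrite addrC (hausdorff_distC B C) (hausdorff_distC A B).
exact: triangle_half bC bB bA Cz.
Qed.

End hausdorff_distance.

Section weak_distance.
Context (R : realType) (G : groupType) (e : nat -> G).

Section profiles.
Context d (Y : measurableType d) (nu : probability Y R) (a : mpaction G nu).

(* Pieces are allowed to be empty. This does not affect [stable_dist], which
   only involves partitions of nonatomic spaces: there, a partition with empty
   pieces is a limit of partitions without. *)
Definition indexed_partition k (A : 'I_k -> set Y) : Prop :=
  [/\ forall i, measurable (A i), trivIset setT A & \bigcup_i A i = setT].

(* A point of [0,1]^(n x k x k): row p is the k x k array of the coordinates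
   (p, q, r), flattened by mxvec. The norm of 'M[R]_(n, k * k) is the sup norm.
   e 0 plays the role of gamma_1. *)
Definition profile n k (A : 'I_k -> set Y) : 'M[R]_(n, k * k) :=
  \matrix_(p < n)
    mxvec (\matrix_(q < k, r < k) fine (nu (a (e p) @` A q `&` A r))).

(* The closed set C_{n,k}(a). *)
Definition profiles n k : set 'M[R]_(n, k * k) :=
  closure [set profile n A | A in @indexed_partition k].
Arguments profiles n k : clear implicits.

Lemma profile_norm n k (A : 'I_k -> set Y) :
  indexed_partition A -> `|profile n A| <= 1.
Proof.
move=> [mA _ _]; rewrite -[leLHS]/(mx_norm (profile n A)) mx_normrE; apply: bigmax_le => //.
move=> [p s] _ /=; rewrite mxE; case/mxvec_indexP: s => q r.
rewrite mxvecE mxE ger0_norm ?fine_ge0//.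
have mI : measurable (a (e p) @` A q `&` A r).
  by apply: measurableI => //; exact: measurable_act_image.
by rewrite -lee_fin fineK ?fin_num_measure// probability_le1.
Qed.

Lemma profiles_bounded n k :
  profiles n k.+1 !=set0 /\ forall x, profiles n k.+1 x -> `|x| <= 2.
Proof.
split=> [|x clx].
  exists (profile n (fun i : 'I_k.+1 => if i == ord0 then setT else set0)).
  apply: subset_closure; eexists; last by [].
  split=> [i|i j _ _|]; first by case: ifP.
    by case: ifPn => [/eqP->|_]; case: ifPn => [/eqP->|_]//; rewrite ?set0I ?setI0 => -[].
  by rewrite -subTset => y _; exists ord0.
have [_ [[A pA <-] xA]] := clx _ (nbhsx_ballx x 1 ltr01).
move: xA; rewrite -ball_normE /= => xA.
rewrite -[x](subrK (profile n A)) (le_trans (ler_normD _ _))//.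
by rewrite (_ : 2 = 1 + 1)// lerD ?profile_norm// ltW.
Qed.

End profiles.
Arguments profiles {d Y nu} a n k _.

(* Indices are shifted: n.+1 and k.+1 range over the positive integers. *)
Definition weak_dist d1 d2 (Y : measurableType d1) (Z : measurableType d2)
    (nu : probability Y R) (xi : probability Z R)
    (a : mpaction G nu) (b : mpaction G xi) : R :=
  fine (\sum_(0 <= n <oo) \sum_(0 <= k <oo)
    (2 ^- (n.+1 + k.+1) *
     hausdorff_dist (profiles a n.+1 k.+1) (profiles b n.+1 k.+1))%:E)%E.

Section weak_dist_metric.
Context d1 d2 d3 (Y : measurableType d1) (Z : measurableType d2)
  (W : measurableType d3).
Context (nu : probability Y R) (xi : probability Z R) (om : probability W R).
Context (a : mpaction G nu) (b : mpaction G xi) (c : mpaction G om).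

Lemma weak_distC : weak_dist a b = weak_dist b a.
Proof.
by congr fine; apply: eq_eseriesr => n _; apply: eq_eseriesr => k _;
  rewrite hausdorff_distC.
Qed.

Lemma weak_distxx : weak_dist a a = 0.
Proof.
rewrite /weak_dist eseries0// => n _ _; rewrite eseries0// => k _ _.
by rewrite (hausdorff_distxx (profiles_bounded a n.+1 k)) mulr0.
Qed.

End weak_dist_metric.

Let term d1 d2 (Y : measurableType d1) (Z : measurableType d2)
    (nu : probability Y R) (xi : probability Z R)
    (a : mpaction G nu) (b : mpaction G xi) (n k : nat) : \bar R :=
  (2 ^- (n.+1 + k.+1) *
   hausdorff_dist (profiles a n.+1 k.+1) (profiles b n.+1 k.+1))%:E.

Let term_ge0 d1 d2 (Y : measurableType d1) (Z : measurableType d2)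
    (nu : probability Y R) (xi : probability Z R)
    (a : mpaction G nu) (b : mpaction G xi) n k : (0 <= term a b n k)%E.
Proof.
rewrite lee_fin mulr_ge0 ?invr_ge0 ?exprn_ge0//.
exact: (hausdorff_dist_ge0 (profiles_bounded a n.+1 k) (profiles_bounded b n.+1 k)).
Qed.

Let term_sum_fin d1 d2 (Y : measurableType d1) (Z : measurableType d2)
    (nu : probability Y R) (xi : probability Z R)
    (a : mpaction G nu) (b : mpaction G xi) :
  (\sum_(0 <= n <oo) \sum_(0 <= k <oo) term a b n k)%E \is a fin_num.
Proof.
rewrite ge0_fin_numE; last first.
  by apply: nneseries_ge0 => n _ _; apply: nneseries_ge0 => k _ _; exact: term_ge0.
apply: (@le_lt_trans _ _ (2 + 2)%:E); last exact: ltry.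
apply: (@le_trans _ _ (\sum_(0 <= n <oo) ((2 + 2) / (2 ^ n.+1)%:R)%:E)%E); last first.
  exact: epsilon_trick0.
apply: lee_nneseries => [n _ _|n _].
  by apply: nneseries_ge0 => k _ _; exact: term_ge0.
apply: (@le_trans _ _
    (\sum_(0 <= k <oo) ((2 + 2) / (2 ^ n.+1)%:R / (2 ^ k.+1)%:R)%:E)%E); last first.
  by apply: epsilon_trick0; rewrite divr_ge0.
apply: lee_nneseries => [k _ _|k _]; first exact: term_ge0.
rewrite lee_fin mulrC -mulrA !natrX -invfM -exprD ler_wpM2r ?invr_ge0 ?exprn_ge0//.
exact: (hausdorff_dist_bounded (profiles_bounded a n.+1 k) (profiles_bounded b n.+1 k)).
Qed.

Lemma weak_dist_triangle d1 d2 d3 (Y : measurableType d1) (Z : measurableType d2)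
    (W : measurableType d3)
    (nu : probability Y R) (xi : probability Z R) (om : probability W R)
    (a : mpaction G nu) (b : mpaction G xi) (c : mpaction G om) :
  weak_dist a c <= weak_dist a b + weak_dist b c.
Proof.
have ge0 := term_ge0.
rewrite -lee_fin EFinD !fineK; try exact: term_sum_fin.
rewrite -nneseriesD; last 2 first.
- by move=> n _ _; apply: nneseries_ge0 => k _ _; exact: term_ge0.
- by move=> n _ _; apply: nneseries_ge0 => k _ _; exact: term_ge0.
apply: lee_nneseries => [n _ _|n _].
  by apply: nneseries_ge0 => k _ _; exact: term_ge0.
rewrite -nneseriesD; last 2 first.
- by move=> k _ _; exact: term_ge0.
- by move=> k _ _; exact: term_ge0.
apply: lee_nneseries => [k _ _|k _]; first exact: term_ge0.
rewrite -EFinD lee_fin -mulrDr ler_wpM2l ?invr_ge0 ?exprn_ge0//.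
exact: (hausdorff_dist_triangle (profiles_bounded a n.+1 k)
  (profiles_bounded b n.+1 k) (profiles_bounded c n.+1 k)).
Qed.

(* The standard probability space carrying the trivial action is the real line
   with the uniform distribution on [0, 1]. *)
Definition stable_dist d1 d2 (Y : measurableType d1) (Z : measurableType d2)
    (nu : probability Y R) (xi : probability Z R)
    (a : mpaction G nu) (b : mpaction G xi) : R :=
  let iota := trivial_action G (uniform_prob (@ltr01 R)) in
  weak_dist (prod_action a iota) (prod_action b iota).

End weak_distance.
Arguments profiles {R G} e {d Y nu} a n k _.

Section stable_space.
Context (R : realType) (G : groupType) d (X : measurableType d).
Context (mu : probability X R) (e : nat -> G).
Local Open Scope quotient_scope.

(* The quotient depends on the enumeration only through its topology, which is
   that of the metric d_s; the latter does not depend on the representatives. *)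
Definition stable_space (_ : nat -> G) : Type :=
  {eq_quot (@stable_equiv_rel R G d X mu)}.

Local Notation Q := (stable_space e).

HB.instance Definition _ := Quotient.on Q.
HB.instance Definition _ := Choice.on Q.

Let sball (x : Q) (r : R) (y : Q) : Prop :=
  stable_dist e (repr x) (repr y) < r.

Let sball_center x (r : R) : 0 < r -> sball x r x.
Proof. by rewrite /sball /stable_dist weak_distxx. Qed.

Let sball_sym x y (r : R) : sball x r y -> sball y r x.
Proof. by rewrite /sball /stable_dist weak_distC. Qed.

Let sball_triangle x y z (r1 r2 : R) :
  sball x r1 y -> sball y r2 z -> sball x (r1 + r2) z.
Proof.
rewrite /sball => xy yz; apply: le_lt_trans (ltrD xy yz).
exact: weak_dist_triangle.
Qed.

HB.instance Definition _ := hasNbhs.Build Q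
  (nbhs_ (entourage_ sball)).
HB.instance Definition _ := @Nbhs_isPseudoMetric.Build R Q
  (entourage_ sball) erefl sball sball_center sball_sym sball_triangle erefl.

End stable_space.
Arguments stable_space {R G d X} mu e.

Lemma stable_space_eqP (R : realType) (G : groupType) d (X : measurableType d)
    (mu : probability X R) (e : nat -> G) (a b : mpaction G mu) :
  (\pi_(stable_space mu e) a = \pi_(stable_space mu e) b)%qT <->
  stably_weakly_equivalent a b.
Proof.
split=> [/(@eqmodP _ (@stable_equiv_rel R G d X mu))/asboolP//|ab].
exact/(@eqmodP _ (@stable_equiv_rel R G d X mu))/asboolP.
Qed.

Section convex_structure.
Context (R : realType) (G : groupType).

Definition isomorphic_actions d1 d2 (X : measurableType d1)
    (Y : measurableType d2) (mu : probability X R) (nu : probability Y R)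
    (a : mpaction G mu) (b : mpaction G nu) : Prop :=
  exists phi : X -> Y,
    [/\ bijective phi, measurable_fun setT phi,
        forall A, measurable A -> measurable (phi @` A),
        forall B, measurable B -> mu (phi @^-1` B) = nu B &
        forall g x, phi (a g x) = b g (phi x)].

Section pair_weights.
Context (t : {i01 R}).

Let pair_wt (i : 'I_2) : R := if i == ord0 then t%:num else 1 - t%:num.

Let pair_wt_ge0 i : 0 <= pair_wt i.
Proof. by rewrite /pair_wt; case: ifP => _ //; rewrite subr_ge0. Qed.

Let pair_wt_sum1 : \sum_i pair_wt i = 1.
Proof. by rewrite big_ord_recl big_ord1 /pair_wt/= addrC subrK. Qed.

Definition pair_weights : weights R 2 := Weights pair_wt_ge0 pair_wt_sum1.

End pair_weights.

Context d (X : measurableType d) (mu : probability X R).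

Definition conv_action (t : {i01 R}) (a b : mpaction G mu) :
    mpaction G (sum_measure (pair_weights t) (fun=> mu)) :=
  sum_action (pair_weights t) (fun i => if i == ord0 then a else b).

Local Open Scope quotient_scope.

(* The class of an action c on (X, mu) isomorphic to t a + (1 - t) b. When
   (X, mu) is standard, the isomorphism theorem provides such a c, and its class
   does not depend on c, a, b; the default value of xget is then not used. *)
Definition stable_conv (e : nat -> G) (t : {i01 R})
    (x y : stable_space mu e) : stable_space mu e :=
  xget x [set z | exists a b c : mpaction G mu,
    [/\ \pi_(stable_space mu e) a = x, \pi_(stable_space mu e) b = y,
        \pi_(stable_space mu e) c = z &
        isomorphic_actions c (conv_action t a b)]].

End convex_structure.

Definition homeomorphism_onto (T U : topologicalType) (f : T -> U) (S : set U) :=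
  [/\ continuous f, range f = S &
      exists g : U -> T, cancel f g /\ {within S, continuous g}].

(* Main.v *)
From HB Require Import structures.
From mathcomp Require Import all_boot all_order all_algebra.
From mathcomp Require Import all_classical all_reals all_analysis.
From mathcomp Require Import measurable_realfun ring lra.

Require Import Defs.

Set Implicit Arguments.
Unset Strict Implicit.
Unset Printing Implicit Defensive.

Import Order.TTheory GRing.Theory Num.Theory.
Import numFieldNormedType.Exports.

Local Open Scope classical_set_scope.
Local Open Scope ring_scope.

(** A profile of an action is the array of the masses [nu (g A :&: B)] for the pieces
    [A], [B] of a finite partition and finitely many group elements [g]. The theorem
    holds because, up to stable weak equivalence, an action amounts to a family of
    finite-dimensional compact convex sets, the closed convex hulls of its sets of
    profiles, and such a family is faithfully and affinely described by support
    functions.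

    Invariants. For a linear functional [c] on profiles of given dimensions let
    [support a c] be the supremum of [c] over the profiles of [a]. Two actions are
    stably weakly equivalent if and only if all their support functions agree
    ([stably_weakly_equivalentP]). Indeed a profile of a multiple of [b] is a convex
    combination of profiles of [b], so stable weak containment says that the
    profiles of [a] are in the closed convex hull of those of [b]; by separation
    ([support_function_approx]) this is an inequality of support functions. The
    support function of a weighted sum of actions is the weighted sum of their
    support functions ([support_sum]).

    Distance. The product of [a] with the trivial action on the unit interval has
    as closed set of profiles exactly the closed convex hull of the profiles of [a]
    ([profilesP]): one inclusion uses the interval as a random choice between
    partitions, the other is Fubini. Hence the stable distance is a weighted sum of
    Hausdorff distances of these hulls, and the vector of all support values,
    suitably weighted, is a bounded function that depends on the action in a
    1-Lipschitz way ([support_vector_lip]). This gives a continuous injective affine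
    map into the Banach space of bounded functions on the set of functionals.

    Compactness. The space of classes is compact ([stable_space_compact]), so the
    map is a homeomorphism onto a compact convex set. Along an ultrafilter a family
    of actions on [X] has a limit ([ultralimit_action]): observe each action through
    countably many sets, code a point by the answers along its orbit, and take the
    ultralimit of the laws of the codes on clopen sets. It extends to a
    shift-invariant law on the Cantor cube, because consistent masses of cylinders
    are realized on the unit interval ([tree_masses]). Among the observed sets are
    almost optimal partitions for countably many functionals, so that support
    functions do not drop in the limit; the approximation of measurable sets by
    clopen sets ([fin_dep_approx]) shows that they do not jump up either. Therefore
    the sets of profiles converge ([limit_stable_dist]). Fine partitions among the
    observed sets keep the limit law nonatomic.

    The isomorphism theorem for standard nonatomic probability spaces
    ([standard_isomorphism]) is used twice: to move the limit action back to [X], and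
    to realize on [X] the convex combinations of actions, which live on two copies
    of [X]. It is proved by realizing every such space as a retract of the Cantor
    space, mapping the unit interval to it through the tree of cylinders, and
    correcting null sets by a measurable Schroeder-Bernstein argument. *)

(** * The pairing of matrices, and closed convex sets *)

Section pairing.
Context (R : realType) (m n : nat).
Implicit Types (c x y : 'M[R]_(m, n)) (K : set 'M[R]_(m, n)).

Lemma entry_le_norm x i j : `|x i j| <= `|x|.
Proof.
rewrite [leRHS]/Num.norm/= mx_normrE.
by apply: (le_bigmax _ (fun ij : 'I_m * 'I_n => `|x ij.1 ij.2|) (i, j)).
Qed.

Lemma norm_lt_entries x r : 0 < r -> (forall i j, `|x i j| < r) -> `|x| < r.
Proof.
move=> r0 xr; rewrite [ltLHS]/Num.norm/= mx_normrE; exact: bigmax_lt.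
Qed.

Lemma subr_entry x y i j : (x - y) i j = x i j - y i j.
Proof. by rewrite !mxE. Qed.

(** Every linear functional on a space of matrices has this form. Its norm, dual
    to the sup norm, is [l1norm]. *)
Definition pairing c x : R := \sum_i \sum_j c i j * x i j.

Definition l1norm c : R := \sum_i \sum_j `|c i j|.

Lemma l1norm_ge0 c : 0 <= l1norm c.
Proof. by apply: sumr_ge0 => i _; apply: sumr_ge0. Qed.

Lemma pairingC c x : pairing c x = pairing x c.
Proof. by apply: eq_bigr => i _; apply: eq_bigr => j _; rewrite mulrC. Qed.

Lemma pairingDr c x y : pairing c (x + y) = pairing c x + pairing c y.
Proof.
rewrite /pairing -big_split/=; apply: eq_bigr => i _.
by rewrite -big_split/=; apply: eq_bigr => j _; rewrite mxE mulrDr.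
Qed.

Lemma pairingZr c t x : pairing c (t *: x) = t * pairing c x.
Proof.
rewrite /pairing mulr_sumr; apply: eq_bigr => i _.
by rewrite mulr_sumr; apply: eq_bigr => j _; rewrite mxE mulrCA.
Qed.

Lemma pairingNr c x : pairing c (- x) = - pairing c x.
Proof. by rewrite -scaleN1r pairingZr mulN1r. Qed.

Lemma pairingBr c x y : pairing c (x - y) = pairing c x - pairing c y.
Proof. by rewrite pairingDr pairingNr. Qed.

Lemma pairing_sumr (I : finType) c (F : I -> 'M[R]_(m, n)) :
  pairing c (\sum_i F i) = \sum_i pairing c (F i).
Proof.
elim/big_ind2 : _ => [|x u y v <- <-|//]; last by rewrite pairingDr.
by rewrite -(scale0r 0) pairingZr mul0r.
Qed.

Lemma pairingBl c y x : pairing (c - y) x = pairing c x - pairing y x.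
Proof. by rewrite 3!(pairingC _ x) pairingBr. Qed.

Lemma pairingZl t c x : pairing (t *: c) x = t * pairing c x.
Proof. by rewrite 2!(pairingC _ x) pairingZr. Qed.

Lemma pairing_le c x b : (forall i j, `|x i j| <= b) ->
  `|pairing c x| <= l1norm c * b.
Proof.
move=> xb; rewrite (le_trans (ler_norm_sum _ _ _))// /l1norm mulr_suml.
apply: ler_sum => i _; rewrite (le_trans (ler_norm_sum _ _ _))// mulr_suml.
by apply: ler_sum => j _; rewrite normrM ler_wpM2l.
Qed.

Lemma pairing_le_norm c x : `|pairing c x| <= l1norm c * `|x|.
Proof. by apply: pairing_le => i j; exact: entry_le_norm. Qed.

Lemma pairing_small c eps : 0 < eps -> exists2 delta, 0 < delta &
  forall x, `|x| <= delta -> `|pairing c x| <= eps.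
Proof.
move=> eps0; have L0 : 0 < l1norm c + 1 by rewrite ltr_wpDl ?l1norm_ge0.
exists (eps / (l1norm c + 1)); first by rewrite divr_gt0.
move=> x xd; apply: le_trans (pairing_le_norm c x) _.
apply: le_trans (ler_wpM2l (l1norm_ge0 c) xd) _.
by rewrite mulrCA -[leRHS]mulr1 ler_pM2l// ler_pdivrMr// mul1r lerDl.
Qed.

Lemma pairing_ge0 x : 0 <= pairing x x.
Proof. by apply: sumr_ge0 => i _; apply: sumr_ge0 => j _; rewrite -expr2 sqr_ge0. Qed.

Lemma norm_lt_pairing x r : 0 < r -> pairing x x < r ^+ 2 -> `|x| < r.
Proof.
move=> r0 xr; apply: norm_lt_entries => // i j.
rewrite -(@ltr_pXn2r _ 2)// ?nnegrE// ?(ltW r0)//; apply: le_lt_trans xr.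
rewrite /pairing (bigD1 i)//= (bigD1 j)//= real_normK ?num_real// -expr2.
rewrite -addrA lerDl addr_ge0//.
  by apply: sumr_ge0 => k _; rewrite -expr2 sqr_ge0.
by apply: sumr_ge0 => k _; apply: sumr_ge0 => l _; rewrite -expr2 sqr_ge0.
Qed.

(** Separation: a point at which no linear functional exceeds its supremum over a
    convex set [K] is in the closure of [K]. If it had a positive distance to [K]
    for the Euclidean norm, then with [y1] an almost nearest point of [K] the
    functional [x - y1] would separate it from [K]. *)
Lemma support_function_approx K (B : R) (x : 'M[R]_(m, n)) :
  K !=set0 -> (forall y, K y -> `|y| <= B) ->
  (forall y z t, K y -> K z -> 0 < t -> t < 1 -> K (t *: y + (1 - t) *: z)) ->
  (forall c u, (forall y, K y -> pairing c y <= u) -> pairing c x <= u) ->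
  forall eps, 0 < eps -> exists2 y, K y & `|x - y| < eps.
Proof.
move=> [y0 Ky0] KB Kconv xK eps eps0; apply: contrapT => /forall2NP far.
pose q (y : 'M[R]_(m, n)) := pairing (x - y) (x - y).
have qeps y : K y -> eps ^+ 2 <= q y.
  move=> Ky; rewrite leNgt; apply/negP => /norm_lt_pairing - /(_ eps0).
  by have [|] := far y.
pose D := inf [set q y | y in K].
have hD : has_inf [set q y | y in K].
  by split; [exists (q y0), y0|exists 0 => _ [y Ky <-]; exact: pairing_ge0].
have D0 : 0 < D.
  apply: (@lt_le_trans _ _ (eps ^+ 2)); first by rewrite exprn_gt0.
  apply: lb_le_inf; first by case: hD.
  by move=> _ [y Ky <-]; exact: qeps.
have qD y : K y -> D <= q y by move=> Ky; apply: ge_inf; [case: hD|exists y].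
pose L : R := \sum_(i < m) \sum_(j < n) (B + B) ^+ 2 + 1.
have B0 : 0 <= B by exact: le_trans (KB _ Ky0).
have L1 : 1 <= L.
  by rewrite lerDr; apply: sumr_ge0 => i _; apply: sumr_ge0 => j _; rewrite sqr_ge0.
have L0 : 0 < L by exact: lt_le_trans L1.
have KL y z : K y -> K z -> pairing (y - z) (y - z) <= L.
  move=> Ky Kz; rewrite ler_wpDr//; apply: ler_sum => i _; apply: ler_sum => j _.
  rewrite -expr2 -[leLHS]real_normK ?num_real// ler_pXn2r ?nnegrE// ?addr_ge0//.
  rewrite (le_trans (entry_le_norm _ _ _))// (le_trans (ler_normB _ _))//.
  by rewrite lerD// KB.
(* Moving from [y1] towards [y] by the fraction [t] changes the squared distance
   by a linear term in [t] and a quadratic term; [t] is so small that the latter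
   is at most half of [D] times [t]. *)
pose t := Num.min (2^-1) (D / (2 * L)).
have t0 : 0 < t by rewrite lt_min invr_gt0 ltr0n/= divr_gt0// mulr_gt0.
have t1 : t < 1.
  by rewrite /t gt_min invf_lt1 ?ltr0n// ltr1n.
have tL : t * L <= D / 2.
  apply: (@le_trans _ _ (D / (2 * L) * L)).
    by rewrite ler_wpM2r// ?(ltW L0)// /t ge_min lexx orbT.
  by rewrite invfM mulrA mulfVK// gt_eqF.
have e0 : 0 < t * (D / 2) by rewrite mulr_gt0// divr_gt0.
have [_ [y1 Ky1 <-] qy1] := inf_adherent e0 hD; rewrite -/D in qy1.
have key y : K y -> pairing (x - y1) (y - y1) <= D / 2.
  move=> Ky; have := qD _ (Kconv y y1 t Ky Ky1 t0 t1).
  have -> : q (t *: y + (1 - t) *: y1) =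
      q y1 - 2 * t * pairing (x - y1) (y - y1) + t ^+ 2 * pairing (y - y1) (y - y1).
    rewrite /q.
    have -> : x - (t *: y + (1 - t) *: y1) = (x - y1) - t *: (y - y1).
      by apply/matrixP => i j; rewrite !mxE; ring.
    rewrite !(pairingBl (x - y1)) !(pairingBr _ (x - y1)) !pairingZl !pairingZr.
    by rewrite [pairing (y - y1) (x - y1)]pairingC; ring.
  move=> Dq.
  have h1 : 2 * t * pairing (x - y1) (y - y1) <= t * (D / 2) + t * (t * L).
    have : t ^+ 2 * pairing (y - y1) (y - y1) <= t * (t * L).
      by rewrite expr2 -mulrA !ler_pM2l// KL.
    by move: Dq qy1; lra.
  have : t * (2 * pairing (x - y1) (y - y1)) <= t * D.
    by have := ler_wpM2l (ltW t0) tL; move: h1; lra.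
  by rewrite ler_pM2l//; lra.
have h : D <= pairing (x - y1) x - pairing (x - y1) y1 by rewrite -pairingBr; exact: qD.
have := xK (x - y1) (pairing (x - y1) y1 + D / 2); apply/not_implyP; split.
  by move=> y Ky; have := key y Ky; rewrite pairingBr; lra.
by move: h D0; lra.
Qed.

End pairing.

Lemma half_power_small (R : realType) (eps : R) : 0 < eps ->
  exists m, forall n, (m <= n)%N -> 2^-1 ^+ n < eps.
Proof.
move=> eps0.
have h : (2^-1 : R) ^+ n @[n --> \oo] --> (0 : R).
  by apply: cvg_expr; rewrite ger0_norm ?invr_ge0// invf_lt1// ltr1n.
have /cvgrPdist_lt/(_ _ eps0)[m _ hm] := h; exists m => n /hm.
by rewrite sub0r normrN ger0_norm// exprn_ge0// invr_ge0.
Qed.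

Section ultralimit.
Context (R : realType) (I : Type) (U : set_system I).
Hypothesis UU : UltraFilter U.

(** The supremum makes the ultralimit a total function; it is the limit along [U]
    for bounded families. *)
Definition ulim (f : I -> R) : R := sup [set t | U [set i | t <= f i]].

Lemma ulimP (f : I -> R) B : (forall i, `|f i| <= B) ->
  forall eps, 0 < eps -> U [set i | `|f i - ulim f| < eps].
Proof.
move=> fB eps eps0; pose S := [set t | U [set i | t <= f i]].
have UT : U setT by exact: filterT.
have hS : has_sup S.
  split.
    exists (- B); rewrite /S/=; apply: filterS UT => i _ /=.
    by have := fB i; rewrite ler_norml => /andP[].
  exists B => t /= /filter_ex[i /= ti]; apply: le_trans ti _.
  by have := fB i; rewrite ler_norml => /andP[].
have [t St tl] := sup_adherent eps0 hS.
have : ~ U [set i | ulim f + eps <= f i].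
  move=> h; have : ulim f + eps <= ulim f.
    by apply: ub_le_sup => //; case: hS.
  by rewrite gerDl leNgt eps0.
have [//|] := in_ultra_setVsetC [set i | ulim f + eps <= f i] UU.
move=> Uc _; apply: filterS (filterI St Uc) => i /= [ti /negP].
rewrite -ltNge => fi; rewrite ltr_norml; apply/andP; split.
  by rewrite ltrBrDr addrC; exact: lt_le_trans tl ti.
by rewrite ltrBlDr addrC.
Qed.

Lemma ulim_unique (f : I -> R) r :
  (forall eps, 0 < eps -> U [set i | `|f i - r| < eps]) -> ulim f = r.
Proof.
move=> fr; apply/eqP; rewrite eq_le; apply/andP; split.
  apply: ge_sup.
    exists (r - 1); rewrite /=; apply: filterS (fr 1 ltr01) => i /=.
    by rewrite ltr_norml => /andP[]; lra.
  move=> t /= Ut; apply/ler_addgt0Pr => eps eps0.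
  by have [i /= [ti]] := filter_ex (filterI Ut (fr _ eps0));
    rewrite ltr_norml => /andP[]; lra.
apply/ler_addgt0Pr => eps eps0; rewrite -lerBlDr.
apply: ub_le_sup.
  exists (r + 1) => t /= Ut.
  by have [i /= [ti]] := filter_ex (filterI Ut (fr _ ltr01));
    rewrite ltr_norml => /andP[]; lra.
by rewrite /=; apply: filterS (fr _ eps0) => i /=; rewrite ltr_norml => /andP[]; lra.
Qed.

End ultralimit.

(** * Masses of sets and measurable partitions *)

Section probability_of_sets.
Context (R : realType) d (Y : measurableType d) (nu : probability Y R).
Implicit Types A B N E : set Y.

Lemma pr_ge0 A : 0 <= fine (nu A).
Proof. exact: fine_ge0. Qed.

Lemma pr_le1 A : measurable A -> fine (nu A) <= 1.
Proof.
by move=> mA; rewrite -lee_fin fineK ?fin_num_measure// probability_le1.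
Qed.

Lemma pr_setT : fine (nu setT) = 1.
Proof. by rewrite probability_setT. Qed.

Lemma pr_le A B : measurable A -> measurable B -> A `<=` B ->
  fine (nu A) <= fine (nu B).
Proof.
move=> mA mB AB; rewrite fine_le ?fin_num_measure//.
by rewrite le_measure// inE.
Qed.

Lemma pr_setU A B : measurable A -> measurable B -> A `&` B = set0 ->
  fine (nu (A `|` B)) = fine (nu A) + fine (nu B).
Proof.
by move=> mA mB AB; rewrite measureU// fineD ?fin_num_measure.
Qed.

Lemma pr_setU_le A B : measurable A -> measurable B ->
  fine (nu (A `|` B)) <= fine (nu A) + fine (nu B).
Proof.
move=> mA mB; rewrite -fineD ?fin_num_measure// fine_le ?fin_num_measure//.
- exact: measurableU.
- by rewrite fin_numD !fin_num_measure.
- exact: measureU2.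
Qed.

Lemma pr_setC A : measurable A -> fine (nu (~` A)) = 1 - fine (nu A).
Proof.
by move=> mA; rewrite probability_setC// fineB ?fin_num_measure.
Qed.

(** How two sets that differ only inside a small set [N] are compared. *)
Lemma pr_agree A B N : measurable A -> measurable B -> measurable N ->
  (forall x, ~ N x -> (A x <-> B x)) ->
  `|fine (nu A) - fine (nu B)| <= fine (nu N).
Proof.
have half A' B' : measurable A' -> measurable B' -> measurable N ->
  (forall x, ~ N x -> (A' x <-> B' x)) -> fine (nu A') <= fine (nu B') + fine (nu N).
  move=> mA mB mN AB; apply: le_trans (pr_setU_le mB mN).
  apply: pr_le => //; first exact: measurableU.
  move=> x Ax; have [Nx|nNx] := pselect (N x); [by right|left].
  exact/(AB _ nNx).
move=> mA mB mN AB.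
have BA x : ~ N x -> (B x <-> A x) by move=> /AB[]; split.
have := half _ _ mA mB mN AB; have := half _ _ mB mA mN BA.
by rewrite ler_norml => h1 h2; apply/andP; split; lra.
Qed.

Lemma measurable_mem_seq (I : eqType) (f : Y -> I) (s : seq I) :
  (forall i, measurable (f @^-1` [set i])) ->
  measurable [set x | f x \in s].
Proof.
move=> mf; elim: s => [|i s IH].
  by rewrite (_ : [set _ | _] = set0)// -subset0 => x.
rewrite (_ : [set _ | _] = f @^-1` [set i] `|` [set x | f x \in s]).
  exact: measurableU.
apply/seteqP; split => x /=; rewrite in_cons; first by move=> /orP[/eqP|]; [left|right].
by move=> [->|->]; rewrite ?eqxx ?orbT.
Qed.

Lemma pr_sum_fibers (I : finType) (f : Y -> I) E : measurable E ->
  (forall i, measurable (f @^-1` [set i])) ->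
  fine (nu E) = \sum_i fine (nu (E `&` f @^-1` [set i])).
Proof.
move=> mE mf.
have key (s : seq I) : uniq s ->
    fine (nu (E `&` [set x | f x \in s])) =
    \sum_(i <- s) fine (nu (E `&` f @^-1` [set i])).
  elim: s => [_|i s IH /andP[nis us]].
    rewrite big_nil (_ : _ `&` _ = set0) ?measure0//.
    by rewrite -subset0 => x [].
  rewrite big_cons -IH// -pr_setU; last first.
  - rewrite -subset0 => x [[_ /= fi] [_ /=]]; rewrite fi => fs.
    by rewrite fs in nis.
  - by apply: measurableI => //; exact: measurable_mem_seq.
  - exact: measurableI.
  rewrite -setIUr; congr (fine (nu (E `&` _))).
  apply/seteqP; split => x /=; rewrite in_cons; first by move=> /orP[/eqP|]; [left|right].
  by move=> [->|->]; rewrite ?eqxx ?orbT.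
rewrite -[RHS]big_enum/= -key ?enum_uniq//; congr (fine (nu _)).
by apply/seteqP; split => x; [move=> Ex; split => //=; rewrite mem_enum|case].
Qed.

Lemma measurable_exists (I : finType) (A : I -> set Y) :
  (forall i, measurable (A i)) -> measurable [set x | exists i, A i x].
Proof.
move=> mA; rewrite (_ : [set _ | _] = \bigcup_(i in setT) A i).
  by apply: fin_bigcup_measurable => //; exact: finite_finset.
by apply/seteqP; split => x [i]; [exists i|move=> _; exists i].
Qed.

Lemma measurable_forall (I : finType) (A : I -> set Y) :
  (forall i, measurable (A i)) -> measurable [set x | forall i, A i x].
Proof.
move=> mA; rewrite (_ : [set _ | _] = \bigcap_(i in setT) A i).
  by apply: fin_bigcap_measurable => //; exact: finite_finset.
by apply/seteqP; split => x Ax i; [move=> _|]; exact: Ax.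
Qed.

Lemma pr_exists_le (I : finType) (A : I -> set Y) :
  (forall i, measurable (A i)) ->
  fine (nu [set x | exists i, A i x]) <= \sum_i fine (nu (A i)).
Proof.
move=> mA.
have key (s : seq I) : measurable [set x | exists2 i, i \in s & A i x] /\
    fine (nu [set x | exists2 i, i \in s & A i x]) <= \sum_(i <- s) fine (nu (A i)).
  elim: s => [|i s [IHm IH]].
    rewrite big_nil (_ : [set _ | _] = set0) ?measure0//.
    by rewrite -subset0 => x [].
  rewrite (_ : [set _ | _] = A i `|` [set x | exists2 i, i \in s & A i x]).
    split; first exact: measurableU.
    by rewrite big_cons (le_trans (pr_setU_le _ _))// lerD2l.
  apply/seteqP; split => x.
    by move=> [j]; rewrite in_cons => /orP[/eqP->|js] Aj; [left|right; exists j].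
  by move=> [Ai|[j js Aj]]; [exists i|exists j]; rewrite ?in_cons ?eqxx ?js ?orbT.
have [mK] := key (enum I); rewrite big_enum; apply: le_trans.
apply: pr_le => //; first exact: measurable_exists.
by move=> x [i Ai]; exists i; rewrite ?mem_enum.
Qed.

End probability_of_sets.

Section fiber_partition.
Context d (Y : measurableType d) (k : nat).

(** Measurable partitions are handled through the function that gives the index
    of the piece of a point. *)
Definition fibers (f : Y -> 'I_k) (i : 'I_k) : set Y := f @^-1` [set i].

Lemma fibers_partition (f : Y -> 'I_k) :
  (forall i, measurable (fibers f i)) -> indexed_partition (fibers f).
Proof.
move=> mf; split => //.
  by apply/trivIsetP => i j _ _ ij; rewrite -subset0 => x [fi fj]; case/eqP: ij; rewrite -fi -fj.
by rewrite -subTset => x _; exists (f x).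
Qed.

Lemma partition_fibers (A : 'I_k -> set Y) : indexed_partition A ->
  exists f, A = fibers f.
Proof.
move=> [_ /trivIsetP tA uA].
have /choice[f Af] x : exists i, A i x.
  by have : setT x by []; rewrite -uA => -[i _]; exists i.
exists f; apply/funext => i; apply/seteqP; split => x /=.
  move=> Ai; apply: contrapT => /eqP fi.
  by have /seteqP[+ _] := tA _ _ Logic.I Logic.I fi => /(_ x); apply.
by move=> <-.
Qed.

End fiber_partition.

Section first_index.
Context d (Y : measurableType d) (k : nat).
Implicit Types B : 'I_k.+1 -> set Y.

(** The piece to which an arbitrary family of sets assigns a point. Points that
    are in no set of the family go to the piece of index 0. *)
Definition first_index B (x : Y) : 'I_k.+1 :=
  odflt ord0 [pick i | `[< B i x /\ forall j : 'I_k.+1, (j < i)%N -> ~ B j x >]].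

Lemma first_indexP B x i : B i x -> (forall j : 'I_k.+1, (j < i)%N -> ~ B j x) ->
  first_index B x = i.
Proof.
move=> Bi nB; rewrite /first_index; case: pickP => [j /asboolP[Bj nBj]|/(_ i)/asboolP[]//].
apply/val_inj/eqP; rewrite eqn_leq; apply/andP; split; rewrite leqNgt; apply/negP.
  by move=> /nBj.
by move=> /nB.
Qed.

Lemma first_index_ex B x : (exists i, B i x) ->
  B (first_index B x) x /\ forall j : 'I_k.+1, (j < first_index B x)%N -> ~ B j x.
Proof.
move=> [i0 Bi0]; have : exists n, `[< exists i : 'I_k.+1, val i = n /\ B i x >].
  by exists i0; apply/asboolP; exists i0.
move=> /ex_minnP[n /asboolP[i [<- Bi]] imin].
have nB (j : 'I_k.+1) : (j < i)%N -> ~ B j x.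
  move=> ji Bj; have : (i <= j)%N by apply: imin; apply/asboolP; exists j.
  by rewrite leqNgt ji.
by rewrite (first_indexP Bi nB).
Qed.

Lemma first_index_none B x : ~ (exists i, B i x) -> first_index B x = ord0.
Proof.
move=> nB; rewrite /first_index; case: pickP => // j /asboolP[Bj _].
by exfalso; apply: nB; exists j.
Qed.

Lemma measurable_first_index B i : (forall j, measurable (B j)) ->
  measurable (fibers (first_index B) i).
Proof.
move=> mB.
have -> : fibers (first_index B) i =
    (B i `&` [set x | forall j : 'I_k.+1, (j < i)%N -> ~ B j x]) `|`
    ([set _ | i = ord0] `&` ~` [set x | exists j, B j x]).
  apply/seteqP; split => x.
    rewrite /fibers/=; have [Bx|nBx] := pselect (exists j, B j x).
      by move=> <-; left; exact: first_index_ex.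
    by rewrite first_index_none// => <-; right.
  by move=> [[/= Bi nB]|[/= -> nB]]; [exact: first_indexP|exact: first_index_none].
apply: measurableU; apply: measurableI => //.
- rewrite (_ : [set x | _] = [set x | forall j : 'I_k.+1, [set y | (j < i)%N -> ~ B j y] x])//.
  apply: measurable_forall => j; have [ji|ji] := boolP (j < i)%N.
    rewrite (_ : [set _ | _] = ~` B j); first exact: measurableC.
    by apply/seteqP; split => y /=; [exact|move=> ? _].
  rewrite (_ : mkset _ = setT); first exact: measurableT.
  by apply/seteqP; split.
- have [->|/eqP i0] := eqVneq i ord0.
    rewrite (_ : mkset _ = setT); first exact: measurableT.
    by apply/seteqP; split.
  rewrite (_ : mkset _ = set0); first exact: measurable0.
  by apply/seteqP; split.
- by apply: measurableC; exact: measurable_exists.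
Qed.

Lemma first_index_partition B : (forall j, measurable (B j)) ->
  indexed_partition (fibers (first_index B)).
Proof. by move=> mB; apply: fibers_partition => i; exact: measurable_first_index. Qed.

(** Sets that overlap little and have total mass close to 1 are close to the
    pieces of the partition which sends a point to the first set containing it:
    the two differ only on the overlaps and on the points left uncovered, and
    the mass of the latter is bounded by inclusion-exclusion. *)
Lemma first_index_close (R : realType) (nu : probability Y R) B (delta : R) :
  0 <= delta -> (forall j, measurable (B j)) ->
  (forall i j, i != j -> fine (nu (B i `&` B j)) <= delta) ->
  1 - delta <= \sum_i fine (nu (B i)) ->
  exists N, [/\ measurable N, fine (nu N) <= delta * (2 * (k.+1 * k.+1)%:R + 1) &
    forall i x, ~ N x -> (B i x <-> fibers (first_index B) i x)].
Proof.
move=> delta0 mB Bij sumB.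
(* [O] is the set of points covered at least twice. *)
pose O := [set x | exists p : 'I_k.+1 * 'I_k.+1, (if p.1 == p.2 then set0 else B p.1 `&` B p.2) x].
have mOp (p : 'I_k.+1 * 'I_k.+1) : measurable (if p.1 == p.2 then set0 else B p.1 `&` B p.2).
  by case: ifP => // _; exact: measurableI.
have mO : measurable O by exact: measurable_exists.
have Ole : fine (nu O) <= delta * (k.+1 * k.+1)%:R.
  rewrite (le_trans (pr_exists_le _ mOp))//.
  apply: (@le_trans _ _ (\sum_(p : 'I_k.+1 * 'I_k.+1) delta)).
    by apply: ler_sum => p _; case: ifPn => [_|/Bij//]; rewrite measure0.
  by rewrite sumr_const card_prod !card_ord mulr_natr.
pose C := [set x | exists i, B i x].
have mC : measurable C by exact: measurable_exists.
have sumle : \sum_i fine (nu (B i)) <= fine (nu C) + delta * (k.+1 * k.+1)%:R.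
  have mF i : measurable (fibers (first_index B) i) by exact: measurable_first_index.
  have h i : fine (nu (B i)) <= fine (nu (C `&` first_index B @^-1` [set i])) +
      \sum_(j < k.+1) (if i == j then 0 else fine (nu (B i `&` B j))).
    have mBj j : measurable (if i == j then set0 else B i `&` B j).
      by case: ifP => // _; exact: measurableI.
    have := pr_exists_le nu mBj.
    rewrite (eq_bigr (fun j => if i == j then 0 else fine (nu (B i `&` B j)))); last first.
      by move=> j _; case: ifP => //; rewrite measure0.
    rewrite -(lerD2l (fine (nu (C `&` first_index B @^-1` [set i])))); apply: le_trans.
    have mE : measurable [set x | exists j, (if i == j then set0 else B i `&` B j) x].
      exact: measurable_exists.
    have mCF : measurable (C `&` first_index B @^-1` [set i]) by exact: (measurableI _ _ mC (mF i)).
    rewrite (le_trans _ (pr_setU_le nu mCF mE))//.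
    apply: pr_le => //; first exact: measurableU.
    move=> x Bi; have /first_index_ex[Bf _] : exists i, B i x by exists i.
    have [fi|fi] := eqVneq i (first_index B x); first by left; split; [exists i|].
    by right; exists (first_index B x); rewrite (negbTE fi).
  rewrite (pr_sum_fibers nu mC mF).
  apply: le_trans (ler_sum _ (fun i _ => h i)) _.
  rewrite big_split/= lerD2l.
  apply: (@le_trans _ _ (\sum_(i < k.+1) \sum_(j < k.+1) delta)).
    by apply: ler_sum => i _; apply: ler_sum => j _; case: ifPn => // /Bij.
  by rewrite !sumr_const !card_ord -mulrnA mulr_natr.
exists (O `|` ~` C); split.
- by apply: measurableU => //; exact: measurableC.
- rewrite (le_trans (pr_setU_le _ _ _))//; first exact: measurableC.
  by rewrite pr_setC//; move: sumle sumB Ole; lra.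
- move=> i x /not_orP[nO /contrapT Cx]; split=> [Bi|<-]; last by have [] := first_index_ex Cx.
  have [Bf _] := first_index_ex Cx; apply: contrapT => /eqP fi.
  by apply: nO; exists (first_index B x, i); rewrite /= (negbTE fi).
Qed.

End first_index.

(** * Profiles and support functions *)

Section correlations.
Context (R : realType) (G : groupType) d (Y : measurableType d).
Context (nu : probability Y R) (a : mpaction G nu).
Implicit Types (A B N : set Y) (g : G).

(** The correlations [nu (g A :&: B)] are the entries of the profiles. *)
Definition corr g A B : R := fine (nu (a g @` A `&` B)).

Lemma measurable_corr g A B : measurable A -> measurable B ->
  measurable (a g @` A `&` B).
Proof. by move=> mA mB; apply: measurableI => //; exact: measurable_act_image. Qed.

Lemma pr_act_image g A : measurable A -> nu (a g @` A) = nu A.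
Proof. by move=> mA; rewrite act_image act_preserving. Qed.

Lemma act1_image A : a 1%g @` A = A.
Proof. by apply/seteqP; split => [_ [x Ax <-]|x Ax]; [|exists x]; rewrite ?act1. Qed.

Lemma corr_ge0 g A B : 0 <= corr g A B.
Proof. exact: pr_ge0. Qed.

Lemma corr_le1 g A B : measurable A -> measurable B -> corr g A B <= 1.
Proof. by move=> mA mB; apply: pr_le1; exact: measurable_corr. Qed.

Lemma corr_agree g A A' B B' N : measurable A -> measurable A' ->
  measurable B -> measurable B' -> measurable N ->
  (forall x, ~ N x -> (A x <-> A' x)) -> (forall x, ~ N x -> (B x <-> B' x)) ->
  `|corr g A B - corr g A' B'| <= 2 * fine (nu N).
Proof.
move=> mA mA' mB mB' mN AA BB.
have mgN := measurable_act_image a g mN.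
have : fine (nu (a g @` N `|` N)) <= 2 * fine (nu N).
  rewrite (le_trans (pr_setU_le _ _ _))//.
  by rewrite [X in X + _](_ : _ = fine (nu N)) ?pr_act_image//; lra.
apply: le_trans; apply: pr_agree; try exact: measurable_corr.
  exact: measurableU.
move=> x /not_orP[ngN nN]; rewrite !act_image/=.
have : ~ N (a g^-1%g x) by move=> h; apply: ngN; exists (a g^-1%g x) => //; rewrite actKV.
by move=> /AA[h1 h2]; have [h3 h4] := BB _ nN; split=> -[]; split; auto.
Qed.

(** Correlations of unions of pieces of a finite partition are sums of entries of
    its profile. *)
Lemma corr_fibers (I : finType) (f : Y -> I) g (Q Q' : pred I) :
  (forall i, measurable (f @^-1` [set i])) ->
  corr g [set x | Q (f x)] [set x | Q' (f x)] =
  \sum_q \sum_r (Q q && Q' r)%:R * corr g (f @^-1` [set q]) (f @^-1` [set r]).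
Proof.
move=> mf; pose F x := (f (a g^-1%g x), f x).
have mQ (P : pred I) : measurable [set x | P (f x)].
  rewrite (_ : mkset _ = [set x | f x \in enum P]); first exact: measurable_mem_seq.
  by apply/seteqP; split => x /=; rewrite mem_enum.
have mF p : measurable (F @^-1` [set p]).
  case: p => q r.
  rewrite (_ : _ @^-1` _ = a g @` (f @^-1` [set q]) `&` f @^-1` [set r]).
    exact: measurable_corr.
  by rewrite act_image; apply/seteqP; split => x; rewrite /F/= => -[-> ->].
rewrite /corr (pr_sum_fibers nu (measurable_corr g (mQ Q) (mQ Q')) mF) pair_bigA/=.
apply: eq_bigr => -[q r] _ /=; rewrite /F !act_image.
have [/andP[Qq Qr]|nQ] := boolP (Q q && Q' r); rewrite ?mul1r ?mul0r.
  congr (fine (nu _)); apply/seteqP; split => x /=; first by move=> [_ [-> ->]].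
  by move=> [-> ->].
rewrite (_ : _ `&` _ = set0) ?measure0//.
rewrite -subset0 => x /= [[Qx Qx'] [fq fr]].
by move: nQ; rewrite -fq -fr Qx Qx'.
Qed.

End correlations.

Section profile_entries.
Context (R : realType) (G : groupType) (e : nat -> G).

Definition row_of k (s : 'I_(k * k)) : 'I_k :=
  (enum_val (cast_ord (esym (mxvec_cast k k)) s)).1.
Definition col_of k (s : 'I_(k * k)) : 'I_k :=
  (enum_val (cast_ord (esym (mxvec_cast k k)) s)).2.

Lemma row_ofE k (q r : 'I_k) : row_of (mxvec_index q r) = q.
Proof. by rewrite /row_of /mxvec_index cast_ordK enum_rankK. Qed.

Lemma col_ofE k (q r : 'I_k) : col_of (mxvec_index q r) = r.
Proof. by rewrite /col_of /mxvec_index cast_ordK enum_rankK. Qed.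

Section one_action.
Context d (Y : measurableType d) (nu : probability Y R) (a : mpaction G nu).

Lemma profileE n k (A : 'I_k -> set Y) p s :
  profile e a n A p s = corr a (e p) (A (row_of s)) (A (col_of s)).
Proof.
case/mxvec_indexP: s => q r.
by rewrite mxE mxvecE mxE row_ofE col_ofE.
Qed.

Lemma profile_entry01 n k (A : 'I_k -> set Y) p s : indexed_partition A ->
  0 <= profile e a n A p s <= 1.
Proof. by move=> [mA _ _]; rewrite profileE corr_ge0 corr_le1. Qed.

Lemma profile_agree n k (A B : 'I_k -> set Y) N :
  (forall i, measurable (A i)) -> (forall i, measurable (B i)) -> measurable N ->
  (forall i x, ~ N x -> (A i x <-> B i x)) ->
  forall p s, `|profile e a n A p s - profile e a n B p s| <= 2 * fine (nu N).
Proof.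
by move=> mA mB mN AB p s; rewrite !profileE; apply: corr_agree => // x; exact: AB.
Qed.

(** The support function of the set of profiles. For fixed [n] and [k] it
    determines the closed convex hull of the profiles, and it is affine in the
    action ([support_sum]). *)
Definition support n k (c : 'M[R]_(n, k.+1 * k.+1)) : R :=
  sup [set pairing c (profile e a n A) | A in @indexed_partition d Y k.+1].

Lemma pairing_profile_le n k (c : 'M[R]_(n, k * k)) (A : 'I_k -> set Y) :
  indexed_partition A -> `|pairing c (profile e a n A)| <= l1norm c.
Proof.
move=> pA; rewrite -[leRHS]mulr1; apply: pairing_le => i j.
by have /andP[? ?] := profile_entry01 i j pA; rewrite ger0_norm.
Qed.

Lemma trivial_partition k : @indexed_partition d Y k.+1 (fibers (fun=> ord0)).
Proof.
apply: fibers_partition => i; rewrite /fibers.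
have [->|/eqP i0] := eqVneq i ord0.
  by rewrite (_ : _ @^-1` _ = setT)//; apply/seteqP; split.
by rewrite (_ : _ @^-1` _ = set0)//; apply/seteqP; split => // x /= /esym.
Qed.

Lemma support_has_sup n k (c : 'M[R]_(n, k.+1 * k.+1)) :
  has_sup [set pairing c (profile e a n A) | A in @indexed_partition d Y k.+1].
Proof.
split; first by eexists; eexists; [exact: (trivial_partition k)|reflexivity].
exists (l1norm c) => _ [A pA <-].
by have := pairing_profile_le c pA; rewrite ler_norml => /andP[].
Qed.

Lemma support_ge n k (c : 'M[R]_(n, k.+1 * k.+1)) A : indexed_partition A ->
  pairing c (profile e a n A) <= support c.
Proof. by move=> pA; apply: ub_le_sup; [case: (support_has_sup c)|exists A]. Qed.

Lemma support_le n k (c : 'M[R]_(n, k.+1 * k.+1)) u :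
  (forall A, indexed_partition A -> pairing c (profile e a n A) <= u) ->
  support c <= u.
Proof.
move=> h; apply: ge_sup; first by case: (support_has_sup c).
by move=> _ [A pA <-]; exact: h.
Qed.

Lemma support_adherent n k (c : 'M[R]_(n, k.+1 * k.+1)) eps : 0 < eps ->
  exists2 A, indexed_partition A & support c - eps < pairing c (profile e a n A).
Proof.
move=> eps0; have [_ [A pA <-] h] := sup_adherent eps0 (support_has_sup c).
by exists A.
Qed.

Lemma support_bound n k (c : 'M[R]_(n, k.+1 * k.+1)) : `|support c| <= l1norm c.
Proof.
rewrite ler_norml; apply/andP; split.
  apply: le_trans (support_ge c (trivial_partition k)).
  by have := pairing_profile_le c (trivial_partition k); rewrite ler_norml => /andP[].
apply: support_le => A pA.
by have := pairing_profile_le c pA; rewrite ler_norml => /andP[].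
Qed.

Lemma support_lip n k (c c' : 'M[R]_(n, k.+1 * k.+1)) :
  support c <= support c' + l1norm (c - c').
Proof.
apply: support_le => A pA.
have := support_ge c' pA; have := pairing_profile_le (c - c') pA.
by rewrite pairingBl ler_norml => /andP[]; lra.
Qed.

Lemma supportZ n k t (c : 'M[R]_(n, k.+1 * k.+1)) : 0 < t ->
  support (t *: c) = t * support c.
Proof.
move=> t0; apply/eqP; rewrite eq_le; apply/andP; split.
  by apply: support_le => A pA; rewrite pairingZl ler_pM2l//; exact: support_ge.
rewrite -ler_pdivlMl//; apply: support_le => A pA.
by rewrite ler_pdivlMl// -pairingZl; exact: support_ge.
Qed.

(** The convex hull of the profiles. Positive coefficients are harmless for the
    closure and match the multiples in stable weak containment. *)
Definition hull n k : set 'M[R]_(n, k * k) := [set M | exists m (alpha : weights R m.+1)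
  (A : 'I_m.+1 -> 'I_k -> set Y), [/\ forall l, 0 < alpha l,
    forall l, indexed_partition (A l) &
    M = \sum_l alpha l *: profile e a n (A l)]].
Arguments hull : clear implicits.

Lemma hull_profile n k (A : 'I_k -> set Y) : indexed_partition A ->
  hull n k (profile e a n A).
Proof.
have w0 : forall i : 'I_1, 0 <= (1 : R) by [].
have w1 : \sum_(i < 1) (1 : R) = 1 by rewrite big_ord1.
exists 0%N, (Weights w0 w1), (fun=> A).
by split => //; rewrite big_ord1/= scale1r.
Qed.

Lemma hull_norm n k M : hull n k M -> `|M| <= 1.
Proof.
move=> [m [alpha [A [a0 pA ->]]]].
rewrite (le_trans (ler_norm_sum _ _ _))// -(wt_sum1 alpha); apply: ler_sum => l _.
rewrite normrZ ger0_norm ?(ltW (a0 l))// -[leRHS]mulr1 ler_pM2l//.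
exact: profile_norm.
Qed.

Lemma hull_convex n k M M' t : hull n k M -> hull n k M' -> 0 < t -> t < 1 ->
  hull n k (t *: M + (1 - t) *: M').
Proof.
move=> [m [alpha [A [a0 pA ->]]]] [m' [beta [B [b0 pB ->]]]] t0 t1.
pose w (i : 'I_(m.+1 + m'.+1)) := match fintype.split i with
  | inl i => t * alpha i | inr j => (1 - t) * beta j end.
have wl i : w (lshift _ i) = t * alpha i by rewrite /w (unsplitK (inl i)).
have wr j : w (rshift _ j) = (1 - t) * beta j by rewrite /w (unsplitK (inr j)).
have w0 i : 0 < w i.
  by rewrite /w; case: fintype.split => j; rewrite mulr_gt0 ?subr_gt0.
have w1 : \sum_i w i = 1.
  rewrite big_split_ord/=; under eq_bigr do rewrite wl; under [X in _ + X]eq_bigr do rewrite wr.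
  by rewrite -!mulr_sumr !wt_sum1 !mulr1 addrC subrK.
exists (m + m'.+1)%N, (@Weights R (m.+1 + m'.+1) w (fun i => ltW (w0 i)) w1).
exists (fun i : 'I_(m.+1 + m'.+1) => match fintype.split i with inl i => A i | inr j => B j end).
split=> [//|l|]; first by case: fintype.split.
rewrite [RHS](@big_split_ord _ _ _ m.+1 m'.+1)/= !scaler_sumr.
congr (_ + _); apply: eq_bigr => i _; rewrite scalerA.
  by rewrite wl (unsplitK (inl i)).
by rewrite wr (unsplitK (inr i)).
Qed.

Lemma hull_approx n k (M : 'M[R]_(n, k.+1 * k.+1)) :
  (forall c, pairing c M <= support c) ->
  forall eps, 0 < eps -> exists2 M', hull n k.+1 M' & `|M - M'| < eps.
Proof.
move=> Msup; apply: (@support_function_approx _ _ _ _ 1).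
- by eexists; apply: hull_profile; exact: trivial_partition.
- exact: hull_norm.
- by move=> y z t hy hz; exact: hull_convex.
move=> c u hu; apply: le_trans (Msup c) _; apply: support_le => A pA.
by apply: hu; exact: hull_profile.
Qed.

End one_action.
Arguments support {d Y nu} a n k c.
Arguments hull {d Y nu} a n k _.

Section sums.
Context d m (Y : 'I_m.+1 -> measurableType d) (alpha : weights R m.+1).
Context (nu : forall i, probability (Y i) R) (a : forall i, mpaction G (nu i)).

Lemma corr_sum g (A B : set (disjoint_union Y)) : measurable A -> measurable B ->
  corr (sum_action alpha a) g A B =
  \sum_l alpha l * corr (a l) g (@embed _ _ Y l @^-1` A) (@embed _ _ Y l @^-1` B).
Proof.
move=> mA mB; rewrite /corr fine_sum_measure; last exact: measurable_corr.
by apply: eq_bigr => l _; rewrite preimage_setI sum_action_image.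
Qed.

Lemma profile_sum n k (B : 'I_k -> set (disjoint_union Y)) :
  (forall i, measurable (B i)) ->
  profile e (sum_action alpha a) n B =
  \sum_l alpha l *: profile e (a l) n (fun i => @embed _ _ Y l @^-1` B i).
Proof.
move=> mB; apply/matrixP => p s; rewrite profileE corr_sum// summxE.
by apply: eq_bigr => l _; rewrite [RHS]mxE profileE.
Qed.

Lemma restrict_partition k (B : 'I_k -> set (disjoint_union Y)) l :
  indexed_partition B -> indexed_partition (fun i => @embed _ _ Y l @^-1` B i).
Proof.
move=> pB; have [mB _ _] := pB; have [f Bf] := partition_fibers pB.
rewrite (_ : (fun i => _) = fibers (f \o @embed _ _ Y l)); last first.
  by apply/funext => i; rewrite Bf.
by apply: fibers_partition => i; have := mB i l; rewrite Bf.
Qed.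

Lemma glue_partition k (A : forall l, 'I_k -> set (Y l)) :
  (forall l, indexed_partition (A l)) ->
  indexed_partition (fun i => [set z : disjoint_union Y | A (projT1 z) i (projT2 z)]).
Proof.
move=> pA; have /choice[f Af] : forall z : disjoint_union Y, exists i,
    forall j, A (projT1 z) j (projT2 z) <-> i = j.
  move=> [l y] /=; have [f Af] := partition_fibers (pA l).
  by exists (f y) => j; rewrite Af.
rewrite (_ : (fun i => _) = fibers f); last first.
  by apply/funext => i; apply/seteqP; split => z /Af.
apply: fibers_partition => i; apply/measurable_unionP => l.
rewrite (_ : _ @^-1` _ = A l i); first by have [] := pA l.
apply/seteqP; split => y /=; first by move=> /(Af (@embed _ _ Y l y)).
by move=> Ay; exact/(Af (@embed _ _ Y l y)).
Qed.

(** A partition of a disjoint union is a partition of each summand, chosen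
    independently, and the profile is the weighted sum of the profiles: the
    suprema add up. This is the reason why the embedding is affine. *)
Lemma support_sum n k (c : 'M[R]_(n, k.+1 * k.+1)) :
  support (sum_action alpha a) n k c = \sum_l alpha l * support (a l) n k c.
Proof.
apply/eqP; rewrite eq_le; apply/andP; split.
  apply: support_le => B pB; have [mB _ _] := pB.
  rewrite profile_sum// pairing_sumr; apply: ler_sum => l _.
  by rewrite pairingZr ler_wpM2l ?wt_ge0//; apply: support_ge; exact: restrict_partition.
apply/ler_addgt0Pr => eps eps0.
pose A l := sval (cid2 (support_adherent (a l) c eps0)).
have pA l : indexed_partition (A l) by rewrite /A; case: cid2.
have hA l : support (a l) n k c - eps < pairing c (profile e (a l) n (A l)).
  by rewrite /A; case: cid2.
have pB := glue_partition pA; have [mB _ _] := pB.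
rewrite -lerBlDr; apply: le_trans (support_ge (sum_action alpha a) c pB).
rewrite profile_sum// pairing_sumr.
rewrite -[X in _ - X]mul1r -(wt_sum1 alpha) mulr_suml -sumrB; apply: ler_sum => l _.
by rewrite -mulrBr pairingZr ler_wpM2l ?wt_ge0// ltW// hA.
Qed.

End sums.

(** Support functions do not see multiplicities, which is why they are invariants
    of stable weak equivalence. *)
Lemma support_multiple d (Y : measurableType d) (nu : probability Y R)
    (a : mpaction G nu) m (alpha : weights R m.+1) n k (c : 'M[R]_(n, k.+1 * k.+1)) :
  support (multiple a alpha) n k c = support a n k c.
Proof. by rewrite support_sum -mulr_suml wt_sum1 mul1r. Qed.

Section factor.
Context d1 d2 (X : measurableType d1) (Y : measurableType d2)
    (mu : probability X R) (nu : probability Y R)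
    (a : mpaction G mu) (b : mpaction G nu) (phi : X -> Y).
Hypotheses (mphi : measurable_fun setT phi)
  (phimu : forall B, measurable B -> mu (phi @^-1` B) = nu B)
  (phieq : forall g x, phi (a g x) = b g (phi x)).

Lemma factor_partition k (B : 'I_k -> set Y) : indexed_partition B ->
  indexed_partition (fun i => phi @^-1` B i).
Proof.
move=> pB; have [mB _ _] := pB; have [f Bf] := partition_fibers pB.
have mpB i : measurable (phi @^-1` B i) by rewrite -[X in measurable X]setTI; exact: mphi.
rewrite (_ : (fun i => _) = fibers (f \o phi)); last by rewrite Bf.
by apply: fibers_partition => i; have := mpB i; rewrite Bf.
Qed.

Lemma factor_profile n k (B : 'I_k -> set Y) : (forall i, measurable (B i)) ->
  profile e b n B = profile e a n (fun i => phi @^-1` B i).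
Proof.
move=> mB; apply/matrixP => p s; rewrite !profileE /corr -phimu; last exact: measurable_corr.
congr (fine (mu _)); rewrite !act_image; apply/seteqP; split => x /=; by rewrite phieq.
Qed.

Lemma support_factor n k (c : 'M[R]_(n, k.+1 * k.+1)) :
  support b n k c <= support a n k c.
Proof.
apply: support_le => B pB; have [mB _ _] := pB.
by rewrite factor_profile//; apply: support_ge; exact: factor_partition.
Qed.

End factor.

Lemma isomorphic_actions_sym d1 d2 (X : measurableType d1) (Y : measurableType d2)
    (mu : probability X R) (nu : probability Y R)
    (a : mpaction G mu) (b : mpaction G nu) :
  isomorphic_actions a b -> isomorphic_actions b a.
Proof.
move=> [phi [[psi phiK psiK] mphi mphi' phimu phieq]].
have psiE (A : set X) : psi @^-1` A = phi @` A.
  apply/seteqP; split => [y Ay|_ [x Ax <-]] /=; last by rewrite phiK.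
  by exists (psi y).
have phiE (B : set Y) : phi @^-1` B = psi @` B.
  apply/seteqP; split => [x Bx|_ [y By <-]] /=; last by rewrite psiK.
  by exists (phi x).
exists psi; split.
- by exists phi.
- by move=> _ A mA; rewrite setTI psiE; exact: mphi'.
- by move=> B mB; rewrite -phiE -[X in measurable X]setTI; exact: mphi.
- move=> A mA; rewrite psiE -phimu; last exact: mphi'.
  congr (mu _); apply/seteqP; split => [x /= [x' Ax' /(can_inj phiK) <-//]|x Ax].
  by exists x.
- by move=> g y; rewrite -[y in LHS]psiK -phieq phiK.
Qed.

Lemma support_isomorphic d1 d2 (X : measurableType d1) (Y : measurableType d2)
    (mu : probability X R) (nu : probability Y R)
    (a : mpaction G mu) (b : mpaction G nu) : isomorphic_actions a b ->
  forall n k (c : 'M[R]_(n, k.+1 * k.+1)), support a n k c = support b n k c.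
Proof.
move=> ab n k c; apply/eqP; rewrite eq_le; apply/andP; split.
  have [psi [_ mpsi _ psinu psieq]] := isomorphic_actions_sym ab.
  exact: (support_factor mpsi psinu psieq).
by have [phi [_ mphi _ phimu phieq]] := ab; exact: (support_factor mphi phimu phieq).
Qed.

End profile_entries.
Arguments support {R G} e {d Y nu} a n k c.
Arguments hull {R G} e {d Y nu} a n k _.

(** * Profiles of stabilized actions *)

Section uniform.
Context (R : realType).
Local Notation RR := (g_sigma_algebraType (R.-ocitv.-measurable)).
Local Notation U01 := (uniform_prob (@ltr01 R) : probability _ R).

Lemma uniform_itv (x y : R) : 0 <= x -> x <= y -> y <= 1 ->
  fine (U01 [set u | x <= u < y]) = y - x.
Proof.
move=> x0 xy y1; rewrite [X in fine X]integral_uniform_pdf.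
have -> : [set u | x <= u < y] `&` `[0, 1] = `[x, y[%classic.
  apply/seteqP; split => u /=; rewrite !in_itv/=; first by move=> [].
  by move=> /andP[xu uy]; rewrite xu uy (le_trans x0 xu) (le_trans (ltW uy) y1).
rewrite (eq_integral (cst 1%E)); last first.
  move=> u; rewrite inE/= in_itv/= => /andP[xu uy].
  by rewrite /uniform_pdf (le_trans x0 xu) (le_trans (ltW uy) y1) subr0 invr1.
rewrite integral_cst//= mul1e lebesgue_measure_itv/= lte_fin.
by case: ltP => // yx; rewrite (le_anti (introT andP (conj xy yx))) subrr.
Qed.

Lemma measurable_itv_co (x y : R) : measurable [set u : R | x <= u < y].
Proof. by rewrite (_ : mkset _ = `[x, y[%classic). Qed.

(** Consecutive intervals with prescribed lengths. *)
Lemma uniform_selector m (alpha : weights R m.+1) : exists J : R -> 'I_m.+1,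
  forall l, measurable (J @^-1` [set l]) /\ fine (U01 (J @^-1` [set l])) = alpha l.
Proof.
pose S (l : 'I_m.+1) := \sum_(i < m.+1 | (i <= l)%N) alpha i.
pose S' (l : 'I_m.+1) := \sum_(i < m.+1 | (i < l)%N) alpha i.
have SE l : S l = alpha l + S' l.
  rewrite /S (bigD1 l)//=; congr (_ + _); apply: eq_bigl => i.
  by rewrite ltn_neqAle andbC.
have sub0 (P Q : pred 'I_m.+1) : subpred P Q ->
    \sum_(i | P i) alpha i <= \sum_(i | Q i) alpha i.
  move=> PQ; rewrite [leRHS](bigID P)/= (eq_bigl P) => [|i]; last first.
    by rewrite andb_idl// => /PQ.
  by rewrite lerDl; apply: sumr_ge0 => i _; exact: wt_ge0.
have S'0 l : 0 <= S' l by apply: sumr_ge0 => i _; exact: wt_ge0.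
have S'S l : S' l <= S l by rewrite SE lerDr wt_ge0.
have S1 l : S l <= 1 by rewrite -(wt_sum1 alpha); exact: sub0.
pose B l := [set u : R | u < S l].
have mB l : measurable (B l).
  by rewrite (_ : B l = `]-oo, S l[%classic)//; apply/seteqP; split => u /=; rewrite in_itv.
exists (first_index B) => l; split; first exact: measurable_first_index.
have agree u : ~ (~` [set u : R | 0 <= u < 1]) u ->
    ((first_index B @^-1` [set l]) u <-> [set u | S' l <= u < S l] u).
  move=> /contrapT/= /andP[u0 u1].
  have /first_index_ex[Bf nBf] : exists i, B i u.
    exists ord_max; rewrite /B/= (_ : S ord_max = 1)// -(wt_sum1 alpha).
    by apply: eq_bigl => i; rewrite -ltnS ltn_ord.
  split=> [<-|/andP[lu ul]].
    apply/andP; split=> //; move: nBf; set i := first_index B u => nBf.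
    case: (posnP i) => [i0|i0].
      by rewrite /S' big1// => j; rewrite i0.
    have ltim : (i.-1 < m.+1)%N by rewrite (leq_ltn_trans (leq_pred _)).
    have := nBf (Ordinal ltim); rewrite /= prednK// leqnn => /(_ isT)/negP.
    rewrite -leNgt; apply: le_trans; apply: sub0 => j /= ji.
    by rewrite -(leq_add2r 1) !addn1 prednK.
  apply: first_indexP => // j jl; apply/negP; rewrite -leNgt.
  by apply: le_trans lu; apply: sub0 => i /= ij; exact: leq_ltn_trans jl.
have mI := measurable_itv_co.
have := pr_agree U01 (measurable_first_index l mB) (mI _ _) (measurableC (mI _ _)) agree.
rewrite [X in `|_ - X|](uniform_itv (S'0 l) (S'S l) (S1 l)) [leRHS]pr_setC; last exact: mI.
rewrite [X in 1 - X](uniform_itv (lexx 0) ler01 (lexx 1)) subr0 subrr normr_le0 subr_eq0.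
by move=> /eqP; rewrite /fibers SE addrK.
Qed.

End uniform.

Section stabilized_profiles.
Context (R : realType) (G : groupType) (e : nat -> G).
Local Notation RR := (g_sigma_algebraType (R.-ocitv.-measurable)).
Local Notation U01 := (uniform_prob (@ltr01 R) : probability _ R).
Context d (Y : measurableType d) (nu : probability Y R) (a : mpaction G nu).
Local Notation stab := (prod_action a (trivial_action G U01)).

(** A convex combination of profiles of [a] is one profile of the stabilized
    action: the coordinate in the unit interval, which the group fixes, selects
    the partition that is used, with the weights as probabilities. *)
Lemma hull_profiles n k (M : 'M[R]_(n, k * k)) :
  hull e a n k M -> profiles e stab n k M.
Proof.
move=> [m [alpha [A [a0 pA ->]]]]; apply: subset_closure.
have [J JP] := uniform_selector alpha.
have /choice[f Af] l := partition_fibers (pA l).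
pose F (z : Y * RR) := f (J z.2) z.1.
have FE i : fibers F i = [set z | exists l, (A l i `*` J @^-1` [set l]) z].
  apply/seteqP; split => [z Fz|z [l [/=]]].
    by exists (J z.2); split => //; rewrite Af.
  by rewrite Af /fibers/= => fi Jl; rewrite /F Jl.
have mA l i : measurable (A l i) by have [] := pA l.
exists (fibers F).
  apply: fibers_partition => i; rewrite FE.
  by apply: measurable_exists => l; apply: measurableX => //; have [] := JP l.
apply/matrixP => p s; rewrite profileE summxE.
have mF i : measurable (fibers F i).
  rewrite FE; apply: measurable_exists => l.
  by apply: measurableX => //; have [] := JP l.
have mJ l : measurable ((J \o snd : Y * RR -> _) @^-1` [set l]).
  rewrite (_ : _ @^-1` _ = setT `*` (J @^-1` [set l])).
    by apply: measurableX => //; have [] := JP l.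
  by apply/seteqP; split => z //= [].
rewrite /corr (pr_sum_fibers _ (measurable_corr stab _ (mF _) (mF _)) mJ).
apply: eq_bigr => l _; rewrite [RHS]mxE profileE -(JP l).2 mulrC.
set q := row_of s; set r := col_of s.
have -> : stab (e p) @` fibers F q `&` fibers F r `&` (J \o snd) @^-1` [set l] =
    (a (e p) @` A l q `&` A l r) `*` (J @^-1` [set l]).
  rewrite !act_image Af; apply/seteqP; split => -[y u] /=; rewrite /fibers/F/=.
    by move=> [[<- <-] <-].
  by move=> [[<- <-] <-].
have mC := measurable_corr a (e p) (mA l q) (mA l r).
transitivity (fine (nu (a (e p) @` A l q `&` A l r) * U01 (J @^-1` [set l]))%E).
  by congr fine; exact: (product_measure1E nu U01 mC (JP l).1).
by rewrite fineM// fin_num_measure//; exact: (JP l).1.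
Qed.

Lemma prod_uniform_ysection (A : set (Y * RR)) : measurable A ->
  (nu \x U01)%E A = (\int[U01]_u nu (ysection A u))%E.
Proof.
move=> mA.
by apply: (product_measure_unique (m' := product_measure2 nu U01)) => // B C mB mC;
  exact: product_measure2E.
Qed.

Lemma bounded_integrable (f : R -> R) (B : R) : measurable_fun setT f ->
  (forall u, `|f u| <= B) -> U01.-integrable setT (EFin \o f).
Proof.
move=> mf fB; apply: measurable_bounded_integrable => //.
  by apply: (@le_lt_trans _ _ 1%E); [rewrite probability_le1|exact: ltry].
exists B; split; first exact: num_real.
by move=> x Bx u _ /=; exact: le_trans (fB u) (ltW Bx).
Qed.

Lemma Rintegral_pairing m n (c : 'M[R]_(m, n)) (F : R -> 'M[R]_(m, n)) (B : R) :
  (forall i j, measurable_fun setT (fun u => F u i j)) ->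
  (forall u i j, `|F u i j| <= B) ->
  U01.-integrable setT (EFin \o (fun u => pairing c (F u))) /\
  pairing c (\matrix_(i, j) Rintegral U01 setT (fun u => F u i j)) =
  Rintegral U01 setT (fun u => pairing c (F u)).
Proof.
move=> mF FB.
pose P (f : R -> R) r := U01.-integrable setT (EFin \o f) /\ r = Rintegral U01 setT f.
have PD f g r s : P f r -> P g s -> P (fun u => f u + g u) (r + s).
  move=> [i1 ->] [i2 ->]; split; first exact: (integrableD measurableT i1 i2).
  by rewrite RintegralD.
have P0 : P (fun=> 0) 0.
  by split; [exact: integrable0|rewrite Rintegral_cst// mul0r].
have Psum (I : finType) (f : I -> R -> R) (r : I -> R) : (forall i, P (f i) (r i)) ->
    P (fun u => \sum_i f i u) (\sum_i r i).
  move=> Pf; elim: (index_enum I) => [|i s IH].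
    rewrite big_nil (_ : (fun u => _) = fun=> 0)//.
    by apply/funext => u; rewrite big_nil.
  rewrite big_cons (_ : (fun u => _) = fun u => f i u + \sum_(j <- s) f j u).
    exact: PD.
  by apply/funext => u; rewrite big_cons.
apply: (Psum) => i; apply: (Psum) => j.
have FI : U01.-integrable setT (EFin \o (fun u => F u i j)).
  exact: (bounded_integrable (B := B)).
split; last by rewrite mxE RintegralZl.
exact: (integrableZl measurableT (c i j) FI).
Qed.

(** Fubini: a profile of the stabilized action is an average of profiles of the
    action itself, over the sections of the partition. *)
Lemma pairing_profiles n k (c : 'M[R]_(n, k.+1 * k.+1)) M :
  profiles e stab n k.+1 M -> pairing c M <= support e a n k c.
Proof.
have key A : indexed_partition A -> pairing c (profile e stab n A) <= support e a n k c.
  move=> pA; have [mA _ _] := pA; have [f Af] := partition_fibers pA.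
  pose Au u i : set Y := ysection (A i) u.
  have mAu u i : measurable (Au u i) by exact: measurable_ysection.
  have pAu u : indexed_partition (Au u).
    rewrite (_ : Au u = fibers (fun y => f (y, u))).
      apply: fibers_partition => i; have := mAu u i; rewrite /Au Af.
      by congr measurable; apply/seteqP; split => y; rewrite /ysection/= inE.
    apply/funext => i; rewrite /Au Af.
    by apply/seteqP; split => y; rewrite /ysection/= inE.
  have sec p s u : profile e a n (Au u) p s =
      fine (nu (ysection (stab (e p) @` A (row_of s) `&` A (col_of s)) u)).
    rewrite profileE /corr; congr (fine (nu _)); rewrite !act_image /Au.
    by apply/seteqP; split => y; rewrite /ysection/= !inE.
  have mS p s : measurable (stab (e p) @` A (row_of s) `&` A (col_of s)).
    by apply: measurable_corr.
  have mp p s : measurable_fun setT (fun u => profile e a n (Au u) p s).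
    under eq_fun do rewrite sec.
    have mfine : measurable_fun setT (fine : \bar R -> R) by [].
    exact: (measurableT_comp mfine (measurable_fun_ysection nu (mS p s))).
  have bp u p s : `|profile e a n (Au u) p s| <= 1.
    by have /andP[? ?] := profile_entry01 e a p s (pAu u); rewrite ger0_norm.
  have [intF pE] := Rintegral_pairing c mp bp.
  rewrite (_ : profile e stab n A = \matrix_(i, j) Rintegral U01 setT
      (fun u => profile e a n (Au u) i j)).
    rewrite pE; apply: (@le_trans _ _ (Rintegral U01 setT (fun=> support e a n k c))).
      apply: le_Rintegral => //.
        by apply: (@bounded_integrable _ `|support e a n k c|).
      by move=> u _; exact: support_ge.
    by rewrite Rintegral_cst// pr_setT mulr1.
  apply/matrixP => p s; rewrite [RHS]mxE profileE /corr.
  rewrite [X in fine X](prod_uniform_ysection (mS p s)).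
  rewrite /Rintegral; congr fine; apply: eq_integral => u _.
  by rewrite sec fineK// fin_num_measure//; exact: measurable_ysection.
move=> clM; apply/ler_addgt0Pr => eps eps0.
have [delta delta0 h] := pairing_small c eps0.
have [_ [[A pA <-] xA]] := clM _ (nbhsx_ballx M _ delta0).
move: xA; rewrite -ball_normE /= => /ltW/h; rewrite pairingBr.
by have := key _ pA; rewrite ler_norml => + /andP[]; lra.
Qed.

(** The closed set of profiles of the stabilized action is the closed convex hull
    of the profiles of the action, so it is described by the support function. *)
Lemma profilesP n k (M : 'M[R]_(n, k.+1 * k.+1)) :
  profiles e stab n k.+1 M <-> forall c, pairing c M <= support e a n k c.
Proof.
split=> [pM c|Msup]; first exact: pairing_profiles.
apply: (@closed_closure _ _ M) => B /nbhs_ballP[eps /= eps0 epsB].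
have [M' hM' MM'] := hull_approx Msup eps0.
by exists M'; split; [exact: hull_profiles|apply: epsB; rewrite -ball_normE].
Qed.

Lemma profiles_hull_approx n k (M : 'M[R]_(n, k.+1 * k.+1)) :
  profiles e stab n k.+1 M ->
  forall eps, 0 < eps -> exists2 M', hull e a n k.+1 M' & `|M - M'| < eps.
Proof. by move=> pM; apply: hull_approx => c; exact: pairing_profiles. Qed.

End stabilized_profiles.

(** * Stable weak containment and support functions *)

Section containment.
Context (R : realType) (G : groupType) (e : nat -> G).
Context d1 d2 (X : measurableType d1) (Y : measurableType d2).
Context (mu : probability X R) (nu : probability Y R).
Context (a : mpaction G mu) (b : mpaction G nu).

(** The sets which stable weak containment provides for a partition are almost
    a partition, by the case of the identity; [first_index] repairs them. *)
Lemma contained_support : stably_weakly_contained a b ->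
  forall n k (c : 'M[R]_(n, k.+1 * k.+1)), support e a n k c <= support e b n k c.
Proof.
move=> ab n k c; apply: support_le => A pA; apply/ler_addgt0Pr => eps eps0.
have [mA /trivIsetP tA _] := pA.
(* [K] collects the errors: [dl] from the containment, and twice the mass of the
   bad set of [first_index_close], where the overlaps are at most [k.+1 * dl]. *)
pose K : R := 1 + 2 * (k.+1%:R * (2 * (k.+1 * k.+1)%:R + 1)).
have K0 : 0 < K by rewrite /K ltr_pwDl// !mulr_ge0// addr_ge0// mulr_ge0.
pose L := l1norm c + 1.
have L0 : 0 < L by rewrite ltr_wpDl ?l1norm_ge0.
pose dl := eps / (L * K).
have dl0 : 0 < dl by rewrite divr_gt0// mulr_gt0.
pose F : set G := [set 1%g] `|` [set e p | p in `I_n].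
have finF : finite_set F.
  by rewrite finite_setU; split; [exact: finite_set1|exact/finite_image/finite_II].
have [m [alpha [B [a0 mB abP]]]] := ab _ A F dl mA finF dl0.
have abP' g i j : F g -> `|corr a g (A i) (A j) - corr (multiple b alpha) g (B i) (B j)| < dl.
  exact: abP.
have F1 : F 1%g by left.
pose nu' := sum_measure alpha (fun=> nu).
have corr1A i j : corr a 1%g (A i) (A j) = fine (mu (A i `&` A j)).
  by rewrite /corr act1_image.
have corr1B i j : corr (multiple b alpha) 1%g (B i) (B j) = fine (nu' (B i `&` B j)).
  by rewrite /corr act1_image.
have dlk : dl <= k.+1%:R * dl by rewrite ler_peMl ?(ltW dl0)// ler1n.
have Bij i j : i != j -> fine (nu' (B i `&` B j)) <= k.+1%:R * dl.
  move=> ij; have := abP' _ i j F1; rewrite corr1A corr1B tA// measure0/= sub0r normrN.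
  by rewrite ger0_norm ?pr_ge0// => h; exact: le_trans (ltW h) dlk.
have [f Af] := partition_fibers pA.
have sumA : \sum_i fine (mu (A i)) = 1.
  rewrite -(pr_setT mu) (pr_sum_fibers mu (f := f) measurableT); last first.
    by move=> i; have := mA i; rewrite Af.
  by apply: eq_bigr => i _; rewrite setTI Af.
have sumB : 1 - k.+1%:R * dl <= \sum_i fine (nu' (B i)).
  have -> : k.+1%:R * dl = \sum_(i < k.+1) dl by rewrite sumr_const card_ord mulr_natl.
  rewrite -sumA -sumrB.
  apply: ler_sum => i _; have := abP' _ i i F1; rewrite corr1A corr1B !setIid.
  by rewrite ltr_norml => /andP[_]; rewrite -/nu'; lra.
have kdl0 : 0 <= k.+1%:R * dl by rewrite mulr_ge0// ltW.
have [N [mN Nle BN]] := first_index_close kdl0 mB Bij sumB.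
pose B' := fibers (first_index B).
have pB' : indexed_partition B' by exact: first_index_partition.
have [mB' _ _] := pB'.
have close p s : `|(profile e a n A - profile e (multiple b alpha) n B') p s| <= dl * K.
  rewrite subr_entry.
  have h1 : `|profile e a n A p s - profile e (multiple b alpha) n B p s| < dl.
    by rewrite !profileE; apply: abP'; right; exists p => //=.
  have h2 := profile_agree e (multiple b alpha) (n := n) mB mB' mN BN p s.
  rewrite -(subrKA (profile e (multiple b alpha) n B p s)).
  rewrite (le_trans (ler_normD _ _))//; move: h1 h2 Nle; rewrite /K -/nu'.
  set u := `|_ - _|; set v := `|_ - _|; set w := fine _ => h1 h2 Nle.
  by lra.
have := pairing_le c close; rewrite pairingBr => h.
have h2 : l1norm c * (dl * K) <= eps.
  rewrite (_ : eps = L * (dl * K)); last first.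
    by rewrite /dl; field; rewrite !gt_eqF.
  by apply: ler_wpM2r; [rewrite mulr_ge0// ltW|rewrite /L lerDl].
have := support_ge e (multiple b alpha) c pB'; rewrite support_multiple.
by have := le_trans h h2; rewrite ler_norml => /andP[]; lra.
Qed.

(** Conversely, the sets generate a finite partition, whose profile lies in the
    closed convex hull of the profiles of [b]: it is a limit of convex
    combinations, which are the profiles of multiples. *)
Lemma support_contained : range e = [set: G] ->
  (forall n k (c : 'M[R]_(n, k.+1 * k.+1)), support e a n k c <= support e b n k c) ->
  stably_weakly_contained a b.
Proof.
move=> e_onto ab k A F eps mA finF eps0.
have [n Fn] : exists n, forall g, F g -> exists2 p, (p < n)%N & e p = g.
  have /choice[idx idxP] g : exists p, e p = g.
    by have : [set: G] g by []; rewrite -e_onto => -[p _ <-]; exists p.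
  have /finite_seqP[D FD] := finF.
  exists (\max_(g <- D) idx g).+1 => g Fg; exists (idx g) => //.
  by rewrite ltnS; apply: (leq_bigmax_seq (F := idx)) => //; rewrite FD in Fg.
(* The pieces of the generated partition are indexed by the possible lists of
   answers to the questions whether a point is in [A i]. *)
pose T := {ffun 'I_k -> bool}.
have TE : #|{: T}|.-1.+1 = #|{: T}|.
  by rewrite prednK// card_ffun card_bool expn_gt0.
pose K := #|{: T}|.-1.
pose code (t : T) : 'I_K.+1 := cast_ord (esym TE) (enum_rank t).
pose dec (q : 'I_K.+1) : T := enum_val (cast_ord TE q).
have codeK : cancel code dec by move=> t; rewrite /dec/code cast_ordKV enum_rankK.
have decK : cancel dec code by move=> t; rewrite /dec/code enum_valK cast_ordK.
pose f x : 'I_K.+1 := code [ffun i => `[< A i x >]].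
have AE i : A i = [set x | dec (f x) i].
  apply/seteqP; split => x /=; rewrite codeK ffunE => /asboolP//.
have mf q : measurable (f @^-1` [set q]).
  rewrite (_ : _ @^-1` _ =
      [set x | forall i, (if dec q i then A i else ~` A i) x]).
    by apply: measurable_forall => i; case: ifP => // _; exact: measurableC.
  apply/seteqP; split => x /=.
    by move=> <- i; rewrite codeK ffunE; case: asboolP.
  move=> h; rewrite -[q]decK; congr code; apply/ffunP => i; rewrite ffunE.
  by have := h i; case: (dec q i) => h'; [exact/asboolP|exact/asboolP].
have pf : indexed_partition (fibers f) by exact: fibers_partition.
pose dl := eps / (K.+1 * K.+1)%:R.
have KK0 : 0 < (K.+1 * K.+1)%:R :> R by rewrite ltr0n.
have dl0 : 0 < dl by rewrite divr_gt0.
have [M' [m [alpha [C [a0 pC M'E]]]] MM'] := hull_approx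
  (fun c => le_trans (support_ge e a c pf) (ab n K c)) dl0.
have /choice[h Ch] l := partition_fibers (pC l).
pose f' (z : disjoint_union (fun _ : 'I_m.+1 => Y)) := h (projT1 z) (projT2 z).
have mf' q : measurable (f' @^-1` [set q]).
  apply/measurable_unionP => l; rewrite (_ : _ @^-1` _ = C l q); last by rewrite Ch.
  by have [] := pC l.
have M'f : M' = profile e (multiple b alpha) n (fibers f').
  rewrite M'E profile_sum//; apply: eq_bigr => l _; congr (_ *: profile _ _ _ _).
  by rewrite Ch.
exists m, alpha, (fun i => [set z | dec (f' z) i]); split => //.
  move=> i; rewrite (_ : mkset _ = [set z | f' z \in [pred q | dec q i]])//.
  rewrite (_ : mkset _ = [set z | f' z \in enum [pred q | dec q i]]).
    exact: measurable_mem_seq.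
  by apply/seteqP; split => z /=; rewrite mem_enum.
move=> g i j /Fn[p pn <-].
rewrite -[X in X - _]/(corr a (e p) (A i) (A j)) (AE i) (AE j).
rewrite -[X in _ - X]/(corr (multiple b alpha) (e p) _ _).
rewrite (corr_fibers a (e p) (fun q => dec q i) (fun q => dec q j) mf).
rewrite (corr_fibers (multiple b alpha) (e p) (fun q => dec q i) (fun q => dec q j) mf').
rewrite -sumrB (le_lt_trans (ler_norm_sum _ _ _))//.
apply: (@lt_le_trans _ _ (\sum_(q < K.+1) \sum_(r < K.+1) dl)); last first.
  rewrite !sumr_const !card_ord -mulrnA -mulr_natr /dl mulfVK ?gt_eqF//.
apply: ltr_sum.
  by apply/hasP; exists ord0 => //; rewrite mem_index_enum.
move=> q _; rewrite -sumrB (le_lt_trans (ler_norm_sum _ _ _))//.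
apply: ltr_sum; first by apply/hasP; exists ord0 => //; rewrite mem_index_enum.
move=> r _; rewrite -mulrBr normrM.
have MMqr : `|corr a (e p) (f @^-1` [set q]) (f @^-1` [set r]) -
    corr (multiple b alpha) (e p) (f' @^-1` [set q]) (f' @^-1` [set r])| < dl.
  have := le_lt_trans (entry_le_norm _ (Ordinal pn) (mxvec_index q r)) MM'.
  rewrite subr_entry M'f.
  by rewrite !profileE row_ofE col_ofE.
case: (_ && _); rewrite ?normr1 ?mul1r// normr0 mul0r//.
Qed.

End containment.

(** The support functions are complete invariants of stable weak equivalence. *)
Lemma stably_weakly_equivalentP (R : realType) (G : groupType) (e : nat -> G)
    d1 d2 (X : measurableType d1) (Y : measurableType d2)
    (mu : probability X R) (nu : probability Y R)
    (a : mpaction G mu) (b : mpaction G nu) : range e = [set: G] ->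
  stably_weakly_equivalent a b <->
  forall n k (c : 'M[R]_(n, k.+1 * k.+1)), support e a n k c = support e b n k c.
Proof.
move=> e_onto; split=> [[ab ba] n k c|h].
  by apply/eqP; rewrite eq_le !contained_support.
by split; apply: (support_contained e_onto) => n k c; rewrite h.
Qed.

(** * Laws on the Cantor space *)

Section image_probability.
Context (R : realType) d1 d2 (Y : measurableType d1) (Z : measurableType d2).

Lemma measurable_preimage (f : Y -> Z) A : measurable_fun setT f -> measurable A ->
  measurable (f @^-1` A).
Proof. by move=> mf mA; rewrite -[X in measurable X]setTI; exact: mf. Qed.

Lemma image_probability (nu : probability Y R) (f : Y -> Z) : measurable_fun setT f ->
  exists lam : probability Z R, forall A, lam A = nu (f @^-1` A).
Proof.
move=> mf; pose X : {mfun Y >-> Z} := mfun_Sub (mem_set mf).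
by exists (distribution nu X).
Qed.

End image_probability.

(** Generators of the product sigma-algebra of the cube [T -> bool]. *)
Definition coord_sets (T : Type) : set (set (T -> bool)) :=
  [set [set z : T -> bool | z t] | t in setT].

Notation cube T := (g_sigma_algebraType (@coord_sets T)).

Section cube_measurability.
Context d (Y : measurableType d).

Lemma measurable_coord (T : Type) (t : T) : measurable ([set z | z t] : set (cube T)).
Proof. by apply: sub_sigma_algebra; exists t. Qed.

Lemma measurable_fun_cube (T : Type) (f : Y -> cube T) :
  (forall t, measurable [set y | f y t]) -> measurable_fun setT f.
Proof.
move=> mf; apply: (@measurability _ _ _ (cube T) setT f (@coord_sets T)) => // _ [_ [t _ <-] <-].
by rewrite setTI; exact: mf.
Qed.

Lemma measurable_cube_coord (T : Type) (f : Y -> cube T) t :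
  measurable_fun setT f -> measurable [set y | f y t].
Proof. by move=> mf; exact: (measurable_preimage mf (measurable_coord t)). Qed.

Lemma measurable_eq_cube (f g : Y -> cube nat) :
  measurable_fun setT f -> measurable_fun setT g -> measurable [set y | f y = g y].
Proof.
move=> mf mg; rewrite (_ : mkset _ = \bigcap_n
    (([set y | f y n] `&` [set y | g y n]) `|` ~` ([set y | f y n] `|` [set y | g y n]))).
  have mfn n := measurable_cube_coord n mf; have mgn n := measurable_cube_coord n mg.
  apply: bigcapT_measurable => n; apply: measurableU; first exact: measurableI.
  by apply: measurableC; exact: measurableU.
apply/seteqP; split => y /= fg; first by move=> n _ /=; rewrite fg; case: (g y n); [left|right => -[]].
apply/funext => n; have [[/= -> ->//]|/= /not_orP[]] := fg n Logic.I.
by case: (f y n); case: (g y n).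
Qed.

End cube_measurability.

(** The sequences agreeing with [c] up to [n] form a cylinder. *)
Definition agree n (c c' : cube nat) := forall i, (i < n)%N -> c i = c' i.

Lemma agreeS n c c' : agree n.+1 c c' <-> agree n c c' /\ c n = c' n.
Proof.
split=> [h|[h hn] i]; first by split=> [i ni|]; apply: h => //; exact: ltnW.
by rewrite ltnS leq_eqVlt => /orP[/eqP->//|]; exact: h.
Qed.

Lemma agree_sym n c c' : agree n c c' -> agree n c' c.
Proof. by move=> h i /h. Qed.

Lemma agree_trans n c c' c'' : agree n c c' -> agree n c' c'' -> agree n c c''.
Proof. by move=> h h' i ni; rewrite h// h'. Qed.

Lemma agree_le m n c c' : (m <= n)%N -> agree n c c' -> agree m c c'.
Proof. by move=> mn h i im; apply: h; exact: leq_trans mn. Qed.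

Lemma measurable_prefix n (S : set (cube nat)) :
  (forall c c', agree n c c' -> S c -> S c') -> measurable S.
Proof.
elim: n S => [|n IH] S SP.
  have [Sp|nSp] := pselect (S (fun=> false)).
    rewrite (_ : S = setT)//; apply/seteqP; split => // c _; exact: SP Sp.
  by rewrite (_ : S = set0)//; apply/seteqP; split => // c Sc; apply: nSp; exact: SP Sc.
pose upd b (c : cube nat) : cube nat := fun i => if i == n then b else c i.
pose Sb b : set (cube nat) := [set c | S (upd b c)].
have mSb b : measurable (Sb b).
  apply: IH => c c' cc'; apply: SP => i; rewrite ltnS leq_eqVlt /upd.
  by case: eqP => //= _ /cc'.
have SbE c : S c <-> Sb (c n) c.
  by split; apply: SP => i _; rewrite /upd; case: eqP => // ->.
have mn := measurable_coord n.
rewrite (_ : S = (Sb true `&` [set c | c n]) `|` (Sb false `&` ~` [set c | c n])).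
  by apply: measurableU; apply: measurableI => //; exact: measurableC.
apply/seteqP; split => c.
  by move=> /SbE; case: (boolP (c n)) => cn Sc; [left|right]; split => //=; exact/negP.
by move=> [[Sc /= cn]|[Sc /= /negP/negbTE cn]]; apply/SbE; rewrite cn.
Qed.

Lemma measurable_agree n c : measurable [set c' | agree n c' c].
Proof.
apply: (@measurable_prefix n) => c1 c2 h /= h1.
exact: agree_trans (agree_sym h) h1.
Qed.

Definition set_bit n b (c : cube nat) : cube nat := fun i => if i == n then b else c i.

Lemma agree_set_bit n b c : agree n (set_bit n b c) c.
Proof. by move=> i im; rewrite /set_bit ltn_eqF. Qed.

Lemma agreeS_set_bit n b c c' :
  agree n.+1 c' (set_bit n b c) <-> agree n c' c /\ c' n = b.
Proof.
split=> [/agreeS[h]|[h cn]].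
  rewrite /set_bit eqxx => ->; split=> //; exact: agree_trans h (@agree_set_bit _ _ _).
apply/agreeS; split; last by rewrite /set_bit eqxx.
exact: agree_trans h (agree_sym (@agree_set_bit _ _ _)).
Qed.

Lemma cylinder_agree n c c' : agree n c c' ->
  [set c'' | agree n c'' c] = [set c'' | agree n c'' c'].
Proof.
move=> h; apply/seteqP; split=> c'' /= h'; first exact: agree_trans h' h.
exact: agree_trans h' (agree_sym h).
Qed.

Lemma cylinder_split n c : [set c' | agree n c' c] =
  [set c' | agree n.+1 c' (set_bit n true c)] `|` [set c' | agree n.+1 c' (set_bit n false c)].
Proof.
apply/seteqP; split=> c' /=; last by move=> [|] /agreeS_set_bit[].
by move=> h; case E : (c' n); [left|right]; apply/agreeS_set_bit.
Qed.

Lemma cylinder_disjoint n c : [set c' | agree n.+1 c' (set_bit n true c)] `&`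
  [set c' | agree n.+1 c' (set_bit n false c)] = set0.
Proof.
by apply/seteqP; split => // c' [/agreeS_set_bit[_ h] /agreeS_set_bit[_]]; rewrite h.
Qed.

(** A finitely additive function is determined on the sets depending on finitely
    many bits by its values on cylinders. *)
Lemma prefix_determined (R : realType) (P Q : set (cube nat) -> R) :
  (forall S S', measurable S -> measurable S' -> S `&` S' = set0 ->
    P (S `|` S') = P S + P S') ->
  (forall S S', measurable S -> measurable S' -> S `&` S' = set0 ->
    Q (S `|` S') = Q S + Q S') ->
  (forall n c, P [set c' | agree n c' c] = Q [set c' | agree n c' c]) ->
  forall n S, (forall c c', agree n c c' -> S c -> S c') -> P S = Q S.
Proof.
move=> addP addQ PQ.
have P0 (F : set (cube nat) -> R) : (forall S S', measurable S -> measurable S' ->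
    S `&` S' = set0 -> F (S `|` S') = F S + F S') -> F set0 = 0.
  move=> addF; have := addF set0 set0 measurable0 measurable0 (setI0 _).
  by rewrite setU0 => /eqP; rewrite addrC -subr_eq subrr eq_sym => /eqP.
pose pre n (S : set (cube nat)) := forall c c', agree n c c' -> S c -> S c'.
pose cyl n c := [set c' | agree n c' c].
have key k : forall m c S, pre (m + k)%N S -> P (S `&` cyl m c) = Q (S `&` cyl m c).
  elim: k => [|k IH] m c S preS.
    rewrite addn0 in preS; have [Sc|nSc] := pselect (S c).
      rewrite (_ : S `&` _ = cyl m c); first exact: PQ.
      apply/seteqP; split => [c' []//|c' h]; split=> //.
      exact: preS (agree_sym h) Sc.
    rewrite (_ : S `&` _ = set0) ?(P0 _ addP) ?(P0 _ addQ)//.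
    by apply/seteqP; split => // c' [Sc' h]; apply: nSc; exact: preS h Sc'.
  have mS : measurable S by exact: measurable_prefix preS.
  have mc b : measurable (S `&` cyl m.+1 (set_bit m b c)).
    by apply: measurableI => //; exact: measurable_agree.
  have -> : S `&` cyl m c =
      (S `&` cyl m.+1 (set_bit m true c)) `|` (S `&` cyl m.+1 (set_bit m false c)).
    by rewrite -setIUr; congr setI; exact: cylinder_split.
  have dis : (S `&` cyl m.+1 (set_bit m true c)) `&` (S `&` cyl m.+1 (set_bit m false c)) = set0.
    by rewrite setIACA (cylinder_disjoint m c) setI0.
  by rewrite addP// addQ//; congr (_ + _); apply: IH; rewrite addSnnS.
move=> n S nS; have := key n 0%N (fun=> false) S nS.
by rewrite (_ : cyl _ _ = setT) ?setIT//; apply/seteqP; split.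
Qed.

Lemma cube_measure_unique (R : realType) (P Q : probability (cube nat) R) :
  (forall n c, P [set c' | agree n c' c] = Q [set c' | agree n c' c]) ->
  forall A, measurable A -> P A = Q A.
Proof.
move=> PQ.
pose pre n (S : set (cube nat)) := forall c c', agree n c c' -> S c -> S c'.
apply: (measure_unique [set S | exists n, pre n S] (fun=> setT)) => //.
- apply/seteqP; split.
    apply: smallest_sub; first exact: smallest_sigma_algebra.
    move=> _ [t _ <-]; apply: sub_sigma_algebra; exists t.+1 => c c' /agreeS[_] /= ->//.
  apply: smallest_sub; first exact: sigma_algebra_measurable.
  by move=> S [n]; exact: measurable_prefix.
- move=> S S' [n nS] [n' nS']; exists (maxn n n') => c c' h [Sc S'c]; split.
    by apply: nS Sc; apply: agree_le h; rewrite leq_maxl.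
  by apply: nS' S'c; apply: agree_le h; rewrite leq_maxr.
- by move=> _; exists 0%N.
- by apply/seteqP; split => // c _; exists 0%N.
- move=> S [n nS]; have mS : measurable S by exact: measurable_prefix nS.
  rewrite -[LHS]fineK ?fin_num_measure// -[RHS]fineK ?fin_num_measure//; congr EFin.
  apply: (@prefix_determined R (fun S => fine (P S)) (fun S => fine (Q S)) _ _ _ n S nS).
  + by move=> S1 S2 m1 m2 S12; exact: pr_setU.
  + by move=> S1 S2 m1 m2 S12; exact: pr_setU.
  + by move=> k c; rewrite PQ.
- by move=> _; rewrite ltey_eq fin_num_measure.
Qed.

Section prefix_recursion.
Variable D : nat -> cube nat -> bool.
Hypothesis DP : forall n c c', agree n c c' -> D n c = D n c'.

Fixpoint branch_approx n : cube nat :=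
  if n is m.+1 then (fun i => if i == m then D m (branch_approx m) else branch_approx m i)
  else fun=> false.

(** The diagonal of the finite approximations; the recursion that it solves is
    [branchE]. *)
Definition branch : cube nat := fun n => branch_approx n.+1 n.

Lemma agree_branch_approx n : agree n branch (branch_approx n).
Proof.
elim: n => [//|n IH]; apply/agreeS; split=> [i ni|//].
by rewrite IH//= ltn_eqF.
Qed.

Lemma branchE n : branch n = D n branch.
Proof. by rewrite /branch/= eqxx; apply: DP; apply/agree_sym/agree_branch_approx. Qed.

Lemma branch_unique c n : (forall i, (i < n)%N -> c i = D i c) -> agree n branch c.
Proof.
elim: n => [//|n IH] h; apply/agreeS.
have bc : agree n branch c by apply: IH => i ni; apply: h; exact: ltnW.
by split=> //; rewrite branchE h//; exact: DP.
Qed.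

End prefix_recursion.

Lemma measurable_branch d (Y : measurableType d) (D : Y -> nat -> cube nat -> bool) :
  (forall n (g : Y -> cube nat), measurable_fun setT g ->
    measurable [set y | D y n (g y)]) ->
  measurable_fun setT (fun y => branch (D y)).
Proof.
move=> mD; have mA n : measurable_fun setT (fun y => branch_approx (D y) n).
  elim: n => [|n IH]; first exact: measurable_cst.
  apply: measurable_fun_cube => t /=; case: (eqVneq t n) => [_|_]; first exact: mD.
  exact: (measurable_cube_coord t IH).
by apply: measurable_fun_cube => n; exact: (measurable_cube_coord n (mA n.+1)).
Qed.

(** A map from sequences of bits to real numbers and a map back. The real number
    of a sequence [c] is the sum of the increments [q n c] over the bits [n] set
    in [c]; the increments may depend on the previous bits. *)
Section greedy_expansion.
Context (R : realType) (q : nat -> cube nat -> R).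
Hypothesis qP : forall n c c', agree n c c' -> q n c = q n c'.
Hypothesis q_ge0 : forall n c, 0 <= q n c.

Definition partial_sum n (c : cube nat) : R := \sum_(i < n) (if c i then q i c else 0).

Lemma partial_sumS n c :
  partial_sum n.+1 c = partial_sum n c + (if c n then q n c else 0).
Proof. by rewrite /partial_sum big_ord_recr. Qed.

Lemma partial_sum_agree n c c' : agree n c c' -> partial_sum n c = partial_sum n c'.
Proof.
move=> h; apply: eq_bigr => i _; rewrite h// (qP (c' := c'))//.
exact: agree_le (ltnW (ltn_ord i)) h.
Qed.

Lemma partial_sum_le m n c : (m <= n)%N -> partial_sum m c <= partial_sum n c.
Proof.
move=> mn; rewrite -(subnKC mn); elim: (n - m)%N => [|k IH]; first by rewrite addn0.
by rewrite addnS partial_sumS ler_wpDr//; case: ifP.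
Qed.

Lemma measurable_partial_sum n : measurable_fun setT (partial_sum n).
Proof.
move=> _ B mB; rewrite setTI; apply: (@measurable_prefix n) => c c' h /=.
by rewrite (partial_sum_agree h).
Qed.

Lemma measurable_increment n : measurable_fun setT (q n).
Proof.
move=> _ B mB; rewrite setTI; apply: (@measurable_prefix n) => c c' h /=.
by rewrite (qP h).
Qed.

(** The greedy algorithm sets a bit whenever the increment still fits below the
    target [u]; with the increments [2^-n.+1] it is binary expansion. *)
Definition greedy_bit (u : R) n (c : cube nat) : bool := partial_sum n c + q n c <= u.

Lemma greedy_bitP u n c c' : agree n c c' -> greedy_bit u n c = greedy_bit u n c'.
Proof. by move=> h; rewrite /greedy_bit (partial_sum_agree h) (qP h). Qed.

Definition expansion (u : R) : cube nat := branch (greedy_bit u).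

Lemma measurable_expansion : measurable_fun setT expansion.
Proof.
apply: measurable_branch => n g mg.
have mf : measurable_fun setT (fun u => partial_sum n (g u) + q n (g u)).
  apply: measurable_funD.
    exact: (measurableT_comp (measurable_partial_sum n) mg).
  exact: (measurableT_comp (measurable_increment n) mg).
have := measurable_fun_ler mf (@measurable_id _ _ setT).
move=> /(_ measurableT [set true] Logic.I); rewrite setTI.
by congr measurable; apply/seteqP.
Qed.

Hypothesis sum_le1 : forall n c, partial_sum n c <= 1.

Definition total (c : cube nat) : R := limn (partial_sum ^~ c).

Lemma cvg_partial_sum c : partial_sum ^~ c @ \oo --> total c.
Proof.
apply: nondecreasing_is_cvgn; first by move=> m n; exact: partial_sum_le.
by exists 1 => _ [n _ <-].
Qed.

Lemma partial_sum_le_total n c : partial_sum n c <= total c.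
Proof.
apply: nondecreasing_cvgn_le; first by move=> i j; exact: partial_sum_le.
exact: cvg_partial_sum.
Qed.

Lemma total_le c b : (forall n, partial_sum n c <= b) -> total c <= b.
Proof. by move=> h; apply: limr_le; [exact: cvg_partial_sum|exact: nearW]. Qed.

Lemma measurable_total : measurable_fun setT total.
Proof.
apply: (measurable_fun_cvg (h := partial_sum)); first exact: measurable_partial_sum.
by move=> c _; exact: cvg_partial_sum.
Qed.

End greedy_expansion.

(** The ternary Cantor set: sequences of bits inject measurably into the unit
    interval, with a measurable left inverse. *)
Lemma cantor_embedding (R : realType) : exists (f : cube nat -> R) (g : R -> cube nat),
  [/\ measurable_fun setT f, measurable_fun setT g, cancel f g &
      forall c, 0 <= f c <= 1].
Proof.
pose q (n : nat) (c : cube nat) : R := 2 * 3^-1 ^+ n.+1.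
have qP n c c' : agree n c c' -> q n c = q n c' by [].
have q0 n c : 0 <= q n c by rewrite mulr_ge0// exprn_ge0// invr_ge0.
(* All the digits from [m] on contribute at most [3^-m], which is less than the
   single increment [2 * 3^-m] of the previous digit: greed finds the digits. *)
have tail m n c : (m <= n)%N ->
    partial_sum q n c <= partial_sum q m c + (3^-1 ^+ m - 3^-1 ^+ n).
  move=> mn; rewrite -(subnKC mn); elim: (n - m)%N => [|k IH].
    by rewrite addn0 subrr addr0.
  rewrite addnS partial_sumS.
  have : (if c (m + k)%N then q (m + k)%N c else 0) <= 2 * 3^-1 ^+ (m + k).+1.
    by case: ifP => // _; exact: (q0 _ c).
  have : 3^-1 ^+ (m + k) = 3 * 3^-1 ^+ (m + k).+1 :> R by rewrite exprS mulrA divff ?mul1r.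
  by move: IH; lra.
have bound n c : partial_sum q n c <= 1.
  have := @tail 0%N n c (leq0n _); rewrite {2}/partial_sum big_ord0 add0r expr0.
  have : 0 <= (3^-1 : R) ^+ n by rewrite exprn_ge0// invr_ge0.
  lra.
exists (total q), (expansion q); split.
- exact: measurable_total.
- exact: measurable_expansion.
- move=> c; apply/funext => n.
  have : agree n.+1 (expansion q (total q c)) c.
    apply: branch_unique => [k c1 c2|i _]; first exact: greedy_bitP.
    rewrite /greedy_bit; apply/esym; have [ci|ci] := boolP (c i).
      apply: le_trans (partial_sum_le_total q0 bound i.+1 c).
      by rewrite partial_sumS ci.
    apply/negbTE; rewrite -ltNge.
    apply: (@le_lt_trans _ _ (partial_sum q i c + 3^-1 ^+ i.+1)).
      apply: (total_le q0 bound) => k.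
      apply: (@le_trans _ _ (partial_sum q (maxn i.+1 k) c)).
        by apply: partial_sum_le => //; rewrite leq_maxr.
      apply: le_trans (tail _ _ _ (leq_maxl i.+1 k)) _.
      rewrite partial_sumS (negbTE ci) addr0 lerD2l gerBl.
      by rewrite exprn_ge0// invr_ge0.
    by rewrite ltrD2l /q ltr_pMl ?ltr1n// exprn_gt0// invr_gt0.
  by apply; exact: ltnSn.
- move=> c; apply/andP; split; last exact: total_le.
  have := partial_sum_le_total q0 bound 0 c.
  by rewrite {1}/partial_sum big_ord0.
Qed.

(** Consistent masses of cylinders are realized by the uniform distribution: the
    cylinders correspond to nested intervals whose lengths are the masses. *)
Section tree_map.
Context (R : realType) (p : nat -> cube nat -> R).
Local Notation U01 := (uniform_prob (@ltr01 R) : probability _ R).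
Hypothesis pP : forall n c c', agree n c c' -> p n c = p n c'.
Hypothesis p_ge0 : forall n c, 0 <= p n c.
Hypothesis p0 : forall c, p 0 c = 1.
Hypothesis p_split : forall n c,
  p n c = p n.+1 (set_bit n true c) + p n.+1 (set_bit n false c).

Let q n c : R := p n.+1 (set_bit n false c).

Let qP n c c' : agree n c c' -> q n c = q n c'.
Proof.
move=> h; apply: pP; apply/agreeS_set_bit; split; last by rewrite /set_bit eqxx.
exact: agree_trans (@agree_set_bit _ _ _) h.
Qed.

Let q_ge0 n c : 0 <= q n c. Proof. exact: p_ge0. Qed.

Let q_le_p n c : q n c <= p n c.
Proof. by rewrite [leRHS]p_split lerDr. Qed.

Let pS n c : p n.+1 c = if c n then p n c - q n c else q n c.
Proof.
have E : p n.+1 c = p n.+1 (set_bit n (c n) c) by apply: pP; exact/agreeS_set_bit.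
rewrite E; case: (c n) => //.
by rewrite [p n c]p_split addrK.
Qed.

Let lo := partial_sum q.

Let loS n c : lo n.+1 c = lo n c + (if c n then q n c else 0).
Proof. exact: partial_sumS. Qed.

Let hi_S n c : lo n.+1 c + p n.+1 c <= lo n c + p n c.
Proof.
rewrite loS pS; case: ifP => _; first by lra.
by rewrite addr0 lerD2l q_le_p.
Qed.

Let hi_le m n c : (m <= n)%N -> lo n c + p n c <= lo m c + p m c.
Proof.
move=> mn; rewrite -(subnKC mn); elim: (n - m)%N => [|k IH]; first by rewrite addn0.
by rewrite addnS; apply: le_trans (hi_S _ _) IH.
Qed.

Let hi1 n c : lo n c + p n c <= 1.
Proof.
apply: le_trans (hi_le c (leq0n n)) _.
by rewrite /lo/partial_sum big_ord0 add0r p0.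
Qed.

Let lo_ge0 n c : 0 <= lo n c.
Proof. by apply: sumr_ge0 => i _; case: ifP. Qed.

Let lo_le1 n c : lo n c <= 1.
Proof. by apply: le_trans (hi1 n c); rewrite lerDl. Qed.

Let W := expansion q.

(** The interval of the cylinder of [c] starts at [lo n c] and has length [p n c];
    the half with bit [false] comes first, whence the increment [q]. *)
Let W_itv n c u : lo n c <= u < lo n c + p n c -> agree n (W u) c.
Proof.
move=> /andP[lu ul]; apply: branch_unique => [k c1 c2|i ni]; first exact: greedy_bitP.
rewrite /greedy_bit -/lo; apply/esym; have [ci|ci] := boolP (c i).
  apply: le_trans lu; apply: le_trans (partial_sum_le q_ge0 c ni).
  by rewrite partial_sumS ci.
apply/negbTE; rewrite -ltNge; apply: lt_le_trans ul _.
apply: le_trans (hi_le c ni) _.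
by rewrite loS pS (negbTE ci) addr0.
Qed.

Let W_in n u : 0 <= u < 1 -> lo n (W u) <= u < lo n (W u) + p n (W u).
Proof.
move=> /andP[u0 u1]; elim: n => [|n /andP[lu ul]].
  by rewrite /lo/partial_sum big_ord0 add0r u0/= p0.
rewrite loS pS.
have -> : W u n = (lo n (W u) + q n (W u) <= u).
  by rewrite {1}/W /expansion branchE// => k c1 c2; exact: greedy_bitP.
case: (leP (lo n (W u) + q n (W u)) u) => h; apply/andP; split; by move: ul lu h; lra.
Qed.

Let W_agree n c u : 0 <= u < 1 -> agree n (W u) c <-> lo n c <= u < lo n c + p n c.
Proof.
move=> u01; split=> [h|]; last exact: W_itv.
by rewrite -(pP h) /lo -(partial_sum_agree qP h); exact: W_in.
Qed.

Let mW : measurable_fun setT W. Proof. exact: measurable_expansion. Qed.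

Let W_law n c : fine (U01 (W @^-1` [set c' | agree n c' c])) = p n c.
Proof.
have mI := @measurable_itv_co R.
have mWn := measurable_preimage mW (measurable_agree n c).
have agr u : ~ (~` [set u : R | 0 <= u < 1]) u ->
    ((W @^-1` [set c' | agree n c' c]) u <-> [set u | lo n c <= u < lo n c + p n c] u).
  by move=> /contrapT/= u01; exact: W_agree.
have := pr_agree U01 mWn (mI _ _) (measurableC (mI _ _)) agr.
have hp : lo n c <= lo n c + p n c by rewrite lerDl.
rewrite [X in `|_ - X|](uniform_itv (lo_ge0 n c) hp (hi1 n c)).
rewrite [leRHS]pr_setC; last exact: mI.
rewrite [X in 1 - X](uniform_itv (lexx 0) ler01 (lexx 1)) subr0 subrr normr_le0 subr_eq0.
by move=> /eqP ->; rewrite addrAC subrr add0r.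
Qed.

(** The left end of the intervals containing [u] tends to [u] when their lengths
    tend to 0. *)
Let total_W u : (forall c eps, 0 < eps -> exists n, p n c < eps) ->
  0 <= u < 1 -> total q (W u) = u.
Proof.
move=> p_small u01; apply/eqP; rewrite eq_le; apply/andP; split.
  by apply: (total_le q_ge0 lo_le1) => n; have /andP[] := W_in n u01.
apply/ler_addgt0Pr => eps eps0.
have [n pn] := p_small (W u) eps eps0.
have /andP[_ ul] := W_in n u01.
by have := partial_sum_le_total q_ge0 lo_le1 n (W u); rewrite -/lo; lra.
Qed.

Lemma tree_masses : exists W' : R -> cube nat,
  [/\ measurable_fun setT W',
      forall n c, fine (U01 (W' @^-1` [set c' | agree n c' c])) = p n c &
    (forall c eps, 0 < eps -> exists n, p n c < eps) -> exists h : cube nat -> R,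
      measurable_fun setT h /\ forall u, 0 <= u < 1 -> h (W' u) = u].
Proof.
exists W; split; [exact: mW|exact: W_law|move=> p_small].
exists (total q); split; last by move=> u; exact: total_W.
exact: measurable_total.
Qed.

End tree_map.

(** For a nonatomic law the intervals shrink to points, whence the left inverse. *)
Lemma tree_law (R : realType) (lam : probability (cube nat) R) :
  exists W : R -> cube nat, [/\ measurable_fun setT W,
    forall A, measurable A ->
      (uniform_prob (@ltr01 R) : probability _ R) (W @^-1` A) = lam A &
    (forall c, lam [set c] = 0%E) -> exists h : cube nat -> R,
      measurable_fun setT h /\ forall u, 0 <= u < 1 -> h (W u) = u].
Proof.
pose p n c : R := fine (lam [set c' | agree n c' c]).
have pP n c c' : agree n c c' -> p n c = p n c'.
  by move=> /cylinder_agree h; rewrite /p h.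
have p0 c : p 0 c = 1.
  by rewrite /p (_ : mkset _ = setT) ?pr_setT//; apply/seteqP; split.
have p_split n c : p n c = p n.+1 (set_bit n true c) + p n.+1 (set_bit n false c).
  rewrite /p cylinder_split pr_setU//; last exact: cylinder_disjoint.
  - exact: measurable_agree.
  - exact: measurable_agree.
have [W [mW lawW hW]] := tree_masses pP (fun n c => pr_ge0 lam _) p0 p_split.
exists W; split => //.
  have [P PE] := image_probability (uniform_prob (@ltr01 R)) mW.
  move=> A mA; rewrite -PE; apply: cube_measure_unique mA => n c; rewrite PE.
  have mn := measurable_agree n c.
  have mWn := measurable_preimage mW mn.
  rewrite -[LHS]fineK ?fin_num_measure// -[RHS]fineK ?fin_num_measure//; congr EFin.
  exact: lawW.
move=> lam0; apply: hW => c eps eps0.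
have cvgp : p n c @[n --> \oo] --> (0 : R).
  apply: (@fine_cvg _ _ _ _ _ 0).
  rewrite (_ : 0%:E = lam [set c]); last by rewrite lam0.
  rewrite (_ : [set c] = \bigcap_n [set c' | agree n c' c]).
    apply: nonincreasing_cvg_mu.
    - by rewrite ltey_eq fin_num_measure//; exact: measurable_agree.
    - by move=> n; exact: measurable_agree.
    - by apply: bigcapT_measurable => n; exact: measurable_agree.
    - by move=> m n mn; apply/subsetPset => c'; exact: agree_le.
  apply/seteqP; split => [_ -> n _ //|c' h].
  by apply/funext => n; apply: (h n.+1 Logic.I).
have /cvgrPdist_lt/(_ _ eps0)[n _ /(_ n (leqnn n))] := cvgp.
by rewrite sub0r normrN ger0_norm ?pr_ge0// => h; exists n.
Qed.

(** * Standard Borel spaces as retracts of the Cantor space *)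

Lemma measurable_prop d (Y : measurableType d) (Q : Prop) : measurable [set _ : Y | Q].
Proof.
have [q|nq] := pselect Q.
  rewrite (_ : mkset _ = setT); first exact: measurableT.
  by apply/seteqP; split.
rewrite (_ : mkset _ = set0); first exact: measurable0.
by apply/seteqP; split.
Qed.

(** The form in which standardness of a Borel space is used: equality becomes
    measurable, and laws can be studied on the Cantor space. *)
Definition cube_retract d (Y : measurableType d) :=
  exists (j : Y -> cube nat) (r : cube nat -> Y),
    [/\ measurable_fun setT j, measurable_fun setT r & cancel j r].

Lemma measurable_shift (f : nat -> nat) :
  measurable_fun setT ((fun c => c \o f) : cube nat -> cube nat).
Proof. by apply: measurable_fun_cube => n; exact: measurable_coord (f n). Qed.

(** One additional bit tells the copy. *)
Lemma cube_retract_double d (X : measurableType d) : cube_retract X ->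
  cube_retract (disjoint_union (fun _ : 'I_2 => X)).
Proof.
move=> [j [r [mj mr jK]]].
pose J (z : disjoint_union (fun _ : 'I_2 => X)) : cube nat :=
  fun n => if n is m.+1 then j (projT2 z) m else projT1 z == ord0.
pose emb : 'I_2 -> X -> disjoint_union (fun _ : 'I_2 => X) := @embed _ 1 (fun=> X).
pose Rr (c : cube nat) : disjoint_union (fun _ : 'I_2 => X) :=
  emb (if c 0%N then ord0 else ord_max) (r (c \o S)).
exists J, Rr; split.
- apply: measurable_fun_cube => -[|n]; apply/measurable_unionP => i.
    rewrite /J /=; have [i0|i0] := eqVneq i ord0.
      rewrite (_ : _ @^-1` _ = setT)//; apply/seteqP; split => // x _ /=.
      by rewrite i0.
    rewrite (_ : _ @^-1` _ = set0)//; apply/seteqP; split => // x /=.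
    by rewrite (negbTE i0).
  exact: (measurable_cube_coord n mj).
- move=> _ A mA; rewrite setTI.
  have mrs : measurable_fun setT (fun c : cube nat => r (c \o S)).
    exact: (measurableT_comp mr (measurable_shift S)).
  rewrite (_ : _ @^-1` _ =
    ([set c : cube nat | c 0%N] `&` (fun c : cube nat => r (c \o S)) @^-1` (emb ord0 @^-1` A)) `|`
    (~` [set c : cube nat | c 0%N] `&` (fun c : cube nat => r (c \o S)) @^-1` (emb ord_max @^-1` A))).
    have m0 := measurable_coord 0%N.
    by apply: measurableU; apply: measurableI;
      [|exact: (measurable_preimage mrs (mA ord0))|exact: measurableC
       |exact: (measurable_preimage mrs (mA ord_max))].
  apply/seteqP; split => c; rewrite /Rr /=; case: (c 0%N) => //=.
  + by left.
  + by right.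
  + by move=> [[]|[]].
  + by move=> [[]|[]].
- move=> [i x]; rewrite /Rr /J /=.
  have -> : r (j x) = x by [].
  rewrite /emb /embed; congr existT; have [->//|i0] := eqVneq i ord0.
  by apply/val_inj; case: i i0 => -[|[|]].
Qed.

Lemma cube_retract_cube (T : Type) (tau : nat -> T) : (forall t, exists n, tau n = t) ->
  cube_retract (cube T).
Proof.
move=> /choice[idx idxK].
exists (fun z => z \o tau), (fun c => c \o idx); split.
- by apply: measurable_fun_cube => n; exact: measurable_coord (tau n).
- by apply: measurable_fun_cube => t; exact: measurable_coord (idx t).
- by move=> z; apply/funext => t /=; rewrite idxK.
Qed.

Lemma countable_enum (T : pointedType) (D : set T) : countable D ->
  exists f : nat -> T, D `<=` range f.
Proof.
move=> /countable_injP[f injf].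
exists (fun n => xget point [set x | D x /\ f x = n]) => x Dx; exists (f x) => //.
case: xgetP => [y _ [Dy fy]|/(_ x)]; first by apply: injf; rewrite ?inE.
by move=> /not_andP[].
Qed.

Lemma measurable_fiber_nat d (Y : measurableType d) (i : Y -> nat) (S : set nat) :
  (forall n, measurable (i @^-1` [set n])) -> measurable (i @^-1` S).
Proof.
move=> mi; rewrite (_ : _ @^-1` _ = \bigcup_(n in S) i @^-1` [set n]).
  by apply: bigcup_measurable => n _.
by apply/seteqP; split => [y Sy|y [n Sn /= ->]]; [exists (i y)|].
Qed.

(** A point of a Polish space is coded by the set of the balls of a countable base
    that contain it in their interior. Conversely a code gives for each radius a
    first marked ball, and the limit of the centers if each of them is close
    to the next; the retraction is constant on the other codes. *)
Section polish_retract.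
Context (R : realType) (P : completePseudoMetricType R).
Hypothesis PH : hausdorff_space P.
Variables (e : nat -> P).
Hypothesis e_dense : dense (range e).

Let rad m : R := 2^-1 ^+ m.

Let rad_gt0 m : 0 < rad m. Proof. by rewrite exprn_gt0// invr_gt0. Qed.

Let radS m : rad m = rad m.+1 + rad m.+1.
Proof. by rewrite /rad exprS; lra. Qed.

Let rad_small eps : 0 < eps -> exists m, forall n, (m <= n)%N -> rad n < eps.
Proof. exact: half_power_small. Qed.

Let code (i m : nat) : nat := pickle (i, m).

Let bits (x : P) : cube nat := fun n =>
  if unpickle n is Some (i, m) then `[< interior (ball (e i : P) (rad m)) x >] else false.

Let bitsE x i m : bits x (code i m) = `[< interior (ball (e i) (rad m)) x >].
Proof. by rewrite /bits /code pickleK. Qed.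

(** The first of the points [e i] whose ball of radius [rad m] is marked. *)
Let idx m (c : cube nat) : nat :=
  if pselect (exists i, c (code i m)) is left h then ex_minn h else 0%N.

Let idxP m (c : cube nat) : (exists i, c (code i m)) -> c (code (idx m c) m).
Proof. by move=> h; rewrite /idx; case: pselect => // h'; case: ex_minnP. Qed.

Let measurable_idx m n : measurable (idx m @^-1` [set n]).
Proof.
pose A : set (cube nat) := [set c | c (code n m)] `&`
  \bigcap_(i in `I_n) ~` [set c | c (code i m)].
pose B : set (cube nat) := [set _ | n = 0%N] `&` \bigcap_i ~` [set c | c (code i m)].
rewrite (_ : _ @^-1` _ = A `|` B).
  have mc i := measurable_coord (code i m).
  apply: measurableU; apply: measurableI; first exact: mc.
  - by apply: bigcap_measurableType => i _; exact: measurableC.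
  - exact: measurable_prop.
  - by apply: bigcapT_measurable => i; exact: measurableC.
apply/seteqP; split => c; rewrite /idx /A /B /=.
  case: pselect => [h|h <-].
    case: ex_minnP => i ci imin <-; left; split=> // j /= ji cj.
    by have := imin _ cj; rewrite leqNgt ji.
  by right; split=> // i _ /= ci; apply: h; exists i.
move=> [[cn h]|[-> h]]; case: pselect => h'.
- case: ex_minnP => i ci imin; apply/eqP; rewrite eqn_leq imin//= leqNgt.
  by apply/negP => /h.
- by exfalso; apply: h'; exists n.
- by case: (h') => i ci; have := h i Logic.I.
- by [].
Qed.

Let pt m c : P := e (idx m c).

(** The codes whose marked points form a sequence of controlled oscillation. *)
Let good : set (cube nat) :=
  [set c | forall m, ball (pt m c) (rad m + rad m.+1) (pt m.+1 c)].

Let measurable_good : measurable good.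
Proof.
rewrite (_ : good = \bigcap_m [set c | ball (pt m c) (rad m + rad m.+1) (pt m.+1 c)]).
  apply: bigcapT_measurable => m.
  pose Q := [set p : nat * nat | ball (e p.1) (rad m + rad m.+1) (e p.2)].
  rewrite (_ : mkset _ = (fun c => pickle (idx m c, idx m.+1 c)) @^-1` (pickle @` Q)).
    apply: measurable_fiber_nat => n.
    case E : (unpickle n : option (nat * nat)) => [[i k]|].
      have [nE|nE] := eqVneq n (pickle (i, k)); last first.
        rewrite (_ : _ @^-1` _ = set0)//; apply/seteqP; split => // c /= h.
        by move: E nE; rewrite -h pickleK => -[-> ->]; rewrite eqxx.
      rewrite (_ : _ @^-1` _ = idx m @^-1` [set i] `&` idx m.+1 @^-1` [set k]).
        exact: measurableI.
      apply/seteqP; split => c /=; first by move=> h; move: E; rewrite -h pickleK => -[-> ->].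
      by move=> [-> ->].
    rewrite (_ : _ @^-1` _ = set0)//; apply/seteqP; split => // c /= h.
    by move: E; rewrite -h pickleK.
  apply/seteqP; split => c /=; first by move=> h; exists (idx m c, idx m.+1 c).
  by move=> [[i k] Qik /(pcan_inj pickleK)[ik1 ik2]]; rewrite /pt -ik1 -ik2.
by apply/seteqP; split => c h m; [move=> _; exact: h|exact: h m Logic.I].
Qed.

Let ball_far c : good c -> forall k m, ball (pt m c) (4 * rad m - 4 * rad (m + k) + rad (m + k)) (pt (m + k) c).
Proof.
move=> gc; elim=> [|k IH] m; first by rewrite addn0 subrr add0r; exact: ballxx.
have h : 4 * rad m - 4 * rad (m + k.+1) + rad (m + k.+1) =
    (rad m + rad m.+1) + (4 * rad m.+1 - 4 * rad (m.+1 + k) + rad (m.+1 + k)) + rad m.+1.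
  by rewrite addnS addSn (radS m); lra.
rewrite h addnS -addSn.
apply: (@le_ball _ _ _ ((rad m + rad m.+1) + (4 * rad m.+1 - 4 * rad (m.+1 + k) + rad (m.+1 + k)))).
  by rewrite lerDl ltW.
exact: ball_triangle (gc m) (IH _).
Qed.

Let lim_pt c : P := if pselect (good c) is left _ then lim (pt ^~ c @ \oo) else e 0%N.

Let cvg_pt c : good c -> pt ^~ c @ \oo --> lim_pt c.
Proof.
move=> gc; rewrite /lim_pt; case: pselect => // _.
apply: cauchy_cvg; apply/cauchyP => eps eps0.
have eps40 : 0 < eps / 4 by rewrite divr_gt0.
have [m /(_ m (leqnn m)) h] := rad_small eps40.
exists (pt m c); exists m => // n /= mn.
rewrite -(subnKC mn); apply: le_ball (ball_far gc _ _).
by have := rad_gt0 (m + (n - m)); move: h; lra.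
Qed.

Let measurable_lim_pt (O : set P) : open O -> measurable (lim_pt @^-1` O).
Proof.
move=> oO.
pose A M k : set (cube nat) := \bigcap_(m in [set m | (M <= m)%N])
  (idx m @^-1` [set i | ball (e i) (rad k) `<=` O]).
have AE c : good c -> O (lim_pt c) <-> (\bigcup_M \bigcup_k A M k) c.
  move=> gc; have lc := cvg_pt gc; split=> [Oc|[M _ [k _ AMk]]].
    have /nbhs_ballP[eps /= eps0 epsO] : nbhs (lim_pt c) O by exact: open_nbhs_nbhs.
    have eps20 : 0 < eps / 2 by rewrite divr_gt0.
    have [k /(_ k (leqnn k)) h] := rad_small eps20.
    have hk : rad k + rad k < eps by lra.
    have /cvg_ball/(_ (rad k) (rad_gt0 k))[M _ hM] := lc.
    exists M => //; exists k => // m /= Mm x bx; apply: epsO.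
    apply: le_ball (ltW hk) _ _; apply: ball_triangle bx; exact: hM.
  have /cvg_ball/(_ (rad k) (rad_gt0 k))[M' _ hM'] := lc.
  apply: (AMk (maxn M M')); first by rewrite /= leq_maxl.
  by apply: ball_sym; apply: hM'; rewrite /= leq_maxr.
have mA : measurable (\bigcup_M \bigcup_k A M k).
  apply: bigcupT_measurable => M; apply: bigcupT_measurable => k.
  apply: bigcap_measurableType => m _; apply: measurable_fiber_nat => n.
  exact: measurable_idx.
rewrite (_ : _ @^-1` _ = (good `&` \bigcup_M \bigcup_k A M k) `|`
    (~` good `&` [set _ | O (e 0%N)])).
  have mg := measurable_good.
  apply: measurableU; first exact: measurableI.
  apply: measurableI; first exact: measurableC.
  exact: measurable_prop.
apply/seteqP; split => c /=.
  have [gc|ngc] := pselect (good c); first by move=> /(AE _ gc); left.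
  by rewrite {1}/lim_pt; case: pselect => // _ Oe; right.
move=> [[gc /(AE _ gc)//]|[ngc Oe]].
by rewrite /lim_pt; case: pselect.
Qed.

Let bits_near x m : ball (pt m (bits x)) (rad m) x.
Proof.
have [i hi] : exists i, bits x (code i m).
  have [z [bx [i _ ei]]] : (interior (ball x (rad m.+1)) `&` range e) !=set0.
    apply: e_dense; last exact: open_interior.
    by exists x; apply: nbhsx_ballx.
  exists i; rewrite bitsE; apply/asboolP.
  have xe : ball (e i) (rad m.+1) x by rewrite ei; apply/ball_sym; exact: interior_subset bx.
  apply/nbhs_ballP; exists (rad m.+1) => //= y xy.
  by rewrite radS; exact: ball_triangle xe xy.
have := idxP (ex_intro _ i hi); rewrite bitsE => /asboolP; exact: interior_subset.
Qed.

Let bitsK x : lim_pt (bits x) = x.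
Proof.
have gx : good (bits x).
  by move=> m; exact: ball_triangle (bits_near x m) (ball_sym (bits_near x m.+1)).
have h := cvg_pt gx; have h' : pt ^~ (bits x) @ \oo --> x.
  apply/cvg_ballP => eps eps0.
  have [m hm] := rad_small eps0.
  exists m => // n /= mn; apply: ball_sym; apply: le_ball (bits_near x n).
  by rewrite ltW// hm.
exact: cvg_unique h h'.
Qed.

Let bits_open n : open [set x | bits x n].
Proof.
rewrite /bits; case: (unpickle n : option (nat * nat)) => [[i m]|].
  rewrite (_ : mkset _ = interior (ball (e i) (rad m))); first exact: open_interior.
  by apply/seteqP; split => x /asboolP.
by rewrite (_ : mkset _ = set0); [exact: open0|apply/seteqP; split].
Qed.

Lemma polish_retract : exists (j : P -> cube nat) (r : cube nat -> P),
  [/\ forall n, open [set x | j x n],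
      forall O, open O -> measurable (r @^-1` O) & cancel j r].
Proof. by exists bits, lim_pt; split; [exact: bits_open|exact: measurable_lim_pt|exact: bitsK]. Qed.

End polish_retract.

Lemma standard_borel_retract (R : realType) d (X : measurableType d) :
  standard_borel R X -> cube_retract X.
Proof.
move=> [P [f [[PH [D cD dD]] [g fK gK] mX]]].
have [e De] := countable_enum cD.
have e_dense : dense (range e).
  by move=> O O0 oO; have [x [Ox Dx]] := dD O O0 oO; exists x; split=> //; exact: De.
have [j [r [oj mr jK]]] := polish_retract PH e_dense.
have imE (A : set X) : f @` A = g @^-1` A.
  apply/seteqP; split => [_ [x Ax <-]|y Ay] /=; first by rewrite fK.
  by exists (g y).
exists (j \o f), (g \o r); split.
- apply: measurable_fun_cube => n; apply/mX; apply: sub_sigma_algebra => /=.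
  rewrite imE (_ : _ @^-1` _ = [set x | j x n])//.
  by apply/seteqP; split => x /=; rewrite gK.
- move=> _ A /mX mA; rewrite setTI.
  rewrite (_ : _ @^-1` _ = r @^-1` (f @` A)); last by rewrite imE.
  pose GP := [set B : set P | measurable (r @^-1` B)].
  suff : <<s [set U : set P | open U] >> `<=` GP by apply.
  apply: smallest_sub; last by move=> O; exact: mr.
  split.
  + by rewrite /GP/= preimage_set0.
  + by move=> B mB; rewrite /GP/= setTD preimage_setC; exact: measurableC.
  + by move=> F mF; rewrite /GP/= preimage_bigcup; exact: bigcupT_measurable.
- by move=> x /=; rewrite jK fK.
Qed.

(** * Almost isomorphism with the unit interval *)

Section full_measure.
Context (R : realType) d (Y : measurableType d) (nu : probability Y R).
Implicit Types A B C : set Y.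

Lemma full_sub A B : measurable A -> measurable B -> A `<=` B -> nu A = 1%E -> nu B = 1%E.
Proof.
move=> mA mB AB A1; apply/eqP; rewrite eq_le probability_le1//= -A1.
by rewrite le_measure ?inE.
Qed.

Lemma full_setC A : measurable A -> nu A = 1%E <-> nu (~` A) = 0%E.
Proof.
move=> mA; split=> [A1|A0]; first by rewrite probability_setC// A1 subee.
by rewrite -[A]setCK probability_setC ?A0 ?sube0//; exact: measurableC.
Qed.

Lemma full_agree A B C : measurable A -> measurable B -> measurable C ->
  nu A = 1%E -> (forall x, A x -> (B x <-> C x)) -> nu B = nu C.
Proof.
move=> mA mB mC A1 BC.
rewrite -[LHS]fineK ?fin_num_measure// -[RHS]fineK ?fin_num_measure//; congr EFin.
have := @pr_agree _ _ _ nu B C (~` A) mB mC (measurableC mA) (fun x h => BC x (contrapT h)).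
by rewrite ((full_setC mA).1 A1)/= normr_le0 subr_eq0 => /eqP.
Qed.

Lemma full_setI A B : measurable A -> measurable B -> nu A = 1%E -> nu B = 1%E ->
  nu (A `&` B) = 1%E.
Proof.
move=> mA mB A1 B1; rewrite -B1; apply: (full_agree mA) => //; first exact: measurableI.
by move=> x Ax; split=> [[]|].
Qed.

Lemma null_sub A B : measurable A -> measurable B -> A `<=` B -> nu B = 0%E -> nu A = 0%E.
Proof.
move=> mA mB AB B0; apply/eqP; rewrite eq_le measure_ge0 andbT -B0.
by rewrite le_measure ?inE.
Qed.

End full_measure.

Lemma measurable_fixed_retract d1 d2 (Z : measurableType d1) (Y : measurableType d2)
    (f : Z -> Y) (g : Y -> Z) : cube_retract Z ->
  measurable_fun setT f -> measurable_fun setT g -> measurable [set z | g (f z) = z].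
Proof.
move=> [j [r [mj _ jK]]] mf mg.
rewrite (_ : mkset _ = [set z | (j \o (g \o f)) z = j z]).
  apply: measurable_eq_cube => //.
  exact: (measurableT_comp mj (measurableT_comp mg mf)).
by apply/seteqP; split => z /=; [move=> ->|move/(can_inj jK)].
Qed.

Lemma measurable_fixed_real (R : realType) d (Y : measurableType d) (f : R -> Y) (g : Y -> R) :
  measurable_fun setT f -> measurable_fun setT g -> measurable [set u | g (f u) = u].
Proof.
move=> mf mg; have mgf : measurable_fun setT (g \o f) := measurableT_comp mg mf.
have := measurable_fun_eqr mgf (@measurable_id _ _ setT) measurableT (Y := [set true]) Logic.I.
by rewrite setTI; congr measurable; apply/seteqP; split => z /= /eqP.
Qed.

Section almost_isomorphism.
Context (R : realType) d (Y : measurableType d) (nu : probability Y R).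
Local Notation RR := (g_sigma_algebraType (R.-ocitv.-measurable)).
Local Notation U01 := (uniform_prob (@ltr01 R) : probability _ R).
Hypothesis Yr : cube_retract Y.
Hypothesis nu_nonatomic : forall y, nu [set y] = 0%E.

Lemma uniform_full : U01 [set u | 0 <= u < 1] = 1%E.
Proof.
have mI := @measurable_itv_co R 0 1.
rewrite -[LHS]fineK ?fin_num_measure//; congr EFin.
by rewrite [LHS](uniform_itv (lexx 0) ler01 (lexx 1)) subr0.
Qed.

(** The law of the space, seen on the Cantor space through the retract, is the
    image of the uniform law under the map of [tree_law], whose left inverse
    exists because the law has no atoms. *)
Lemma uniform_isomorphism : exists (alpha : R -> Y) (beta : Y -> R),
  [/\ measurable_fun setT alpha, measurable_fun setT beta,
      forall A, measurable A -> U01 (alpha @^-1` A) = nu A,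
      U01 [set u | beta (alpha u) = u] = 1%E &
      nu [set y | alpha (beta y) = y] = 1%E].
Proof.
have [j [r [mj mr jK]]] := Yr.
have [lam lamE] := image_probability nu mj.
have lam0 c : lam [set c] = 0%E.
  rewrite lamE; have [[y jy]|nc] := pselect (exists y, j y = c).
    rewrite (_ : _ @^-1` _ = [set y])//; apply/seteqP; split => z /=.
      by rewrite -jy => /(can_inj jK).
    by move=> ->.
  rewrite (_ : _ @^-1` _ = set0) ?measure0//; apply/seteqP; split => // z /= jz.
  by apply: nc; exists z.
have [W [mW lawW /(_ lam0)[h [mh hW]]]] := tree_law lam.
have malpha : measurable_fun setT (r \o W) by exact: measurableT_comp.
have mbeta : measurable_fun setT (h \o j) by exact: measurableT_comp.
pose E := [set c : cube nat | j (r c) = c].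
have mE : measurable E.
  apply: measurable_eq_cube; last exact: measurable_id.
  exact: measurableT_comp.
have lamEE : lam E = 1%E.
  rewrite lamE (_ : _ @^-1` _ = setT) ?probability_setT//; apply/seteqP; split => // y _.
  by rewrite /E/= jK.
have lawalpha A : measurable A -> U01 ((r \o W) @^-1` A) = nu A.
  move=> mA; rewrite comp_preimage lawW; last exact: measurable_preimage.
  rewrite lamE; congr (nu _); apply/seteqP; split => y /=; rewrite jK//.
have mV : measurable [set u | (h \o j) ((r \o W) u) = u] by exact: measurable_fixed_real malpha mbeta.
have UV : U01 [set u | (h \o j) ((r \o W) u) = u] = 1%E.
  have mWE := measurable_preimage mW mE.
  apply: (@full_sub R _ RR U01 ([set u | 0 <= u < 1] `&` W @^-1` E)) => //.
  - by apply: measurableI => //; exact: measurable_itv_co.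
  - by move=> u [/= u01 WE]; rewrite WE hW.
  - apply: (@full_setI R _ RR U01) => //; [exact: measurable_itv_co|exact: uniform_full|].
    by rewrite lawW.
exists (r \o W), (h \o j); split => //.
have mY1 : measurable [set y | (r \o W) ((h \o j) y) = y] by exact: measurable_fixed_retract.
rewrite -lawalpha//; apply: (@full_sub R _ RR U01 _ _ mV) => //.
  exact: measurable_preimage.
by move=> u /= ->.
Qed.

Lemma inverse_law (alpha : R -> Y) (beta : Y -> R) :
  measurable_fun setT alpha -> measurable_fun setT beta ->
  (forall A, measurable A -> U01 (alpha @^-1` A) = nu A) ->
  U01 [set u | beta (alpha u) = u] = 1%E ->
  forall B, measurable B -> nu (beta @^-1` B) = U01 B.
Proof.
move=> ma mb lawa V1 B mB.
have mV : measurable [set u | beta (alpha u) = u] by exact: measurable_fixed_real ma mb.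
rewrite -lawa; last exact: measurable_preimage.
apply: (@full_agree R _ RR U01 _ _ _ mV) => //.
  by apply: measurable_preimage => //; exact: measurable_preimage.
by move=> u /= ->.
Qed.

End almost_isomorphism.

(** A set of full measure contains a measurable copy of the Cantor space: it
    contains a compact set [K] of positive measure, and the quantile function of
    the restriction to [K] embeds an interval into [K]. *)
Section cantor_in_full_set.
Context (R : realType).
Local Notation RR := (g_sigma_algebraType (R.-ocitv.-measurable)).
Local Notation U01 := (uniform_prob (@ltr01 R) : probability _ R).

Lemma uniform_le_lebesgue (A : set R) : measurable A ->
  (U01 A <= lebesgue_measure A)%E.
Proof.
move=> mA; rewrite [leLHS](_ : _ = \int[lebesgue_measure]_(x in A) (uniform_pdf 0 1 x)%:E)%E//.
rewrite -[leRHS]mul1e -integral_cst//; apply: ge0_le_integral => //=.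
- by move=> x _; rewrite lee_fin uniform_pdf_ge0.
- by apply/measurable_EFinP/measurable_funTS; exact: measurable_uniform_pdf.
- by move=> x _; rewrite lee_fin /uniform_pdf; case: ifP => // _; rewrite subr0 invr1.
Qed.

(** The measure of [K] stays above 1/2, so that the quantile function is used for
    levels up to 1/2 only. *)
Lemma compact_in_full_set (V : set R) : measurable V -> U01 V = 1%E ->
  exists K, [/\ closed K, K `<=` V, K `<=` [set u | 0 <= u < 1 \/ u = 1] & 2^-1 < fine (U01 K)].
Proof.
move=> mV V1; pose D := V `&` `[0, 1]%classic.
have mD : measurable D by exact: measurableI.
have U1 : U01 D = 1%E.
  apply: (@full_sub R _ RR U01 (V `&` [set u | 0 <= u < 1])) => //.
  - by apply: measurableI => //; exact: measurable_itv_co.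
  - by move=> u [Vu /= /andP[u0 u1]]; split=> //=; rewrite in_itv/= u0 ltW.
  - by apply: (@full_setI R _ RR U01) => //; [exact: measurable_itv_co|exact: uniform_full].
have Doo : (lebesgue_measure D < +oo)%E.
  apply: (@le_lt_trans _ _ (lebesgue_measure (`[0, 1]%classic : set R))).
    by apply: le_measure; rewrite ?inE//; move=> u [].
  by rewrite lebesgue_measure_itv/= lte_fin ltr01 ltry.
have e0 : 0 < 2^-1 :> R by rewrite invr_gt0.
have [K [cK KD DK]] := lebesgue_regularity_inner mD Doo e0.
have clK : closed K by exact: compact_closed.
have mK : measurable K by exact: closed_measurable.
exists K; split => //.
- by move=> u /KD[].
- move=> u /KD[_] /=; rewrite in_itv/= => /andP[u0]; rewrite le_eqVlt u0.
  by move=> /orP[/eqP|]; [right|left].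
- have mDK : measurable (D `\` K) by exact: measurableD.
  have UDK : fine (U01 (D `\` K)) < 2^-1.
    rewrite -lte_fin fineK ?fin_num_measure//.
    exact: le_lt_trans (uniform_le_lebesgue mDK) DK.
  have DKE : (D `\` K) `|` K = D by rewrite setUC setDUK.
  have DKI : (D `\` K) `&` K = set0 by rewrite setDE -setIA setICl setI0.
  have := @pr_setU R _ RR U01 _ _ mDK mK DKI; rewrite DKE U1/=.
  by move: UDK; lra.
Qed.

Section quantile.
Variable K : set R.
Hypotheses (clK : closed K) (K01 : K `<=` [set u | 0 <= u < 1 \/ u = 1]).
Hypothesis UK : 2^-1 < fine (U01 K).

Let mK : measurable K. Proof. exact: closed_measurable. Qed.

Let mlt (x : R) : measurable [set u | u < x].
Proof. by rewrite (_ : mkset _ = `]-oo, x[%classic). Qed.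

(** The distribution function of [K]; its quantile function is [q] below. *)
Let F x : R := fine (U01 (K `&` [set u | u < x])).

Let mKx x : measurable (K `&` [set u | u < x]).
Proof. exact: measurableI mK (mlt x). Qed.

Let F_homo : {homo F : x y / x <= y}.
Proof. by move=> x y xy; apply: (@pr_le R _ RR U01 _ _ (mKx x) (mKx y)) => u [Ku /= ux]; split=> //=; exact: lt_le_trans xy. Qed.

Let F_lip x y : 0 <= x -> x <= y -> y <= 1 -> F y <= F x + (y - x).
Proof.
move=> x0 xy y1; rewrite -(uniform_itv x0 xy y1).
apply: le_trans (pr_setU_le U01 (mKx x) (measurable_itv_co x y)).
have mU := measurableU _ _ (mKx x) (measurable_itv_co x y).
apply: (@pr_le R _ RR U01 _ _ (mKx y) mU) => u [Ku /= uy]; have [ux|xu] := ltP u x; first by left.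
by right; apply/andP.
Qed.

Let F0 : F 0 = 0.
Proof.
rewrite /F (_ : _ `&` _ = set0) ?measure0//; apply/seteqP; split => // u [/K01 /= [/andP[u0 _]|->] u1].
  by move: u1; rewrite ltNge u0.
by move: u1; rewrite ltNge ler01.
Qed.

Let F1 : 2^-1 <= F 1.
Proof.
suff KE : U01 K = U01 (K `&` [set u | u < 1]) by rewrite /F -[X in fine X]KE ltW.
apply: (@full_agree R _ RR U01 [set u | 0 <= u < 1]) => //.
- exact: measurable_itv_co.
- exact: mKx.
- exact: uniform_full.
- by move=> u /andP[u0 u1]; split => [|[]].
Qed.

Let S t := [set x | 0 <= x <= 1 /\ Num.min t 2^-1 <= F x].

Let S1 t : S t 1.
Proof. by split; [rewrite ler01 lexx|rewrite ge_min F1 orbT]. Qed.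

Let hS t : has_inf (S t).
Proof. by split; [exists 1|exists 0 => x [/andP[]]]. Qed.

Let q t := inf (S t).

Let q_homo : {homo q : s t / s <= t}.
Proof.
move=> s t st; apply: lb_le_inf; first by exists 1.
move=> x [x01 tx]; apply: ge_inf; first by case: (hS s).
by split=> //; apply: le_trans tx; rewrite le_min ge_min st ge_min lexx orbT.
Qed.

Let q01 t : 0 <= q t <= 1.
Proof.
apply/andP; split; first by apply: lb_le_inf; [exists 1|move=> x [/andP[]]].
by apply: ge_inf; [case: (hS t)|].
Qed.

Let Fq_ge t : Num.min t 2^-1 <= F (q t).
Proof.
apply/ler_addgt0Pr => eps eps0.
have [x [/andP[x0 x1] tx] xq] := inf_adherent eps0 (hS t).
have qx : q t <= x by apply: ge_inf; [case: (hS t)|split=> //; apply/andP].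
have /andP[q0 q1] := q01 t.
by have := F_lip q0 qx x1; move: tx xq; rewrite -/(q t); lra.
Qed.

Let q_min t x : 0 <= x -> x < q t -> F x < Num.min t 2^-1.
Proof.
move=> x0 xq; rewrite ltNge; apply/negP => tx.
have : q t <= x.
  apply: ge_inf; first by case: (hS t).
  by split=> //; rewrite x0; have /andP[_] := q01 t; apply: le_trans; exact: ltW.
by rewrite leNgt xq.
Qed.

Let q_gt0 t : 0 < t -> 0 < q t.
Proof.
move=> t0; have /andP[q0 _] := q01 t; rewrite lt_neqAle q0 andbT; apply/eqP => q00.
have := Fq_ge t; rewrite -q00 F0 leNgt lt_min t0 invr_gt0 ltr0n//.
Qed.

Let Fq t : 0 < t -> t <= 2^-1 -> F (q t) = t.
Proof.
move=> t0 t1; have tm : Num.min t 2^-1 = t by rewrite min_l.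
apply/eqP; rewrite eq_le; apply/andP; split; last by rewrite -{1}tm Fq_ge.
rewrite leNgt; apply/negP => tF.
have q0 := q_gt0 t0; have /andP[_ q1] := q01 t.
pose x := Num.max 0 (q t - (F (q t) - t)).
have x0 : 0 <= x by rewrite le_max lexx.
have xq : x < q t by rewrite gt_max q0/= gtrBl subr_gt0.
have := q_min x0 xq; rewrite tm; have := F_lip x0 (ltW xq) q1.
have : q t - (F (q t) - t) <= x by rewrite le_max lexx orbT.
lra.
Qed.

(** Just below a quantile the distribution function takes smaller values, so [K]
    accumulates there. *)
Let Kq t : 0 < t -> K (q t).
Proof.
move=> t0; have q0 := q_gt0 t0; have /andP[_ q1] := q01 t.
apply: clK => B /nbhs_ballP[eps /= eps0 epsB]; apply: contrapT => KB.
pose x := Num.max 0 (q t - eps / 2).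
have x0 : 0 <= x by rewrite le_max lexx.
have xq : x < q t by rewrite gt_max q0/= gtrBl divr_gt0.
have := q_min x0 xq; rewrite ltNge => /negP; apply.
apply: le_trans (Fq_ge t) _; apply: (@pr_le R _ RR U01 _ _ (mKx _) (mKx _)) => u [Ku /= uq]; split=> //=.
rewrite ltNge; apply/negP => xu; apply: KB; exists u; split=> //; apply: epsB.
rewrite -ball_normE/= ger0_norm ?subr_ge0 ?(ltW uq)//.
have : q t - eps / 2 <= x by rewrite le_max lexx orbT.
by move: xu eps0; lra.
Qed.

Lemma closed_cantor_embedding : exists (f : cube nat -> R) (g : R -> cube nat),
  [/\ measurable_fun setT f, measurable_fun setT g, cancel f g & forall c, K (f c)].
Proof.
have [f [g [mf mg fK f01]]] := cantor_embedding R.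
(* The levels are in [1/4, 1/2]: positive, so that the quantiles belong to [K],
   and at most the mass of [K]. *)
pose t c := (1 + f c) / 4.
have t_itv c : 0 < t c <= 2^-1.
  by have /andP[? ?] := f01 c; rewrite /t; apply/andP; split; lra.
have mq : measurable_fun setT q by apply: nondecreasing_measurable => //; exact: q_homo.
have mF : measurable_fun setT F by apply: nondecreasing_measurable => //; exact: F_homo.
have mt : measurable_fun setT t.
  by apply: measurable_funM => //; exact: measurable_funD.
exists (q \o t), (fun x => g (4 * F x - 1)); split.
- exact: measurableT_comp.
- apply: (measurableT_comp mg); apply: measurable_funB => //.
  exact: measurable_funM.
- move=> c /=; have /andP[t0 t1] := t_itv c; rewrite Fq// /t.
  by rewrite (_ : 4 * _ - 1 = f c) ?fK//; field.
- by move=> c; apply: Kq; have /andP[] := t_itv c.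
Qed.

End quantile.

End cantor_in_full_set.

(** * The isomorphism theorem for standard nonatomic spaces *)

Lemma measurable_if_prop d1 d2 (X : measurableType d1) (Y : measurableType d2)
    (A : set X) (f g : X -> Y) : measurable A ->
  measurable_fun setT f -> measurable_fun setT g ->
  measurable_fun setT (fun x => if `[< A x >] then f x else g x).
Proof.
move=> mA mf mg _ B mB; rewrite setTI.
rewrite (_ : _ @^-1` _ = (A `&` f @^-1` B) `|` (~` A `&` g @^-1` B)).
  by apply: measurableU; apply: measurableI => //;
    [exact: measurable_preimage|exact: measurableC|exact: measurable_preimage].
apply/seteqP; split => x /=; case: asboolP => Ax; first by left.
- by right.
- by move=> [[]|[]].
- by move=> [[]|[]].
Qed.

(** Following the lighter of the two halves of each cylinder leads to a null point. *)
Lemma cube_null_point (R : realType) (lam : probability (cube nat) R) :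
  exists c, lam [set c] = 0%E.
Proof.
pose half n (c : cube nat) b : set (cube nat) := [set c' | agree n c' c /\ c' n = b].
have mh n c b : measurable (half n c b).
  apply: (@measurable_prefix n.+1) => c1 c2 /agreeS[h hn] [h1 h1n]; split.
    exact: agree_trans (agree_sym h) h1.
  by rewrite -hn.
pose D n c := fine (lam (half n c true)) <= fine (lam (half n c false)).
have DP n c c' : agree n c c' -> D n c = D n c'.
  move=> h; have hE b : half n c b = half n c' b.
    apply/seteqP; split => c'' [h1 h2]; split => //; apply: agree_trans h1 _ => //.
    exact: agree_sym.
  by rewrite /D !hE.
pose c := branch D; exists c.
have cE n : c n = D n c by exact: branchE.
pose p n := fine (lam [set c' | agree n c' c]).
have p_half n : p n.+1 <= p n / 2.
  have pE : p n = fine (lam (half n c true)) + fine (lam (half n c false)).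
    rewrite -pr_setU//; last first.
      by apply/seteqP; split => // c' [[_ h1] [_]]; rewrite h1.
    congr (fine (lam _)); apply/seteqP; split => c' /=.
      by move=> h; case E : (c' n); [left|right].
    by move=> [[]|[]].
  have -> : p n.+1 = fine (lam (half n c (c n))).
    by congr (fine (lam _)); apply/seteqP; split => c' /= /agreeS.
  rewrite cE pE /D.
  by case: (leP (fine (lam (half n c true))) (fine (lam (half n c false)))); lra.
have p_small n : p n <= 2^-1 ^+ n.
  elim: n => [|n IH]; first by rewrite expr0 pr_le1//; exact: measurable_agree.
  by have := p_half n; rewrite exprS; move: IH; lra.
have mc : measurable [set c].
  rewrite (_ : [set c] = [set c' | c' = c]); last by apply/seteqP; split.
  by apply: measurable_eq_cube; [exact: measurable_id|exact: measurable_cst].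
apply/eqP; rewrite -fine_eq0 ?fin_num_measure// eq_le pr_ge0 andbT.
apply/ler_addgt0Pr => eps eps0; rewrite add0r.
have [m /(_ m (leqnn m)) he] := half_power_small eps0.
apply: le_trans (ltW he); apply: le_trans (p_small m).
by apply: pr_le => //; [exact: measurable_agree|move=> _ ->].
Qed.

Section null_copy.
Context (R : realType) d (Y : measurableType d) (nu : probability Y R).
Hypothesis Yr : cube_retract Y.
Hypothesis nu_nonatomic : forall y, nu [set y] = 0%E.

(** A Cantor space contains uncountably many disjoint copies of itself, one of
    which has to be null. *)
Lemma null_cantor_embedding : exists (f : cube nat -> Y) (g : Y -> cube nat),
  [/\ measurable_fun setT f, measurable_fun setT g, cancel f g &
      nu [set y | f (g y) = y] = 0%E].
Proof.
have [al [be [mal mbe _ V1 _]]] := uniform_isomorphism Yr nu_nonatomic.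
have mV : measurable [set u | be (al u) = u] by exact: measurable_fixed_real mal mbe.
have [K [cK KV K01 UK]] := compact_in_full_set mV V1.
have [f [g [mf mg fK fK']]] := closed_cantor_embedding cK K01 UK.
have mk : measurable_fun setT (al \o f) by exact: measurableT_comp.
have mr : measurable_fun setT (g \o be) by exact: measurableT_comp.
have rk : cancel (al \o f) (g \o be).
  by move=> c /=; have /= -> := KV _ (fK' c).
(* The odd bits index the copies; the even bits are the points of a copy. *)
pose ev (c : cube nat) : cube nat := c \o double.
pose od (c : cube nat) : cube nat := c \o (fun n => n.*2.+1).
have mod' : measurable_fun setT (od \o (g \o be)).
  exact: (measurableT_comp (measurable_shift (fun n => n.*2.+1)) mr).
have [lam lamE] := image_probability nu mod'.
have [t t0] := cube_null_point lam.
pose join (c : cube nat) : cube nat := fun n => if odd n then t n./2 else c n./2.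
have mjoin : measurable_fun setT join.
  apply: measurable_fun_cube => n; rewrite /join; case: (odd n).
    exact: measurable_prop.
  exact: measurable_coord n./2.
have joinev c : ev (join c) = c.
  by apply/funext => n; rewrite /ev /join /= odd_double doubleK.
have joinod c : od (join c) = t.
  by apply/funext => n; rewrite /od /join /= odd_double/= uphalf_double.
have mkj : measurable_fun setT ((al \o f) \o join) by exact: measurableT_comp.
have mev : measurable_fun setT (ev \o (g \o be)).
  exact: (measurableT_comp (measurable_shift double) mr).
exists ((al \o f) \o join), (ev \o (g \o be)); split => //.
  by move=> c; have := rk (join c); rewrite /= => ->; exact: joinev.
have mt : measurable [set t].
  rewrite (_ : [set t] = [set c' | c' = t]); last by apply/seteqP; split.
  by apply: measurable_eq_cube; [exact: measurable_id|exact: measurable_cst].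
apply: (null_sub (B := (od \o (g \o be)) @^-1` [set t])).
- exact: measurable_fixed_retract.
- exact: measurable_preimage.
- move=> y /= yE; rewrite -yE; set c := ev _.
  by have := rk (join c); rewrite /= => ->; exact: joinod.
- by rewrite -lamE.
Qed.

End null_copy.

Section measurable_schroeder_bernstein.
Context (R : realType) d1 d2 (X : measurableType d1) (Y : measurableType d2).
Context (mu : probability X R) (nu : probability Y R).

(** Both spaces are almost isomorphic to the unit interval. *)
Lemma almost_isomorphism : cube_retract X -> cube_retract Y ->
  (forall x, mu [set x] = 0%E) -> (forall y, nu [set y] = 0%E) ->
  exists (f : X -> Y) (g : Y -> X), [/\ measurable_fun setT f, measurable_fun setT g,
    forall B, measurable B -> mu (f @^-1` B) = nu B & mu [set x | g (f x) = x] = 1%E].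
Proof.
move=> Xr Yr muN nuN.
have [aX [bX [maX mbX lawX VX X1]]] := uniform_isomorphism Xr muN.
have [aY [bY [maY mbY lawY VY Y1]]] := uniform_isomorphism Yr nuN.
have mVY : measurable [set u | bY (aY u) = u] by exact: measurable_fixed_real maY mbY.
have mX1 : measurable [set x | aX (bX x) = x] by exact: measurable_fixed_retract.
have lawbX := inverse_law maX mbX lawX VX.
have mf : measurable_fun setT (aY \o bX) by exact: measurableT_comp.
have mg : measurable_fun setT (aX \o bY) by exact: measurableT_comp.
exists (aY \o bX), (aX \o bY); split => //.
  move=> B mB; rewrite comp_preimage lawbX; first exact: lawY.
  exact: measurable_preimage.
have mW := measurable_preimage mbX mVY.
apply: (@full_sub _ _ _ _ (bX @^-1` [set u | bY (aY u) = u] `&` [set x | aX (bX x) = x])).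
- exact: measurableI.
- exact: measurable_fixed_retract.
- by move=> x [/= -> ->].
- by apply: full_setI => //; rewrite lawbX.
Qed.

(** An almost isomorphism becomes injective everywhere when the null set of bad
    points is sent into a null copy of the Cantor space, whose preimage is bad
    as well. *)
Lemma measure_preserving_embedding : cube_retract X -> cube_retract Y ->
  (forall x, mu [set x] = 0%E) -> (forall y, nu [set y] = 0%E) ->
  exists (f : X -> Y) (g : Y -> X), [/\ measurable_fun setT f, measurable_fun setT g,
    forall B, measurable B -> mu (f @^-1` B) = nu B & cancel f g].
Proof.
move=> Xr Yr muN nuN.
have [f0 [g0 [mf0 mg0 law0 X1]]] := almost_isomorphism Xr Yr muN nuN.
have [k [rh [mk mrh rhk E0]]] := null_cantor_embedding Yr nuN.
have [j [r [mj mr jK]]] := Xr.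
pose E := [set y | k (rh y) = y].
have mE : measurable E by exact: measurable_fixed_retract.
have mX1 : measurable [set x | g0 (f0 x) = x] by exact: measurable_fixed_retract.
pose A := [set x | g0 (f0 x) = x] `&` ~` (f0 @^-1` E).
have mfE : measurable (f0 @^-1` E) by exact: measurable_preimage.
have mA : measurable A by apply: measurableI => //; exact: measurableC.
have A1 : mu A = 1%E.
  apply: full_setI => //; first exact: measurableC.
  by apply/full_setC; [exact: measurableC|rewrite setCK law0].
have mf : measurable_fun setT (fun x => if `[< A x >] then f0 x else k (j x)).
  by apply: measurable_if_prop => //; exact: (measurableT_comp mk mj).
exists (fun x => if `[< A x >] then f0 x else k (j x)),
  (fun y => if `[< E y >] then r (rh y) else g0 y); split => //.
- by apply: measurable_if_prop => //; exact: (measurableT_comp mr mrh).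
- move=> B mB; rewrite -law0//; apply: (full_agree mA) => //.
  + exact: measurable_preimage.
  + exact: measurable_preimage.
  + by move=> x Ax /=; case: asboolP.
- move=> x; case: (asboolP (A x)) => [[/= gf nE]|_]; first by case: asboolP.
  by case: asboolP => [_|[]]; rewrite ?rhk ?jK// /E/= rhk.
Qed.

End measurable_schroeder_bernstein.

(** The isomorphism theorem for standard nonatomic probability spaces, with a map
    that is bijective everywhere: measure-preserving embeddings in both directions
    are combined as in the theorem of Schroeder and Bernstein; the set on which
    the two differ is null. *)
Lemma standard_isomorphism (R : realType) d1 d2 (X : measurableType d1)
    (Y : measurableType d2) (mu : probability X R) (nu : probability Y R) :
  cube_retract X -> cube_retract Y ->
  (forall x, mu [set x] = 0%E) -> (forall y, nu [set y] = 0%E) ->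
  exists phi : X -> Y,
    [/\ bijective phi, measurable_fun setT phi,
        forall A, measurable A -> measurable (phi @` A) &
        forall B, measurable B -> mu (phi @^-1` B) = nu B].
Proof.
move=> Xr Yr muN nuN.
have [f [f' [mf mf' lawf fK]]] := measure_preserving_embedding Xr Yr muN nuN.
have [g [g' [mg mg' lawg gK]]] := measure_preserving_embedding Yr Xr nuN muN.
(* [step B] is the image of [B] under [g \o f]. The set [A] below is the smallest
   one which contains the complement of the range of [g] and is mapped to itself
   by [g \o f]: [f] is used on [A] and the inverse of [g] off [A]. *)
pose step (B : set X) := [set x | g (g' x) = x] `&`
  (g' @^-1` ([set y | f (f' y) = y] `&` f' @^-1` B)).
pose A0 := ~` [set x | g (g' x) = x].
have mgg : measurable [set x | g (g' x) = x] by exact: measurable_fixed_retract.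
have mff : measurable [set y | f (f' y) = y] by exact: measurable_fixed_retract.
have mstep B : measurable B -> measurable (step B).
  move=> mB; apply: measurableI => //; apply: measurable_preimage => //.
  by apply: measurableI => //; exact: measurable_preimage.
have step0 B : measurable B -> mu B = 0%E -> mu (step B) = 0%E.
  move=> mB B0; rewrite -lawg; last exact: mstep.
  rewrite (_ : _ @^-1` _ = [set y | f (f' y) = y] `&` f' @^-1` B); last first.
    apply/seteqP; split => y /=; first by move=> [_ [/=]]; rewrite gK.
    by move=> [fy By]; split; rewrite /= gK.
  rewrite -lawf; last by apply: measurableI => //; exact: measurable_preimage.
  apply: (null_sub _ _ _ B0) => //.
    apply: measurable_preimage => //.
    by apply: measurableI => //; exact: measurable_preimage.
  by move=> x [_ /=]; rewrite fK.
pose An n := iter n step A0.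
have mAn n : measurable (An n).
  by elim: n => [|n IH]; [exact: measurableC|exact: mstep].
have An0 n : mu (An n) = 0%E.
  elim: n => [|n IH]; last exact: step0.
  rewrite -[An 0%N]setCK; apply/full_setC; first by apply: measurableC.
  rewrite /= setCK -lawg// (_ : _ @^-1` _ = setT) ?probability_setT//.
  by apply/seteqP; split => // y _ /=; rewrite gK.
pose A := \bigcup_n An n.
have mA : measurable A by exact: bigcupT_measurable.
have A_null : mu A = 0%E.
  apply: measure_negligible => //; apply: negligible_bigcup => n.
  by apply/negligibleP; [exact: mAn|exact: An0].
have AS x : g (g' x) = x -> f (f' (g' x)) = g' x -> A (f' (g' x)) -> A x.
  by move=> gx fx [n _ An_]; exists n.+1.
have AN x : ~ A x -> g (g' x) = x.
  by move=> nA; apply: contrapT => h; apply: nA; exists 0%N.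
have AP x : A x -> g (g' x) = x -> f (f' (g' x)) = g' x /\ A (f' (g' x)).
  by move=> [[|n] _]; [move=> /[apply]|move=> [_ [/= fx An_]] _; split=> //; exists n].
pose phi x := if `[< A x >] then f x else g' x.
pose FA := [set y | f (f' y) = y] `&` f' @^-1` A.
pose psi y := if `[< FA y >] then f' y else g y.
have mFA : measurable FA by apply: measurableI => //; exact: measurable_preimage.
have mphi : measurable_fun setT phi by exact: measurable_if_prop.
have mpsi : measurable_fun setT psi by exact: measurable_if_prop.
have phiK : cancel phi psi.
  move=> x; rewrite /phi; case: asboolP => Ax; rewrite /psi; case: asboolP => //.
  - by move=> h; exfalso; apply: h; split; rewrite /= fK.
  - by move=> [/= h1 h2]; exfalso; apply: (Ax); apply: AS => //; exact: AN.
  - by move=> _; exact: AN.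
have psiK : cancel psi phi.
  move=> y; rewrite /psi; case: asboolP => [[/= fy Ay]|nF]; rewrite /phi; case: asboolP => //.
  - by move=> Ag; exfalso; apply: nF; have := AP _ Ag; rewrite gK => /(_ erefl)[].
exists phi; split => //; first by exists psi.
  move=> B mB; rewrite (_ : phi @` B = psi @^-1` B); first exact: measurable_preimage.
  apply/seteqP; split => [_ [x Bx <-]|y By] /=; first by rewrite phiK.
  by exists (psi y).
move=> B mB.
have mB' : measurable (g' @^-1` B) by exact: measurable_preimage.
transitivity (mu (g' @^-1` B)).
  apply: (@full_agree _ _ _ mu (~` A)) => //.
  - exact: measurableC.
  - exact: measurable_preimage.
  - by apply/full_setC; [exact: measurableC|rewrite setCK].
  - by move=> x nA; rewrite /phi /=; case: asboolP.
rewrite -lawg//; congr (nu _); apply/seteqP; split => y /=; rewrite gK//.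
Qed.

(** * Ultralimits of measure-preserving actions *)

Section finitely_dependent_sets.
Context (T : eqType).
Implicit Types S : set (cube T).

(** The clopen sets of the Cantor cube. *)
Definition fin_dep S := exists s : seq T,
  forall z z' : cube T, (forall t, t \in s -> z t = z' t) -> S z -> S z'.

Lemma fin_dep_coord (t : T) : fin_dep [set z | z t].
Proof. by exists [:: t] => z z' /(_ t); rewrite inE eqxx => /(_ isT) /= ->. Qed.

Lemma fin_dep0 : fin_dep set0.
Proof. by exists [::]. Qed.

Lemma fin_depT : fin_dep setT.
Proof. by exists [::]. Qed.

Lemma fin_depC S : fin_dep S -> fin_dep (~` S).
Proof. by move=> [s h]; exists s => z z' zz' nS S'; apply: nS; apply: h S' => t /zz'. Qed.

Lemma fin_depI S S' : fin_dep S -> fin_dep S' -> fin_dep (S `&` S').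
Proof.
move=> [s h] [s' h']; exists (s ++ s') => z z' zz' [Sz S'z]; split.
  by apply: h Sz => t ts; apply: zz'; rewrite mem_cat ts.
by apply: h' S'z => t ts; apply: zz'; rewrite mem_cat ts orbT.
Qed.

Lemma fin_depU S S' : fin_dep S -> fin_dep S' -> fin_dep (S `|` S').
Proof.
move=> fS fS'; rewrite -[S `|` S']setCK setCU.
by apply/fin_depC/fin_depI; exact: fin_depC.
Qed.

Lemma fin_dep_exists (A : nat -> set (cube T)) n : (forall j, (j < n)%N -> fin_dep (A j)) ->
  fin_dep [set z | exists2 j, (j < n)%N & A j z].
Proof.
elim: n => [|n IH] fA.
  by rewrite (_ : mkset _ = set0); [exact: fin_dep0|apply/seteqP; split => // z []].
rewrite (_ : mkset _ = A n `|` [set z | exists2 j, (j < n)%N & A j z]).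
  by apply: fin_depU; [exact: fA|apply: IH => j jn; apply: fA; exact: ltnW].
apply/seteqP; split => z /=.
  by move=> [j]; rewrite ltnS leq_eqVlt => /orP[/eqP->|jn] Aj; [left|right; exists j].
by move=> [An|[j jn Aj]]; [exists n|exists j => //; exact: ltnW].
Qed.

Lemma fin_dep_first_index k (B : 'I_k.+1 -> set (cube T)) i :
  (forall j, fin_dep (B j)) -> fin_dep (fibers (first_index B) i).
Proof.
move=> /choice[s sP]; exists (flatten [seq s j | j : 'I_k.+1]) => z z' zz'.
have BE j : B j z <-> B j z'.
  have h t : t \in s j -> z t = z' t.
    move=> ts; apply: zz'; apply/flatten_mapP; exists j => //.
    by rewrite mem_enum.
  by split; apply: sP => t /h.
rewrite /fibers/= => <-.
have [e|e] := pselect (exists j, B j z).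
  have [h1 h2] := first_index_ex e.
  by apply: first_indexP; [exact/BE|move=> j /h2 nB /BE].
by rewrite !first_index_none// => -[j /BE Bj]; apply: e; exists j.
Qed.

Variables (tau : nat -> T) (idx : T -> nat).
Hypothesis idxK : cancel idx tau.

Lemma fin_dep_prefix S : fin_dep S -> exists n,
  forall c c' : cube nat, agree n c c' -> S (c \o idx) -> S (c' \o idx).
Proof.
move=> [s h]; exists (\max_(t <- s) (idx t).+1) => c c' cc'; apply: h => t ts /=.
by apply: cc'; apply: (leq_bigmax_seq (F := fun t => (idx t).+1)).
Qed.

Lemma measurable_fin_dep S : fin_dep S -> measurable S.
Proof.
move=> /fin_dep_prefix[n h].
pose res (z : cube T) : cube nat := z \o tau.
have mt : measurable_fun setT res.
  by apply: measurable_fun_cube => m; exact: measurable_coord (tau m).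
have mS : measurable [set c : cube nat | S (c \o idx)] by exact: measurable_prefix h.
rewrite (_ : S = res @^-1` [set c : cube nat | S (c \o idx)]).
  exact: measurable_preimage.
have zE (z : cube T) : res z \o idx = z by apply/funext => t; rewrite /res /= idxK.
by apply/seteqP; split => z /=; rewrite zE.
Qed.

Lemma fin_dep_generates : (@measurable _ (cube T)) = <<s fin_dep >>.
Proof.
apply/seteqP; split; last first.
  apply: smallest_sub; first exact: sigma_algebra_measurable.
  exact: measurable_fin_dep.
apply: smallest_sub; first exact: smallest_sigma_algebra.
by move=> _ [t _ <-]; apply: sub_sigma_algebra; exact: fin_dep_coord.
Qed.

(** The clopen sets form a pi-system that generates the sigma-algebra. *)
Lemma fin_dep_measure_unique (R : realType) (P Q : probability (cube T) R) :
  (forall S, fin_dep S -> P S = Q S) ->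
  forall A, measurable A -> P A = Q A.
Proof.
move=> PQ; apply: (measure_unique fin_dep (fun=> setT)) => //.
- exact: fin_dep_generates.
- exact: fin_depI.
- by move=> _; exact: fin_depT.
- by apply/seteqP; split => // z _; exists 0%N.
- by move=> _; rewrite ltey_eq fin_num_measure.
Qed.

(** Measurable sets are approximated by clopen sets: the sets for which this holds
    form a sigma-algebra. *)
Lemma fin_dep_approx (R : realType) (lam : probability (cube T) R) A : measurable A ->
  forall eps, 0 < eps -> exists S N, [/\ fin_dep S, measurable N, fine (lam N) < eps &
    forall z, ~ N z -> (A z <-> S z)].
Proof.
pose appr A := measurable A /\ forall eps : R, 0 < eps -> exists S N,
  [/\ fin_dep S, measurable N, fine (lam N) < eps & forall z, ~ N z -> (A z <-> S z)].
suff : @measurable _ (cube T) `<=` appr by move=> h /h[].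
have fd S : fin_dep S -> appr S.
  move=> fS; split; first exact: measurable_fin_dep.
  by move=> eps eps0; exists S, set0; rewrite measure0.
rewrite fin_dep_generates; apply: smallest_sub; last exact: fd.
split.
- exact: fd fin_dep0.
- move=> B [mB hB]; rewrite setTD; split; first exact: measurableC.
  move=> eps /hB[S [N [fS mN Ne h]]]; exists (~` S), N; split => //; first exact: fin_depC.
  by move=> z /h[h1 h2]; split=> nB ?; apply: nB; auto.
- move=> F hF; have mF n : measurable (F n) by have [] := hF n.
  split; first exact: bigcupT_measurable.
  move=> eps eps0; have eps20 : 0 < eps / 2 by rewrite divr_gt0.
  pose D n := (\bigcup_k F k) `\` [set z | exists2 j, (j < n)%N & F j z].
  have mU n : measurable [set z | exists2 j, (j < n)%N & F j z].
    rewrite (_ : mkset _ = \bigcup_(j in `I_n) F j); last first.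
      by apply/seteqP; split => z [j]; exists j.
    by apply: bigcup_measurable => j _.
  have mD n : measurable (D n) by apply: measurableD => //; exact: bigcupT_measurable.
  have cvgD : fine (lam (D n)) @[n --> \oo] --> (0 : R).
    apply: (@fine_cvg _ _ _ _ _ 0).
    rewrite (_ : 0%:E = lam (\bigcap_n D n)).
      apply: nonincreasing_cvg_mu => //.
      - by rewrite ltey_eq fin_num_measure.
      - exact: bigcapT_measurable.
      - move=> m n mn; apply/subsetPset => z [Fz nz]; split => // -[j jm Fj].
        by apply: nz; exists j => //; exact: leq_trans mn.
    rewrite (_ : \bigcap_n D n = set0) ?measure0//; apply/seteqP; split => // z h.
    have [[k _ Fk] _] := h 0%N Logic.I.
    by have [_] := h k.+1 Logic.I; apply; exists k.
  have /cvgrPdist_lt/(_ _ eps20)[n _ /(_ n (leqnn n))] := cvgD.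
  rewrite sub0r normrN ger0_norm ?pr_ge0// => Dn.
  have epsn0 : 0 < eps / 2 / n.+1%:R by rewrite divr_gt0.
  have /choice[S /choice[N SN]] j : exists S N, [/\ fin_dep S, measurable N,
      fine (lam N) < eps / 2 / n.+1%:R & forall z, ~ N z -> (F j z <-> S z)].
    by have [_ h] := hF j; have [S [N ?]] := h _ epsn0; exists S, N.
  pose NN := [set z | exists j : 'I_n, N j z].
  have mN j : measurable (N j) by have [] := SN j.
  have mNN : measurable NN by apply: measurable_exists => j.
  exists [set z | exists2 j, (j < n)%N & S j z], (D n `|` NN); split.
  + by apply: fin_dep_exists => j _; have [] := SN j.
  + exact: measurableU.
  + apply: le_lt_trans (pr_setU_le lam (mD n) mNN) _.
    have : fine (lam NN) <= eps / 2.
      apply: le_trans (pr_exists_le lam (fun j : 'I_n => mN j)) _.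
      apply: (@le_trans _ _ (\sum_(j < n) (eps / 2 / n.+1%:R))).
        by apply: ler_sum => j _; have [_ _ h _] := SN j; exact: ltW.
      rewrite sumr_const card_ord -[leLHS]mulr_natr mulrAC.
      by rewrite ler_pdivrMr// ler_pM2l// ler_nat.
    by move: Dn; lra.
  + move=> z /not_orP[nD nN].
    have FS j : (j < n)%N -> F j z <-> S j z.
      move=> jn; have [_ _ _] := SN j; apply => Nj; apply: nN.
      by exists (Ordinal jn).
    split=> [Fz|[j jn /(FS _ jn) Fj]]; last by exists j.
    have [j jn Fj] : exists2 j, (j < n)%N & F j z.
      by apply: contrapT => h; apply: nD; split.
    by exists j => //; exact/FS.
Qed.

End finitely_dependent_sets.

Section ultralimit_rules.
Context (R : realType) (I : Type) (U : set_system I).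
Hypothesis UU : UltraFilter U.

Lemma ulimD (f g : I -> R) A B : (forall i, `|f i| <= A) -> (forall i, `|g i| <= B) ->
  ulim U (fun i => f i + g i) = ulim U f + ulim U g.
Proof.
move=> fA gB; apply: ulim_unique => // eps eps0.
have eps20 : 0 < eps / 2 by rewrite divr_gt0.
apply: filterS (filterI (ulimP UU fA eps20) (ulimP UU gB eps20)) => i /= [h1 h2].
rewrite (_ : f i + g i - _ = (f i - ulim U f) + (g i - ulim U g)); last by ring.
by apply: le_lt_trans (ler_normD _ _) _; lra.
Qed.

Lemma ulim_cst (r : R) : ulim U (fun=> r) = r.
Proof.
by apply: ulim_unique => // eps eps0; apply: filterS filterT => i _ /=; rewrite subrr normr0.
Qed.

Lemma ulim_ge0 (f : I -> R) B : (forall i, `|f i| <= B) -> (forall i, 0 <= f i) ->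
  0 <= ulim U f.
Proof.
move=> fB f0; apply/ler_addgt0Pr => eps eps0.
have [i /=] := filter_ex (ulimP UU fB eps0).
by rewrite ltr_norml => /andP[]; have := f0 i; lra.
Qed.

End ultralimit_rules.

(** The ultralimit of the laws of random points of a Cantor cube; it is countably
    additive because it is realized on the unit interval. *)
Lemma ultralimit_law (R : realType) (I : Type) (U : set_system I) (T : eqType)
    (tau : nat -> T) (idx : T -> nat) d (X : measurableType d) (mu : probability X R)
    (pi : I -> X -> cube T) :
  UltraFilter U -> cancel idx tau -> (forall i, measurable_fun setT (pi i)) ->
  exists lam : probability (cube T) R, forall S, fin_dep S ->
    fine (lam S) = ulim U (fun i => fine (mu (pi i @^-1` S))).
Proof.
move=> UU idxK mpi.
pose bits i (x : X) : cube nat := pi i x \o tau.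
have mbits i : measurable_fun setT (bits i).
  by apply: measurable_fun_cube => n; exact: (measurable_cube_coord (tau n) (mpi i)).
pose Q (S : set (cube nat)) :=
  ulim U (fun i => fine (mu (bits i @^-1` S))).
have Qb (S : set (cube nat)) : measurable S ->
    forall i, `|fine (mu (bits i @^-1` S))| <= 1.
  by move=> mS i; rewrite ger0_norm ?pr_ge0// pr_le1//; exact: measurable_preimage.
have addQ S S' : measurable S -> measurable S' -> S `&` S' = set0 ->
    Q (S `|` S') = Q S + Q S'.
  move=> mS mS' SS'; rewrite -(ulimD UU (Qb _ mS) (Qb _ mS')); congr ulim.
  apply/funext => i; rewrite preimage_setU pr_setU//.
  - exact: measurable_preimage.
  - exact: measurable_preimage.
  - by rewrite -preimage_setI SS' preimage_set0.
pose p n c := Q [set c' | agree n c' c].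
have pP n c c' : agree n c c' -> p n c = p n c'.
  by move=> /cylinder_agree h; rewrite /p h.
have p_ge0 n c : 0 <= p n c.
  by apply: (ulim_ge0 UU (Qb _ (measurable_agree n c))) => i; exact: pr_ge0.
have p0 c : p 0 c = 1.
  rewrite -[RHS](ulim_cst UU); congr ulim; apply/funext => i.
  by rewrite (_ : _ @^-1` _ = setT) ?pr_setT//; apply/seteqP; split.
have p_split n c : p n c = p n.+1 (set_bit n true c) + p n.+1 (set_bit n false c).
  rewrite /p cylinder_split addQ//; last exact: cylinder_disjoint.
  - exact: measurable_agree.
  - exact: measurable_agree.
have [W [mW lawW _]] := tree_masses pP p_ge0 p0 p_split.
have mWi : measurable_fun setT ((fun u => (W u \o idx : cube T)) : R -> cube T).
  by apply: measurable_fun_cube => t; exact: (measurable_cube_coord (idx t) mW).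
have [P PE] := image_probability (uniform_prob (@ltr01 R)) mW.
have [lam lamE] := image_probability (uniform_prob (@ltr01 R)) mWi.
exists lam => S fS; have [n nS] := fin_dep_prefix idx fS.
transitivity (fine (P [set c : cube nat | S (c \o idx)])); first by rewrite lamE PE.
transitivity (Q [set c : cube nat | S (c \o idx)]).
  apply: (@prefix_determined R (fun S => fine (P S)) Q _ addQ _ n) => //.
    by move=> S1 S2 m1 m2 S12; exact: pr_setU.
  by move=> k c; rewrite PE; exact: lawW.
congr ulim; apply/funext => i; congr (fine (mu _)).
apply/seteqP; split => x /=; rewrite (_ : bits i x \o idx = pi i x)//;
  by apply/funext => t; rewrite /bits /= idxK.
Qed.

(** The ultralimit of actions, observed through countably many sets: the cube is
    indexed by the sets and the group, and the group acts by shifts. *)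
Section ultralimit_action.
Context (R : realType) (G : groupType) (I : Type) (U : set_system I).
Hypothesis UU : UltraFilter U.
Context d (X : measurableType d) (mu : probability X R) (a : I -> mpaction G mu).
Context (K : choiceType) (f : K -> I -> X -> bool).
Hypothesis mf : forall k i, measurable [set x | f k i x].
Variables (tau : nat -> K * G) (idx : K * G -> nat).
Hypothesis idxK : cancel idx tau.

(** A point is coded by the answers to the observations [f k] along its orbit. The
    code is equivariant for the shift, and this makes the shift preserve the
    ultralimit of the laws of the codes. *)
Definition orbit_code i (x : X) : cube (K * G)%type :=
  fun t => f t.1 i (a i t.2^-1%g x).

Lemma measurable_orbit_code i : measurable_fun setT (orbit_code i).
Proof.
apply: measurable_fun_cube => -[k h].
exact: (measurable_preimage (act_measurable (a i) h^-1%g) (mf k i)).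
Qed.

Definition shift_map g (z : cube (K * G)%type) : cube (K * G)%type :=
  fun t => z (t.1, (g^-1 * t.2)%g).

Lemma orbit_code_shift i g x : orbit_code i (a i g x) = shift_map g (orbit_code i x).
Proof.
by apply/funext => -[k h]; rewrite /orbit_code /shift_map /= -actM invgM invgK.
Qed.

Lemma measurable_shift_map g : measurable_fun setT (shift_map g).
Proof.
by apply: measurable_fun_cube => -[k h]; exact: (measurable_coord (k, (g^-1 * h)%g)).
Qed.

Lemma fin_dep_shift g S : fin_dep S -> fin_dep (shift_map g @^-1` S).
Proof.
move=> [s h]; exists [seq (t.1, (g^-1 * t.2)%g) | t <- s] => z z' zz'.
by apply: h => t ts; apply: zz'; apply/mapP; exists t.
Qed.

Lemma ultralimit_action : exists (lam : probability (cube (K * G)%type) R)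
    (b : mpaction G lam), (forall g z, b g z = shift_map g z) /\
  forall S, fin_dep S ->
    fine (lam S) = ulim U (fun i => fine (mu (orbit_code i @^-1` S))).
Proof.
have [lam lamE] := ultralimit_law mu UU idxK measurable_orbit_code.
have s1 z : shift_map 1%g z = z.
  by apply/funext => -[k h]; rewrite /shift_map /= invg1 mul1g.
have sM g h z : shift_map (g * h)%g z = shift_map g (shift_map h z).
  by apply/funext => -[k l]; rewrite /shift_map /= invgM mulgA.
have mS (S : set (cube (K * G)%type)) : fin_dep S -> measurable S.
  exact: (measurable_fin_dep idxK).
have spres g A : measurable A -> lam (shift_map g @^-1` A) = lam A.
  have [P PE] := image_probability lam (measurable_shift_map g).
  rewrite -PE; apply: (fin_dep_measure_unique idxK) => S fS; rewrite PE.
  have mS1 := mS _ fS; have mS2 := mS _ (fin_dep_shift g fS).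
  rewrite -[LHS]fineK ?fin_num_measure// -[RHS]fineK ?fin_num_measure//; congr EFin.
  rewrite !lamE//; last exact: fin_dep_shift.
  congr ulim; apply/funext => i; congr fine.
  rewrite -[RHS](act_preserving (a i) g); last first.
    exact: (measurable_preimage (measurable_orbit_code i) mS1).
  by congr (mu _); apply/seteqP; split => x /=; rewrite orbit_code_shift.
by exists lam, (MPAction s1 sM measurable_shift_map spres).
Qed.

End ultralimit_action.

(** * Limits of actions on a standard nonatomic space *)

Lemma transport_action (R : realType) (G : groupType) d1 d2 (X : measurableType d1)
    (Y : measurableType d2) (mu : probability X R) (nu : probability Y R)
    (b : mpaction G nu) (phi : X -> Y) :
  bijective phi -> measurable_fun setT phi ->
  (forall A, measurable A -> measurable (phi @` A)) ->
  (forall B, measurable B -> mu (phi @^-1` B) = nu B) ->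
  exists a : mpaction G mu, isomorphic_actions a b.
Proof.
move=> [psi phiK psiK] mphi mphi' phimu.
have psiE (A : set X) : psi @^-1` A = phi @` A.
  apply/seteqP; split => [y Ay|_ [x Ax <-]] /=; last by rewrite phiK.
  by exists (psi y).
have mpsi : measurable_fun setT psi by move=> _ A mA; rewrite setTI psiE; exact: mphi'.
pose act' g x := psi (b g (phi x)).
have a1 x : act' 1%g x = x by rewrite /act' act1 phiK.
have aM g h x : act' (g * h)%g x = act' g (act' h x) by rewrite /act' actM psiK.
have mact g : measurable_fun setT (act' g).
  exact: (measurableT_comp mpsi (measurableT_comp (act_measurable b g) mphi)).
have pact g A : measurable A -> mu (act' g @^-1` A) = mu A.
  move=> mA; have mB := measurable_preimage mpsi mA.
  transitivity (mu (phi @^-1` (b g @^-1` (psi @^-1` A)))); first by [].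
  rewrite phimu; last exact: (measurable_preimage (act_measurable b g) mB).
  rewrite act_preserving// -phimu//; congr (mu _).
  by apply/seteqP; split => x /=; rewrite phiK.
exists (MPAction a1 aM mact pact), phi; split => //; first by exists psi.
by move=> g x; rewrite /= /act' psiK.
Qed.

(** Pull back the partition of the unit interval into intervals of equal length. *)
Lemma fine_partition (R : realType) d (X : measurableType d) (mu : probability X R) :
  cube_retract X -> (forall x, mu [set x] = 0%E) ->
  forall N, exists f : X -> 'I_N.+1, forall j, measurable (f @^-1` [set j]) /\
    fine (mu (f @^-1` [set j])) = N.+1%:R^-1.
Proof.
move=> Xr muN N.
have [al [be [mal mbe law V1 _]]] := uniform_isomorphism Xr muN.
have w0 (i : 'I_N.+1) : 0 <= N.+1%:R^-1 :> R by rewrite invr_ge0.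
have w1 : \sum_(i < N.+1) N.+1%:R^-1 = 1 :> R.
  by rewrite sumr_const card_ord -[LHS]mulr_natr mulVf// pnatr_eq0.
have [J JP] := uniform_selector (Weights w0 w1).
exists (J \o be) => j; have [mJ UJ] := JP j.
split; first exact: (measurable_preimage mbe mJ).
by rewrite comp_preimage (inverse_law mal mbe law V1 mJ).
Qed.

Section limit_action.
Context (R : realType) (G : groupType) (e : nat -> G).
Hypothesis e_onto : range e = [set: G].
Context (I : Type) (U : set_system I).
Hypothesis UU : UltraFilter U.
Context d (X : measurableType d) (mu : probability X R).
Hypothesis Xr : cube_retract X.
Hypothesis muN : forall x, mu [set x] = 0%E.
Variable a : I -> mpaction G mu.

Let task := ({n : nat & {k : nat & 'M[int]_(n, k.+1 * k.+1)}} + nat)%type.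

Let int_mx n k (C : 'M[int]_(n, k)) : 'M[R]_(n, k) := map_mx intr C.

(** Countably many observations have to suffice, so the functionals are integral;
    their rational multiples are dense. For each one a nearly optimal partition is
    observed, so that its support function does not drop in the limit. Fine
    partitions of the space make the limit nonatomic. *)
Let observes (t : task) (i : I) (L : X -> nat) : Prop :=
  match t with
  | inl (existT n (existT k C)) => exists f : X -> 'I_k.+1,
      [/\ forall j, measurable (fibers f j), L = val \o f &
          support e (a i) n k (int_mx C) - 1 < pairing (int_mx C) (profile e (a i) n (fibers f))]
  | inr N => exists f : X -> 'I_N.+1,
      [/\ forall j, measurable (fibers f j), L = val \o f &
          forall j, fine (mu (fibers f j)) = N.+1%:R^-1]
  end.

Let observes_ex (ti : task * I) : exists L, observes ti.1 ti.2 L.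
Proof.
case: ti => -[[n [k C]]|N] i /=.
  have [A pA hA] := support_adherent e (a i) (int_mx C) ltr01.
  have [f Af] := partition_fibers pA; have [mA _ _] := pA.
  by exists (val \o f), f; split => //; rewrite -Af.
have [f fP] := fine_partition Xr muN N.
by exists (val \o f), f; split => // j; have [] := fP j.
Qed.

Let label (t : task) (i : I) : X -> nat := projT1 (cid (observes_ex (t, i))).

Let labelP t i : observes t i (label t i).
Proof. exact: (projT2 (cid (observes_ex (t, i)))). Qed.

Let measurable_val k (f : X -> 'I_k.+1) q : (forall j, measurable (fibers f j)) ->
  measurable [set x | val (f x) = q].
Proof.
move=> mf; have [qk|qk] := ltnP q k.+1.
  rewrite (_ : mkset _ = fibers f (Ordinal qk))//.
  by apply/seteqP; split => x /=; [move=> h; exact/val_inj|move=> ->].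
rewrite (_ : mkset _ = set0)//; apply/seteqP; split => // x /= h.
have : (q < k.+1)%N by rewrite -h; exact: ltn_ord.
by rewrite ltnNge qk.
Qed.

Let bit (kq : task * nat) i x := label kq.1 i x == kq.2.

Let measurable_bit kq i : measurable [set x | bit kq i x].
Proof.
case: kq => t q; rewrite (_ : mkset _ = [set x | label t i x = q]); last first.
  by apply/seteqP; split => x /eqP.
have := labelP t i; case: t => [[n [k C]]|N] /= [f [mf -> _]]; exact: measurable_val.
Qed.

Let T := ((task * nat) * G)%type.

Let enum_ex : exists (tau : nat -> T) (idx : T -> nat), cancel idx tau.
Proof.
have /choice[j jP] g : exists p, e p = g.
  by have : [set: G] g by []; rewrite -e_onto => -[p _ <-]; exists p.
pose idx (t : T) : nat := pickle (t.1, j t.2).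
pose tau n : T := if unpickle n is Some (k, p) then (k, e p) else ((inr 0%N, 0%N), 1%g).
by exists tau, idx => -[k g]; rewrite /tau /idx pickleK /= jP.
Qed.

Let tau := projT1 (cid enum_ex).
Let idx := projT1 (cid (projT2 (cid enum_ex))).
Let idxK : cancel idx tau.
Proof. exact: (projT2 (cid (projT2 (cid enum_ex)))). Qed.

Let code i := orbit_code a bit i.

Section limit_on_cube.
Variables (lam : probability (cube T) R) (b : mpaction G lam).
Hypothesis bE : forall g z, b g z = shift_map g z.
Hypothesis lamE : forall S, fin_dep S ->
  fine (lam S) = ulim U (fun i => fine (mu (code i @^-1` S))).

Let mcode i : measurable_fun setT (code i).
Proof. exact: measurable_orbit_code measurable_bit i. Qed.

Let mfin (S : set (cube T)) : fin_dep S -> measurable S.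
Proof. exact: (measurable_fin_dep idxK). Qed.

Let fin_dep_corr g (S S' : set (cube T)) : fin_dep S -> fin_dep S' ->
  fin_dep (b g @` S `&` S').
Proof.
move=> fS fS'; rewrite act_image; apply: fin_depI => //.
rewrite (_ : _ @^-1` _ = shift_map g^-1%g @^-1` S); first exact: fin_dep_shift.
by apply/seteqP; split => z /=; rewrite bE.
Qed.

(** The correlations of clopen sets in the limit are ultralimits by construction. *)
Let corr_limit g (S S' : set (cube T)) : fin_dep S -> fin_dep S' ->
  corr b g S S' = ulim U (fun i => corr (a i) g (code i @^-1` S) (code i @^-1` S')).
Proof.
move=> fS fS'; rewrite /corr lamE; last exact: fin_dep_corr.
congr ulim; apply/funext => i; congr (fine (mu _)); rewrite !act_image.
by apply/seteqP; split => x /=; rewrite bE /code -orbit_code_shift.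
Qed.

Let profile_limit n k (B : 'I_k -> set (cube T)) eps : (forall j, fin_dep (B j)) ->
  0 < eps -> U [set i | forall p s,
    `|profile e (a i) n (fun j => code i @^-1` B j) p s - profile e b n B p s| < eps].
Proof.
move=> fB eps0; apply: filter_forall => p; apply: filter_forall => s.
rewrite profileE corr_limit//.
have hb i : `|corr (a i) (e p) (code i @^-1` B (row_of s)) (code i @^-1` B (col_of s))| <= 1.
  have mB j : measurable (code i @^-1` B j) by apply: (measurable_preimage (mcode i)); exact: mfin.
  by rewrite ger0_norm ?corr_ge0// corr_le1.
apply: filterS (ulimP UU hb eps0) => i /=.
by rewrite profileE.
Qed.

(** A partition of the limit space is close to a clopen one, and the latter is read
    off on the spaces of the actions. *)
Let limit_partitions n k (A : 'I_k.+1 -> set (cube T)) eps :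
  indexed_partition A -> 0 < eps -> U [set i | exists2 A' : 'I_k.+1 -> set X,
    indexed_partition A' & `|profile e (a i) n A' - profile e b n A| < eps].
Proof.
move=> pA eps0; have [mA _ _] := pA; have [f Af] := partition_fibers pA.
pose eps' := eps / 4 / k.+1%:R.
have eps40 : 0 < eps / 4 by rewrite divr_gt0.
have eps'0 : 0 < eps' by rewrite divr_gt0.
have /choice[S /choice[N SN]] q : exists S N, [/\ fin_dep S, measurable N,
    fine (lam N) < eps' & forall z, ~ N z -> (A q z <-> S z)].
  by have [S [N ?]] := fin_dep_approx idxK lam (mA q) eps'0; exists S, N.
have mN q : measurable (N q) by have [] := SN q.
pose NN := [set z | exists q, N q z].
have mNN : measurable NN by exact: measurable_exists.
have NNe : fine (lam NN) <= eps / 4.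
  apply: le_trans (pr_exists_le lam mN) _.
  apply: (@le_trans _ _ (\sum_(q < k.+1) eps')).
    by apply: ler_sum => q _; have [_ _ h _] := SN q; exact: ltW.
  by rewrite sumr_const card_ord -[leLHS]mulr_natr /eps' mulfVK ?pnatr_eq0.
pose B := fibers (first_index S).
have fS q : fin_dep (S q) by have [] := SN q.
have fB q : fin_dep (B q) by exact: fin_dep_first_index.
have mB q : measurable (B q) by exact: mfin.
have AB q z : ~ NN z -> (A q z <-> B q z).
  move=> nN; have AS j : A j z <-> S j z.
    by have [_ _ _ h] := SN j; apply: h => Nj; apply: nN; exists j.
  have -> : B q z <-> f z = q; last by rewrite Af.
  rewrite /B /fibers/= (@first_indexP _ _ _ S z (f z))//; first by apply/AS; rewrite Af.
  by move=> j jf /AS; rewrite Af /fibers/= => fj; rewrite fj ltnn in jf.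
have h := profile_agree e b (n := n) mA mB mNN AB.
apply: filterS (profile_limit n fB eps40) => i hi.
exists (fun j => code i @^-1` B j).
  rewrite (_ : (fun j => _) = fibers (first_index S \o code i))//.
  apply: fibers_partition => j; exact: (measurable_preimage (mcode i) (mB j)).
apply: norm_lt_entries => // p s; rewrite subr_entry.
rewrite -(subrKA (profile e b n B p s)).
apply: le_lt_trans (ler_normD _ _) _.
by have := hi p s; have := h p s; rewrite [in X in X -> _]distrC; move: NNe; lra.
Qed.

Let limit_support n k (c : 'M[R]_(n, k.+1 * k.+1)) eps : 0 < eps ->
  U [set i | support e (a i) n k c <= support e b n k c + eps].
Proof.
move=> eps0; pose NE : R := (n * (k.+1 * k.+1))%:R.
(* The functional [c] is replaced by an integral one divided by [m], with an error
   of [NE / m] for each of the two support functions. *)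
pose m := (Num.bound ((2 + 2 * NE) / eps)).+1.
have m0 : 0 < m%:R :> R by rewrite ltr0n.
have NE0 : 0 <= NE by rewrite ler0n.
have mP : (2 + 2 * NE) / m%:R < eps.
  rewrite ltr_pdivrMr// [ltRHS]mulrC -ltr_pdivrMr//.
  apply: (@lt_trans _ _ (Num.bound ((2 + 2 * NE) / eps))%:R); last by rewrite /m ltr_nat.
  by apply: archi_boundP; rewrite divr_ge0 ?(ltW eps0)// addr_ge0// mulr_ge0.
pose C : 'M[int]_(n, k.+1 * k.+1) := \matrix_(p, s) Num.floor (m%:R * c p s).
have l1 : l1norm (c - m%:R^-1 *: int_mx C) <= NE / m%:R.
  apply: (@le_trans _ _ (\sum_(p < n) \sum_(s < k.+1 * k.+1) m%:R^-1)).
    apply: ler_sum => p _; apply: ler_sum => s _; rewrite !mxE.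
    have := floor_itv (m%:R * c p s); set F := (Num.floor _)%:~R => /andP[F1 F2].
    have -> : c p s - m%:R^-1 * F = m%:R^-1 * (m%:R * c p s - F).
      by rewrite mulrBr mulrA mulVf ?gt_eqF// mul1r.
    rewrite normrM ger0_norm ?invr_ge0// ler_piMr ?invr_ge0//.
    rewrite ger0_norm ?subr_ge0//; move: F2; rewrite intrD => F2.
    by rewrite lerBlDl ltW.
  rewrite !sumr_const !card_ord -mulrnA -[leLHS]mulr_natl /NE mulnC//.
pose t : task := inl (existT _ n (existT _ k C)).
pose piece (q : 'I_k.+1) : set (cube T) := [set z | z ((t, val q), 1%g)].
pose B := fibers (first_index piece).
have fB q : fin_dep (B q) by apply: fin_dep_first_index => j; exact: fin_dep_coord.
have mB q : measurable (B q) by exact: mfin.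
have pB : indexed_partition B by exact: (fibers_partition mB).
have eta0 : 0 < (l1norm (int_mx C) + 1)^-1.
  by rewrite invr_gt0 ltr_wpDl ?l1norm_ge0.
apply: filterS (profile_limit n fB eta0) => i hi /=.
have [f [mf Lf hf]] := labelP t i.
have fi x : first_index piece (code i x) = f x.
  have codeE q : piece q (code i x) <-> val (f x) = val q.
    rewrite /piece /= /code /orbit_code /bit /= invg1 act1 Lf.
    by split => [/eqP|h]; [|apply/eqP].
  apply: first_indexP; first exact/codeE.
  by move=> q qf /codeE h; rewrite -[X in (_ < X)%N]/(val (f x)) h ltnn in qf.
have BE : (fun j => code i @^-1` B j) = fibers f.
  by apply/funext => j; apply/seteqP; split => x; rewrite /B /fibers/= fi.
have h1 : pairing (int_mx C) (profile e (a i) n (fibers f)) <= pairing (int_mx C) (profile e b n B) + 1.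
  have h : forall p s, `|(profile e (a i) n (fibers f) - profile e b n B) p s| <=
      (l1norm (int_mx C) + 1)^-1.
    by move=> p s; rewrite subr_entry -BE ltW.
  have := pairing_le (int_mx C) h; rewrite pairingBr.
  have : l1norm (int_mx C) * (l1norm (int_mx C) + 1)^-1 <= 1.
    by rewrite ler_pdivrMr ?mul1r ?lerDl// ltr_wpDl ?l1norm_ge0.
  by rewrite ler_norml => + /andP[]; lra.
have minv0 : 0 < m%:R^-1 :> R by rewrite invr_gt0.
have l1' : l1norm (m%:R^-1 *: int_mx C - c) <= NE / m%:R.
  apply: le_trans l1; apply: ler_sum => p _; apply: ler_sum => s _.
  by rewrite !subr_entry distrC.
have h2 := support_lip e (a i) c (m%:R^-1 *: int_mx C).
have h3 := support_lip e b (m%:R^-1 *: int_mx C) c.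
rewrite !supportZ// in h2 h3.
have h4 := support_ge e b (int_mx C) pB.
have h5 : m%:R^-1 * support e (a i) n k (int_mx C) <= m%:R^-1 * (support e b n k (int_mx C) + 2).
  by rewrite ler_pM2l//; lra.
by move: mP; rewrite mulrDl mulrDr in h5 *; lra.
Qed.

Let limit_nonatomic z : lam [set z] = 0%E.
Proof.
have mz : measurable [set z].
  rewrite (_ : [set z] = \bigcap_n [set z' : cube T | z' (tau n) = z (tau n)]).
    apply: bigcapT_measurable => n; apply: mfin; exists [:: tau n] => z1 z2.
    by move=> /(_ (tau n)); rewrite inE eqxx => /(_ isT) /= ->.
  apply/seteqP; split => [_ -> //|z' h]; apply/funext => t.
  by have := h (idx t) Logic.I; rewrite /= idxK.
apply/eqP; rewrite -fine_eq0 ?fin_num_measure// eq_le pr_ge0 andbT.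
apply/ler_addgt0Pr => eps eps0; rewrite add0r.
pose N := Num.bound eps^-1; pose t : task := inr N.
(* The points in the same piece as [z]. *)
pose S : set (cube T) := [set z' | forall q : 'I_N.+1, z' ((t, val q), 1%g) = z ((t, val q), 1%g)].
have fS : fin_dep S.
  exists [seq ((t, val q), 1%g) | q : 'I_N.+1] => z1 z2 zz' h q.
  by rewrite -zz' ?h//; apply/mapP; exists q => //; rewrite mem_enum.
have Neps : N.+1%:R^-1 <= eps.
  rewrite invf_ple ?posrE ?ltr0n//; apply: ltW.
  apply: (@lt_trans _ _ N%:R); last by rewrite ltr_nat.
  by apply: archi_boundP; rewrite invr_ge0 ltW.
apply: le_trans Neps; apply: (@le_trans _ _ (fine (lam S))).
  by apply: pr_le => //; [exact: mfin|move=> _ ->].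
rewrite lamE//.
have hS i : fine (mu (code i @^-1` S)) <= N.+1%:R^-1.
  have mcS : measurable (code i @^-1` S) by exact: (measurable_preimage (mcode i) (mfin fS)).
  have [f [mf Lf fN]] := labelP t i.
  have codeE x q : code i x ((t, q), 1%g) = (val (f x) == q).
    by rewrite /code /orbit_code /bit /= invg1 act1 Lf.
  have [[q zq]|nz] := pselect (exists q : 'I_N.+1, z ((t, val q), 1%g)).
    rewrite -(fN q); apply: pr_le => // x /(_ q); rewrite codeE zq => /eqP.
    by move=> h; exact/val_inj.
  rewrite (_ : _ @^-1` _ = set0) ?measure0 ?invr_ge0//.
  apply/seteqP; split => // x /(_ (f x)); rewrite codeE eqxx => /esym h.
  by apply: nz; exists (f x).
have hb i : `|fine (mu (code i @^-1` S))| <= 1.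
  rewrite ger0_norm ?pr_ge0// pr_le1//.
  exact: (measurable_preimage (mcode i) (mfin fS)).
apply/ler_addgt0Pr => eps' eps'0.
pose F i := fine (mu (code i @^-1` S)).
have [i hi] : exists i, `|F i - ulim U F| < eps' by exact: filter_ex (ulimP UU hb eps'0).
change (ulim U F <= N.+1%:R^-1 + eps').
have Fi : F i <= N.+1%:R^-1 by exact: hS.
move: hi Fi; rewrite ltr_norml => /andP[].
by move: (F i) (ulim U F) N.+1%:R^-1 => x y v; lra.
Qed.

Lemma limit_on_cube :
  [/\ forall n k c eps, 0 < eps ->
      U [set i | support e (a i) n k c <= support e b n k c + eps],
    forall n k (A : 'I_k.+1 -> set (cube T)) eps, indexed_partition A -> 0 < eps ->
      U [set i | exists2 A' : 'I_k.+1 -> set X,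
        indexed_partition A' & `|profile e (a i) n A' - profile e b n A| < eps] &
    forall z, lam [set z] = 0%E].
Proof.
split; [exact: limit_support|exact: limit_partitions|exact: limit_nonatomic].
Qed.

End limit_on_cube.

(** The limit on the Cantor cube is carried by a standard nonatomic space, so the
    isomorphism theorem moves it to the given space. The two conclusions are the
    two halves of the convergence of the sets of profiles. *)
Lemma limit_action : exists b : mpaction G mu,
  (forall n k c eps, 0 < eps ->
      U [set i | support e (a i) n k c <= support e b n k c + eps]) /\
  (forall n k (A : 'I_k.+1 -> set X) eps, indexed_partition A -> 0 < eps ->
      U [set i | exists2 A' : 'I_k.+1 -> set X,
        indexed_partition A' & `|profile e (a i) n A' - profile e b n A| < eps]).
Proof.
have [lam [b [bE lamE]]] := ultralimit_action UU a measurable_bit idxK.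
have [bsup bpart lam0] := limit_on_cube bE lamE.
have Zr : cube_retract (cube T).
  by apply: (cube_retract_cube (tau := tau)) => t; exists (idx t).
have [phi [bphi mphi mphi' lawphi]] := standard_isomorphism Xr Zr muN lam0.
have [b' b'b] := transport_action b bphi mphi mphi' lawphi.
exists b'; split=> [n k c eps eps0|n k A eps pA eps0].
  by rewrite (support_isomorphic e b'b); exact: bsup.
have [psi [_ mpsi _ psinu psieq]] := isomorphic_actions_sym b'b.
have [mA _ _] := pA.
rewrite (factor_profile e psinu psieq n mA).
by apply: bpart => //; exact: (factor_partition mpsi).
Qed.

End limit_action.

(** * Convergence for the stable distance *)

Section weak_distance_bounds.
Context (R : realType) (G : groupType) (e : nat -> G).
Context d1 d2 (Y : measurableType d1) (Z : measurableType d2).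
Context (nu : probability Y R) (xi : probability Z R).
Context (a : mpaction G nu) (b : mpaction G xi).

Let dist n k := hausdorff_dist (profiles e a n.+1 k.+1) (profiles e b n.+1 k.+1).

Let dist_ge0 n k : 0 <= dist n k.
Proof. exact: hausdorff_dist_ge0 (profiles_bounded e a n.+1 k) (profiles_bounded e b n.+1 k). Qed.

Let dist_le4 n k : dist n k <= 4.
Proof.
apply: le_trans (hausdorff_dist_bounded (profiles_bounded e a n.+1 k) (profiles_bounded e b n.+1 k)) _.
by lra.
Qed.

Let term n k : R := 2 ^- (n.+1 + k.+1) * dist n k.

Let term_ge0 n k : 0 <= term n k.
Proof. by rewrite mulr_ge0// invr_ge0 exprn_ge0. Qed.

Lemma eseries_le (f : nat -> R) (B : R) : (forall k, 0 <= f k) ->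
  (forall m, \sum_(0 <= k < m) f k <= B) -> (\sum_(0 <= k <oo) (f k)%:E <= B%:E)%E.
Proof.
move=> f0 fB; apply: lime_le; first by apply: is_cvg_nneseries => k _ _; rewrite lee_fin.
by apply: nearW => m; rewrite sumEFin lee_fin.
Qed.

Let half n : R := 2 ^- n.

Let half_gt0 n : 0 < half n. Proof. by rewrite invr_gt0 exprn_gt0. Qed.

Let halfS n : half n = half n.+1 + half n.+1.
Proof. by rewrite /half exprS invfM; lra. Qed.

Let sum_half m : \sum_(0 <= k < m) half k.+1 <= 1.
Proof.
suff : \sum_(0 <= k < m) half k.+1 + half m <= 1 by have := half_gt0 m; lra.
elim: m => [|m IH]; first by rewrite big_geq// add0r /half expr0 invr1.
by rewrite big_nat_recr//=; move: IH; rewrite (halfS m); lra.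
Qed.

(** A bound for the part of row or column [j] that [delta] does not control. *)
Let tail N j : R := if (N <= j)%N then 4 * half j.+1 else 0.

Let tail_ge0 N j : 0 <= tail N j.
Proof. by rewrite /tail; case: ifP => // _; rewrite mulr_ge0// ltW. Qed.

Let sum_tail N m : \sum_(0 <= k < m) tail N k <= 4 * half N.
Proof.
suff : \sum_(0 <= k < m) tail N k + 4 * half (maxn N m) <= 4 * half N.
  by have := half_gt0 (maxn N m); lra.
elim: m => [|m IH]; first by rewrite big_geq// add0r maxn0.
rewrite big_nat_recr//= {2}/tail; have [Nm|Nm] := boolP (N <= m)%N.
  have E1 : maxn N m = m by apply/maxn_idPr.
  have E2 : maxn N m.+1 = m.+1 by apply/maxn_idPr; exact: leqW.
  by move: IH; rewrite E1 E2 (halfS m); lra.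
rewrite -ltnNge in Nm.
have E1 : maxn N m = N by apply/maxn_idPl; exact: ltnW.
have E2 : maxn N m.+1 = N by apply/maxn_idPl.
by rewrite addr0 E2; rewrite E1 in IH.
Qed.

Let double_sum_le N delta : 0 <= delta ->
  (forall n k, (n < N)%N -> (k < N)%N -> dist n k <= delta) ->
  (\sum_(0 <= n <oo) \sum_(0 <= k <oo) (term n k)%:E <= (delta + 8 * half N)%:E)%E.
Proof.
move=> delta0 h.
have hN := ltW (half_gt0 N).
pose r n := delta * half n.+1 + tail N n + 4 * half N * half n.+1.
have termle n k : term n k <= delta * half n.+1 * half k.+1 + tail N n * half k.+1 +
    tail N k * half n.+1.
  have nk : term n k = half n.+1 * half k.+1 * dist n k.
    by rewrite /term /half exprD invfM.
  have p1 : 0 <= half n.+1 * half k.+1 by rewrite mulr_ge0// ltW.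
  rewrite nk /tail; have := dist_le4 n k; have := @h n k; have := dist_ge0 n k.
  case: leqP => Nn; case: leqP => Nk /=; move: (dist n k) p1 => D; nra.
apply: (@le_trans _ _ (\sum_(0 <= n <oo) (r n)%:E)%E).
  apply: lee_nneseries => [n _ _|n _].
    by apply: nneseries_ge0 => k _ _; rewrite lee_fin.
  apply: eseries_le => // m.
  apply: (@le_trans _ _ (\sum_(0 <= k < m) (delta * half n.+1 * half k.+1 +
      tail N n * half k.+1 + tail N k * half n.+1))); first exact: ler_sum.
  rewrite !big_split/= -!mulr_sumr -mulr_suml /r.
  have hn := ltW (half_gt0 n.+1).
  apply: lerD; [apply: lerD|].
  - by rewrite ler_piMr// mulr_ge0.
  - by rewrite ler_piMr.
  - by rewrite ler_wpM2r.
have r0 n : 0 <= r n.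
  have hn := ltW (half_gt0 n.+1).
  by rewrite /r !addr_ge0// mulr_ge0// mulr_ge0.
apply: eseries_le => // m; rewrite /r !big_split/= -!mulr_sumr.
have := sum_tail N m; have := sum_half m.
move: (\sum_(0 <= i < m) tail N i) (\sum_(0 <= i < m) half i.+1) => s t t1 s1.
have : delta * t <= delta by rewrite ler_piMr.
have : 4 * half N * t <= 4 * half N by rewrite ler_piMr// mulr_ge0.
by lra.
Qed.

Let double_sum_fin :
  (\sum_(0 <= n <oo) \sum_(0 <= k <oo) (term n k)%:E)%E \is a fin_num.
Proof.
rewrite ge0_fin_numE; last first.
  by apply: nneseries_ge0 => n _ _; apply: nneseries_ge0 => k _ _; rewrite lee_fin.
have /double_sum_le : 0 <= 4 :> R by [].
by move=> /(_ 0%N (fun n k _ _ => dist_le4 n k))/le_lt_trans; apply; exact: ltry.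
Qed.

(** The Hausdorff distances are at most 4, so the terms with [n] or [k] at least
    [N] contribute a geometric tail. *)
Lemma weak_dist_le N delta : 0 <= delta ->
  (forall n k, (n < N)%N -> (k < N)%N ->
    hausdorff_dist (profiles e a n.+1 k.+1) (profiles e b n.+1 k.+1) <= delta) ->
  weak_dist e a b <= delta + 8 * 2 ^- N.
Proof.
by move=> d0 /(double_sum_le d0); rewrite -lee_fin fineK//; exact: double_sum_fin.
Qed.

Lemma hausdorff_le_weak_dist n k :
  2 ^- (n.+1 + k.+1) *
    hausdorff_dist (profiles e a n.+1 k.+1) (profiles e b n.+1 k.+1) <= weak_dist e a b.
Proof.
rewrite -lee_fin fineK; last exact: double_sum_fin.
have single (f : nat -> \bar R) m : (forall i, 0 <= f i)%E ->
    (f m <= \sum_(0 <= i <oo) f i)%E.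
  move=> f0; apply: le_trans (nneseries_lim_ge m.+1 _) => //.
  by rewrite big_nat_recr//= leeDr// sume_ge0.
have in0 i : (0 <= \sum_(0 <= k <oo) (term i k)%:E)%E.
  by apply: nneseries_ge0 => j _ _; rewrite lee_fin.
apply: le_trans (single _ n in0).
exact: (single (fun k => (term n k)%:E) k (fun j => term_ge0 n j)).
Qed.

End weak_distance_bounds.

Section stable_distance.
Context (R : realType) (G : groupType) (e : nat -> G).
Local Notation U01 := (uniform_prob (@ltr01 R) : probability _ R).
Local Notation stab a := (prod_action a (trivial_action G U01)).

Lemma stab_profiles_bounded d (Y : measurableType d) (nu : probability Y R)
    (a : mpaction G nu) n k : profiles e (stab a) n k.+1 !=set0 /\
  forall x, profiles e (stab a) n k.+1 x -> `|x| <= 2.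
Proof. exact: profiles_bounded. Qed.

Lemma support_eq_profiles d1 d2 (Y : measurableType d1) (Z : measurableType d2)
    (nu : probability Y R) (xi : probability Z R)
    (a : mpaction G nu) (b : mpaction G xi) :
  (forall n k (c : 'M[R]_(n, k.+1 * k.+1)), support e a n k c = support e b n k c) ->
  forall n k, profiles e (stab a) n k.+1 = profiles e (stab b) n k.+1.
Proof.
move=> ab n k; apply/seteqP; split => M /profilesP h; apply/profilesP => c.
  by rewrite -ab.
by rewrite ab.
Qed.

(** The stable distance depends on the support functions only, hence on the stable
    weak equivalence class. *)
Lemma support_eq_stable_dist d1 d2 d3 (Y : measurableType d1) (Z : measurableType d2)
    (W : measurableType d3) (nu : probability Y R) (xi : probability Z R)
    (om : probability W R)
    (a : mpaction G nu) (b : mpaction G xi) (c : mpaction G om) :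
  (forall n k (c : 'M[R]_(n, k.+1 * k.+1)), support e a n k c = support e b n k c) ->
  stable_dist e a c = stable_dist e b c.
Proof.
move=> ab; congr fine; apply: eq_eseriesr => n _; apply: eq_eseriesr => k _.
by rewrite (support_eq_profiles ab).
Qed.

Lemma support_le_hausdorff d1 d2 (Y : measurableType d1) (Z : measurableType d2)
    (nu : probability Y R) (xi : probability Z R)
    (a : mpaction G nu) (b : mpaction G xi) n k (c : 'M[R]_(n, k.+1 * k.+1)) :
  support e a n k c <= support e b n k c +
    l1norm c * hausdorff_dist (profiles e (stab a) n k.+1) (profiles e (stab b) n k.+1).
Proof.
set D := hausdorff_dist _ _; apply: support_le => A pA.
have Ka : profiles e (stab a) n k.+1 (profile e a n A).
  by apply/profilesP => c'; exact: support_ge.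
have [/(_ (lexx _))[ab _] _] :=
  hausdorff_distP D (stab_profiles_bounded a n k) (stab_profiles_bounded b n k).
have [Kb0 _] := stab_profiles_bounded b n k.
apply/ler_addgt0Pr => eps eps0.
have L0 : 0 < l1norm c + 1 by rewrite ltr_wpDl ?l1norm_ge0.
have e0 : 0 < eps / (l1norm c + 1) by rewrite divr_gt0.
have hinf : has_inf [set `|profile e a n A - y| | y in profiles e (stab b) n k.+1].
  by split; [case: Kb0 => y Ky; exists `|profile e a n A - y|, y|exists 0 => _ [y _ <-]].
have [_ [y Ky <-] yD] := inf_adherent e0 hinf.
have /profilesP/(_ c) yc := Ky.
have h1 := pairing_le_norm c (profile e a n A - y).
have h2 : `|profile e a n A - y| <= D + eps / (l1norm c + 1).
  by apply: ltW (lt_le_trans yD _); rewrite lerD2r; exact: ab.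
have h3 : l1norm c * `|profile e a n A - y| <= l1norm c * D + eps.
  apply: le_trans (ler_wpM2l (l1norm_ge0 c) h2) _; rewrite mulrDr lerD2l.
  by rewrite mulrCA -[leRHS]mulr1 ler_pM2l// ler_pdivrMr// mul1r lerDl.
move: h1; rewrite pairingBr ler_norml => /andP[_]; lra.
Qed.

Section limits.
Context (I : Type) (U : set_system I).
Hypothesis UU : UltraFilter U.

Lemma ulim_matrix m n (F : I -> 'M[R]_(m, n)) (B : R) : (forall i, `|F i| <= B) ->
  exists M, forall eps, 0 < eps -> U [set i | `|F i - M| < eps].
Proof.
move=> FB; exists (\matrix_(p, s) ulim U (fun i => F i p s)) => eps eps0.
have h : U [set i | forall p s, `|F i p s - ulim U (fun i => F i p s)| < eps].
  apply: filter_forall => p; apply: filter_forall => s.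
  by apply: (ulimP UU (B := B)) => // i; exact: le_trans (entry_le_norm _ _ _) (FB i).
apply: filterS h => i /= h; apply: norm_lt_entries => // p s.
by rewrite subr_entry mxE.
Qed.

Context d (X : measurableType d) (mu : probability X R).
Context (a : I -> mpaction G mu) (b : mpaction G mu).
Hypothesis bsup : forall n k c eps, 0 < eps ->
  U [set i | support e (a i) n k c <= support e b n k c + eps].
Hypothesis bpart : forall n k (A : 'I_k.+1 -> set X) eps, indexed_partition A ->
  0 < eps -> U [set i | exists2 A' : 'I_k.+1 -> set X,
    indexed_partition A' & `|profile e (a i) n A' - profile e b n A| < eps].

(** Closedness, which both inclusions rely on: an ultralimit of matrices that
    satisfy the inequalities of [b] in the limit is a profile of the stabilized
    [b]. *)
Let limit_in_profiles n k (F : I -> 'M[R]_(n, k.+1 * k.+1)) M :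
  (forall c eps, 0 < eps -> U [set i | pairing c (F i) <= support e b n k c + eps]) ->
  (forall eps, 0 < eps -> U [set i | `|F i - M| < eps]) ->
  profiles e (stab b) n k.+1 M.
Proof.
move=> Fsup FM; apply/profilesP => c; apply/ler_addgt0Pr => eps eps0.
have eps20 : 0 < eps / 2 by rewrite divr_gt0.
have [delta delta0 h] := pairing_small c eps20.
have [i [/= h1 /ltW/h]] := filter_ex (filterI (Fsup c _ eps20) (FM _ delta0)).
by rewrite pairingBr ler_norml => /andP[]; lra.
Qed.

(** No profiles of the [a i] stay away from those of [b]: otherwise the ultralimit
    of such profiles would be one of [b]. *)
Let upper n k eps : 0 < eps -> U [set i | forall M, profiles e (stab (a i)) n k.+1 M ->
  dist_to M (profiles e (stab b) n k.+1) <= eps].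
Proof.
move=> eps0; set S := [set i | _]; have [//|US] := in_ultra_setVsetC S UU.
have /choice[F FP] i : exists M, profiles e (stab (a i)) n k.+1 M /\
    (~ S i -> eps < dist_to M (profiles e (stab b) n k.+1)).
  have [Si|/existsNP[M /not_implyP[KM /negP]]] := pselect (S i).
    by have [[M KM] _] := stab_profiles_bounded (a i) n k; exists M.
  by rewrite -ltNge => h; exists M.
have FB i : `|F i| <= 2.
  by have [KF _] := FP i; have [_] := stab_profiles_bounded (a i) n k; apply.
have [M FM] := ulim_matrix FB.
have KM : profiles e (stab b) n k.+1 M.
  apply: limit_in_profiles FM => c eps' eps'0; apply: filterS (bsup c eps'0) => i /=.
  by apply: le_trans; have [/profilesP/(_ c)] := FP i.
have [i [/= nS h]] := filter_ex (filterI US (FM _ eps0)).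
have [_ /(_ nS)] := FP i; rewrite ltNge => /negP[].
by apply: le_trans (dist_to_le _ KM) (ltW h).
Qed.

(** The profiles of [b] are approximated: up to a small error they are convex
    combinations of finitely many profiles of partitions, each of which is
    approximated by [a i]. Compactness makes this uniform. *)
Let lower n k eps : 0 < eps -> U [set i | forall M, profiles e (stab b) n k.+1 M ->
  dist_to M (profiles e (stab (a i)) n k.+1) <= eps].
Proof.
move=> eps0; set S := [set i | _]; have [//|US] := in_ultra_setVsetC S UU.
have /choice[F FP] i : exists M, profiles e (stab b) n k.+1 M /\
    (~ S i -> eps < dist_to M (profiles e (stab (a i)) n k.+1)).
  have [Si|/existsNP[M /not_implyP[KM /negP]]] := pselect (S i).
    by have [[M KM] _] := stab_profiles_bounded b n k; exists M.
  by rewrite -ltNge => h; exists M.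
have FB i : `|F i| <= 2.
  by have [KF _] := FP i; have [_] := stab_profiles_bounded b n k; apply.
have [M FM] := ulim_matrix FB.
have KM : profiles e (stab b) n k.+1 M.
  apply: limit_in_profiles FM => c eps' eps'0; apply: filterS filterT => i _ /=.
  by have [/profilesP/(_ c) h _] := FP i; rewrite ler_wpDr// ltW.
have eps40 : 0 < eps / 4 by rewrite divr_gt0.
have [M' [m [alpha [A [a0 pA M'E]]]] MM'] := profiles_hull_approx KM eps40.
have UA : U [set i | forall l, exists2 A' : 'I_k.+1 -> set X, indexed_partition A' &
    `|profile e (a i) n A' - profile e b n (A l)| < eps / 4].
  by apply: filter_forall => l; exact: bpart.
have [i [[/= nS h] hA]] := filter_ex (filterI (filterI US (FM _ eps40)) UA).
have /choice[A' AP] l : exists A' : 'I_k.+1 -> set X, indexed_partition A' /\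
    `|profile e (a i) n A' - profile e b n (A l)| < eps / 4.
  by have [A' ? ?] := hA l; exists A'.
pose Mi := \sum_l alpha l *: profile e (a i) n (A' l).
have KMi : profiles e (stab (a i)) n k.+1 Mi.
  apply: hull_profiles; exists m, alpha, A'; split => // l.
  by have [] := AP l.
have MiM' : `|Mi - M'| <= eps / 4.
  rewrite M'E -sumrB (le_trans (ler_norm_sum _ _ _))//.
  rewrite -[leRHS]mul1r -[X in X * _](wt_sum1 alpha) mulr_suml; apply: ler_sum => l _.
  rewrite -scalerBr normrZ ger0_norm ?(ltW (a0 l))// ler_pM2l//.
  have [_ hl] := AP l; exact: (ltW hl).
have [_ /(_ nS)] := FP i; rewrite ltNge => /negP[].
apply: le_trans (dist_to_le _ KMi) _.
have -> : F i - Mi = (F i - M) + ((M - M') - (Mi - M')).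
  by apply/matrixP => p s; rewrite !mxE; ring.
apply: le_trans (ler_normD _ _) _; have := ler_normB (M - M') (Mi - M').
by move: h MM' MiM'; lra.
Qed.

Lemma limit_hausdorff n k eps : 0 < eps ->
  U [set i | hausdorff_dist (profiles e (stab b) n k.+1)
                            (profiles e (stab (a i)) n k.+1) <= eps].
Proof.
move=> eps0; apply: filterS (filterI (lower n k eps0) (upper n k eps0)) => i [/= hl hu].
have HP := hausdorff_distP eps (stab_profiles_bounded b n k) (stab_profiles_bounded (a i) n k).
exact: HP.2 (conj hl hu).
Qed.

Lemma limit_stable_dist eps : 0 < eps -> U [set i | stable_dist e b (a i) < eps].
Proof.
move=> eps0; have eps20 : 0 < eps / 2 by rewrite divr_gt0.
have [N hN] : exists N, 8 * 2 ^- N < eps / 2 :> R.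
  have eps160 : 0 < eps / 16 by rewrite divr_gt0.
  have [N /(_ N (leqnn N))] := half_power_small eps160; rewrite exprVn => hN.
  by exists N; lra.
have : U [set i | forall n k : 'I_N, hausdorff_dist (profiles e (stab b) n.+1 k.+1)
    (profiles e (stab (a i)) n.+1 k.+1) <= eps / 2].
  by apply: filter_forall => n; apply: filter_forall => k; exact: limit_hausdorff.
apply: filterS => i /= h.
have : stable_dist e b (a i) <= eps / 2 + 8 * 2 ^- N.
  apply: weak_dist_le; first exact: ltW.
  by move=> n k nN kN; exact: (h (Ordinal nN) (Ordinal kN)).
by move: hN; lra.
Qed.

End limits.

End stable_distance.

(** * The Banach space of bounded functions *)

Section bounded_functions.
Context (R : realType) (T : pointedType).

Definition is_bounded : {pred (T -> R^o)} :=
  [pred f | `[< exists B : R, forall t, `|f t| <= B >]].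

Lemma is_boundedP (f : T -> R^o) :
  reflect (exists B : R, forall t, `|f t| <= B) (f \in is_bounded).
Proof. exact: asboolP. Qed.

Record bounded_fun := BoundedFun { bval :> T -> R^o ; bvalP : bval \in is_bounded }.

HB.instance Definition _ := [isSub for bval].
HB.instance Definition _ := [Choice of bounded_fun by <:].

Lemma is_bounded_submod_closed : submod_closed is_bounded.
Proof.
split.
  by apply/is_boundedP; exists 0 => t; rewrite normr0.
move=> c f g /is_boundedP[A fA] /is_boundedP[B gB]; apply/is_boundedP.
exists (`|c| * A + B) => t; apply: le_trans (ler_normD _ _) _.
by rewrite lerD// normrM ler_wpM2l.
Qed.

HB.instance Definition _ := GRing.isSubmodClosed.Build _ _ is_bounded
  is_bounded_submod_closed.
HB.instance Definition _ := [SubChoice_isSubLmodule of bounded_fun by <:].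

Implicit Types f g : bounded_fun.

Definition sup_norm f : R := sup [set `|f t| | t in setT].

Lemma sup_norm_has_sup f : has_sup [set `|f t| | t in setT].
Proof.
split; first by exists `|f point|, point.
have /is_boundedP[B fB] := bvalP f.
by exists B => _ [t _ <-].
Qed.

Lemma sup_norm_ge f t : `|f t| <= sup_norm f.
Proof. by apply: ub_le_sup; [case: (sup_norm_has_sup f)|exists t]. Qed.

Lemma sup_norm_le f B : (forall t, `|f t| <= B) -> sup_norm f <= B.
Proof.
by move=> fB; apply: ge_sup; [case: (sup_norm_has_sup f)|move=> _ [t _ <-]].
Qed.

Lemma bounded_fun_eq f g : (forall t, f t = g t) -> f = g.
Proof. by move=> fg; apply/val_inj/funext. Qed.

Let ler_sup_normD f g : sup_norm (f + g) <= sup_norm f + sup_norm g.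
Proof.
apply: sup_norm_le => t; apply: le_trans (ler_normD _ _) _.
by rewrite lerD// sup_norm_ge.
Qed.

Let sup_normZ (l : R) f : sup_norm (l *: f) = `|l| * sup_norm f.
Proof.
have half (c : R) g : sup_norm (c *: g) <= `|c| * sup_norm g.
  by apply: sup_norm_le => t; rewrite normrM ler_wpM2l// sup_norm_ge.
apply/eqP; rewrite eq_le half/=.
have [->|l0] := eqVneq l 0.
  by rewrite normr0 mul0r (le_trans _ (sup_norm_ge _ point)).
have := half l^-1 (l *: f); rewrite scalerA mulVf// scale1r normfV.
by rewrite -ler_pdivlMl ?invr_gt0 ?normr_gt0// invrK.
Qed.

Let sup_norm_eq0 f : sup_norm f = 0 -> f = 0.
Proof.
move=> f0; apply: bounded_fun_eq => t; apply/eqP; rewrite -normr_le0 -f0.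
exact: sup_norm_ge.
Qed.

HB.instance Definition _ := @Lmodule_isNormed.Build R bounded_fun sup_norm
  ler_sup_normD sup_normZ sup_norm_eq0.

Lemma bounded_fun_normE f : `|f| = sup_norm f.
Proof. by []. Qed.

Lemma bounded_fun_dist f g t : `|(f t : R) - g t| <= `|f - g|.
Proof. by rewrite bounded_fun_normE; exact: (sup_norm_ge (f - g) t). Qed.

Let cauchy_cvg_bounded (F : set_system bounded_fun) : ProperFilter F -> cauchy F -> cvg F.
Proof.
move=> FF /cauchyP F_cauchy.
have Fc eps : 0 < eps -> exists f, F (ball f eps).
  by move=> /F_cauchy[f h]; exists f.
have cau_t t : cvg ((fun f : bounded_fun => f t : R) @ F).
  apply/cauchy_cvgP/cauchyP => eps eps0; have [f Ff] := Fc _ eps0.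
  exists (f t); suff : F [set g : bounded_fun | ball (f t : R) eps (g t)] by [].
  apply: filterS Ff => g; rewrite -!ball_normE /=.
  by apply: le_lt_trans; exact: bounded_fun_dist.
pose l t := lim ((fun f : bounded_fun => f t : R) @ F).
have near_l f eps : 0 < eps -> F (ball f eps) -> forall t, `|f t - l t| <= eps.
  move=> eps0 Ff t; apply/ler_addgt0Pr => eta eta0.
  have /cvgrPdist_lt/(_ _ eta0) Fl := cau_t t.
  have [g [gf gl]] := filter_ex (filterI Ff Fl).
  have h1 : `|f t - g t| <= eps.
    move: gf; rewrite -ball_normE /= => /ltW; apply: le_trans.
    exact: bounded_fun_dist.
  rewrite -(subrKA (g t : R)); apply: le_trans (ler_normD _ _) _.
  by rewrite lerD// distrC ltW.
have l_bounded : (l : T -> R^o) \in is_bounded.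
  have [f Ff] := Fc _ ltr01; apply/is_boundedP; exists (sup_norm f + 1) => t.
  have -> : l t = f t - (f t - l t) by rewrite subKr.
  apply: le_trans (ler_normB _ _) _; rewrite lerD ?sup_norm_ge//.
  exact: near_l.
apply/cvg_ex; exists (BoundedFun l_bounded); apply/cvg_ballP => eps eps0.
have eps40 : 0 < eps / 4 by rewrite divr_gt0.
have [f Ff] := Fc _ eps40; have fl := near_l _ _ eps40 Ff.
apply: filterS Ff => g gf.
rewrite -ball_normE /=.
have -> : BoundedFun l_bounded - g = (BoundedFun l_bounded - f) + (f - g).
  by rewrite addrA subrK.
apply: le_lt_trans (ler_normD _ _) _.
have h1 : `|BoundedFun l_bounded - f| <= eps / 4.
  apply: sup_norm_le => t; rewrite -[leLHS]/(`|l t - (f t : R)|) distrC.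
  exact: fl.
by move: gf; rewrite -ball_normE /= => gf; lra.
Qed.

HB.instance Definition _ := Uniform_isComplete.Build bounded_fun cauchy_cvg_bounded.

End bounded_functions.

(** * The embedding into a space of bounded functions *)

Section embedding.
Context (R : realType) (G : groupType) (e : nat -> G).
Hypothesis e_onto : range e = [set: G].

(** Linear functionals on the spaces of profiles of all dimensions. The
    coefficients are given by a function on pairs of natural numbers, so that the
    index type does not depend on the dimensions. *)
Definition functional_index : pointedType := (nat * nat * (nat -> nat -> R))%type.

Definition functional_mx (t : functional_index) :
    'M[R]_(t.1.1.+1, t.1.2.+1 * t.1.2.+1) := \matrix_(p, s) t.2 p s.

(** Weights such that the family of all support functions is bounded and depends
    on the action in a 1-Lipschitz way: the norm of the functional is divided
    out, and the power of 2 is the one in the series that defines the distance. *)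
Definition functional_weight (t : functional_index) : R :=
  2 ^- (t.1.1.+1 + t.1.2.+1) / (l1norm (functional_mx t) + 1).

Lemma l1norm1_gt0 m n (c : 'M[R]_(m, n)) : 0 < l1norm c + 1.
Proof. by rewrite ltr_wpDl ?l1norm_ge0. Qed.

Lemma functional_weight_gt0 t : 0 < functional_weight t.
Proof. by rewrite divr_gt0 ?l1norm1_gt0// invr_gt0 exprn_gt0. Qed.

Lemma functional_mx_onto n k (c : 'M[R]_(n.+1, k.+1 * k.+1)) :
  exists f, functional_mx (n, k, f) = c.
Proof.
pose f p s : R := if (insub p : option 'I_n.+1) is Some i then
  if (insub s : option 'I_(k.+1 * k.+1)) is Some j then c i j else 0 else 0.
by exists f; apply/matrixP => p s; rewrite mxE /f /= !valK.
Qed.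

Section coordinates.
Context d (X : measurableType d) (mu : probability X R) (a : mpaction G mu).

Definition support_coord (t : functional_index) : R^o :=
  functional_weight t * support e a t.1.1.+1 t.1.2 (functional_mx t).

Lemma support_coord_bounded : support_coord \in @is_bounded R functional_index.
Proof.
apply/is_boundedP; exists 1 => t; rewrite normrM gtr0_norm ?functional_weight_gt0//.
apply: le_trans (ler_wpM2l (ltW (functional_weight_gt0 t)) (support_bound _ _ _)) _.
rewrite /functional_weight -mulrA mulr_ile1 ?invr_ge0 ?exprn_ge0//.
- by rewrite mulr_ge0 ?l1norm_ge0// invr_ge0 ltW// l1norm1_gt0.
- by rewrite invf_le1 ?exprn_gt0// exprn_ege1// ler1n.
- by rewrite mulrC ler_pdivrMr ?l1norm1_gt0// mul1r lerDl.
Qed.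

Definition support_vector : bounded_fun R functional_index :=
  BoundedFun support_coord_bounded.

End coordinates.

Lemma support_vector_inj d1 d2 (X : measurableType d1) (Y : measurableType d2)
    (mu : probability X R) (nu : probability Y R)
    (a : mpaction G mu) (b : mpaction G nu) :
  support_vector a = support_vector b ->
  forall n k (c : 'M[R]_(n, k.+1 * k.+1)), support e a n k c = support e b n k c.
Proof.
move=> ab [|n] k c.
  have zero (Z : 'M[R]_(0, k.+1 * k.+1)) : pairing c Z = 0 by rewrite /pairing big_ord0.
  apply/eqP; rewrite eq_le; apply/andP; split; apply: support_le => A _; rewrite zero.
    by rewrite -(zero (profile e b 0 (fibers (fun=> ord0)))) support_ge//; exact: trivial_partition.
  by rewrite -(zero (profile e a 0 (fibers (fun=> ord0)))) support_ge//; exact: trivial_partition.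
have [f <-] := functional_mx_onto c.
have : support_vector a (n, k, f) = support_vector b (n, k, f) by rewrite ab.
by apply: mulfI; rewrite gt_eqF// functional_weight_gt0.
Qed.

Lemma support_vector_lip d1 d2 (X : measurableType d1) (Y : measurableType d2)
    (mu : probability X R) (nu : probability Y R)
    (a : mpaction G mu) (b : mpaction G nu) :
  `|support_vector a - support_vector b| <= stable_dist e a b.
Proof.
apply: sup_norm_le => -[[n k] f]; set t := (n, k, f).
rewrite -[leLHS]/(`|support_coord a t - support_coord b t|) /support_coord -mulrBr.
rewrite normrM gtr0_norm ?functional_weight_gt0//=.
set c := functional_mx t.
pose D := hausdorff_dist
  (profiles e (prod_action a (trivial_action G (uniform_prob (@ltr01 R)))) n.+1 k.+1)
  (profiles e (prod_action b (trivial_action G (uniform_prob (@ltr01 R)))) n.+1 k.+1).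
have hab : support e a n.+1 k c <= support e b n.+1 k c + l1norm c * D.
  exact: support_le_hausdorff.
have hba : support e b n.+1 k c <= support e a n.+1 k c + l1norm c * D.
  by rewrite /D hausdorff_distC; exact: support_le_hausdorff.
have hd : `|support e a n.+1 k c - support e b n.+1 k c| <= l1norm c * D.
  by rewrite ler_norml; apply/andP; split; lra.
apply: le_trans (ler_wpM2l (ltW (functional_weight_gt0 t)) hd) _.
apply: le_trans (hausdorff_le_weak_dist e _ _ n k); rewrite -/D.
have D0 : 0 <= D.
  exact: hausdorff_dist_ge0 (stab_profiles_bounded e a n.+1 k) (stab_profiles_bounded e b n.+1 k).
rewrite /functional_weight mulrA -/t -/c ler_wpM2r// -mulrA ler_piMr ?invr_ge0 ?exprn_ge0//.
by rewrite mulrC ler_pdivrMr ?l1norm1_gt0// mul1r lerDl.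
Qed.

Section quotient_embedding.
Context d (X : measurableType d) (mu : probability X R).
Hypothesis mu_standard : standard_probability mu.
Local Notation Q := (stable_space mu e).
Local Open Scope quotient_scope.

Let Xr : cube_retract X.
Proof. by have [h _] := mu_standard; exact: standard_borel_retract h. Qed.

Let muN x : mu [set x] = 0%E.
Proof. by have [_] := mu_standard. Qed.

Lemma support_repr (a : mpaction G mu) n k (c : 'M[R]_(n, k.+1 * k.+1)) :
  support e (repr (\pi_Q a)) n k c = support e a n k c.
Proof.
have : (\pi_Q (repr (\pi_Q a)) = \pi_Q a)%qT by rewrite reprK.
by move=> /stable_space_eqP/(stably_weakly_equivalentP _ _ e_onto).
Qed.

Definition stable_embedding (x : Q) : bounded_fun R functional_index :=
  support_vector (repr x).

Lemma stable_embedding_inj : injective stable_embedding.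
Proof.
move=> x y /support_vector_inj xy; rewrite -[x]reprK -[y]reprK.
by apply/stable_space_eqP/(stably_weakly_equivalentP _ _ e_onto).
Qed.

Lemma stable_embedding_continuous : continuous stable_embedding.
Proof.
move=> x B /nbhs_ballP[eps /= eps0 epsB]; apply/nbhs_ballP; exists eps => // y xy.
by apply: epsB; rewrite -ball_normE /=; exact: le_lt_trans (support_vector_lip _ _) xy.
Qed.

(** Every ultrafilter converges, to the class of the limit action. *)
Lemma stable_space_compact : compact [set: Q].
Proof.
rewrite compact_ultra => F UF _.
have [b [bsup bpart]] := limit_action e_onto UF Xr muN (fun x : Q => repr x).
exists (\pi_Q b); split => // B /nbhs_ballP[eps /= eps0 epsB].
suff Fball : F (ball (\pi_Q b : Q) eps) by exact: (@filterS _ F _ _ _ epsB Fball).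
apply: (@filterS _ F _ _ _ _ (limit_stable_dist UF bsup bpart eps0)) => y /= h.
by rewrite /ball/= (support_eq_stable_dist _ (support_repr b)).
Qed.

Lemma sum_nonatomic (t : {i01 R}) z : sum_measure (pair_weights t) (fun=> mu) [set z] = 0%E.
Proof.
apply: big1 => i _; rewrite (_ : mu _ = 0%E) ?mule0//.
have [[x xz]|nz] := pselect (exists x, @embed d 1 (fun=> X) i x = z).
  rewrite (_ : _ @^-1` _ = [set x]); first exact: muN.
  apply/seteqP; split => x' /= x'z; last by rewrite x'z.
  by rewrite -xz in x'z; have := congr1 (fun u : disjoint_union (fun _ : 'I_2 => X) => (projT2 u : X)) x'z.
rewrite (_ : _ @^-1` _ = set0) ?measure0//; apply/seteqP; split => // x /= xz.
by apply: nz; exists x.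
Qed.

(** The convex combination lives on two copies of the space, which together form a
    standard nonatomic space again. *)
Lemma conv_action_ex (t : {i01 R}) (a b : mpaction G mu) :
  exists c : mpaction G mu, isomorphic_actions c (conv_action t a b).
Proof.
have [phi [bphi mphi mphi' phimu]] :=
  standard_isomorphism Xr (cube_retract_double Xr) muN (sum_nonatomic t).
exact: (transport_action (conv_action t a b) bphi mphi mphi' phimu).
Qed.

(** Support functions are affine on sums and invariant under isomorphism. *)
Lemma stable_embedding_conv (x y : Q) (t : {i01 R}) :
  stable_embedding (stable_conv t x y) =
  t%:num *: stable_embedding x + (1 - t%:num) *: stable_embedding y.
Proof.
have : exists z : Q, [set z | exists a b c : mpaction G mu,
    [/\ \pi_Q a = x, \pi_Q b = y, \pi_Q c = z &
        isomorphic_actions c (conv_action t a b)]] z.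
  have [c cE] := conv_action_ex t (repr x) (repr y).
  by exists (\pi_Q c), (repr x), (repr y), c; split; rewrite ?reprK.
move=> /(xgetPex x)[a [b [c [<- <- cz ciso]]]].
rewrite /stable_conv; move: cz; set z := xget _ _ => <-.
apply: bounded_fun_eq => s.
rewrite -[RHS]/(t%:num * support_coord (repr (\pi_Q a)) s +
  (1 - t%:num) * support_coord (repr (\pi_Q b)) s).
rewrite -[LHS]/(support_coord (repr (\pi_Q c)) s) /support_coord !support_repr.
rewrite (support_isomorphic e ciso) support_sum big_ord_recl big_ord1 /=.
by ring.
Qed.

End quotient_embedding.

End embedding.

Theorem theorem1p5 (R : realType) (G : groupType) (e : nat -> G)
    (d : measure_display) (X : measurableType d) (mu : probability X R)
    (G_countable : countable [set: G]) (e_enum : range e = [set: G])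
    (mu_standard : standard_probability mu) :
  exists (E : completeNormedModType R) (S : set E)
      (Theta : stable_space mu e -> E),
    [/\ compact S, convex_set S, homeomorphism_onto Theta S &
        forall (x y : stable_space mu e) (t : {i01 R}),
          Theta (stable_conv t x y) =
            t%:num *: Theta x + (1 - t%:num) *: Theta y].
Proof.
pose Theta := @stable_embedding R G e d X mu.
have cQ := stable_space_compact e_enum mu_standard.
have cTheta := @stable_embedding_continuous R G e d X mu.
have injTheta := @stable_embedding_inj R G e e_enum d X mu.
have affine := stable_embedding_conv e_enum mu_standard.
have cim (C : set (stable_space mu e)) : compact C -> compact (Theta @` C).
  by apply: continuous_compact; exact: continuous_subspaceT.
exists (bounded_fun R (functional_index R)), (range Theta), Theta; split.
- exact: cim.
- move=> u v t; rewrite !inE => -[x _ <-] [y _ <-].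
  by exists (stable_conv t x y) => //; rewrite /Theta affine.
- split => //.
  pose x0 : stable_space mu e := (\pi_(stable_space mu e) (trivial_action G mu))%qT.
  pose g u := xget x0 [set x | Theta x = u].
  have gK : cancel Theta g.
    by move=> x; apply: injTheta; apply: (xgetPex x0 (P := [set y | Theta y = Theta x])); exists x.
  exists g; split => //; apply/subspace_continuousP => _ [x _ <-].
  rewrite /from_subspace gK => B; rewrite nbhsE => -[W [oW Wx] WB].
  (* The inverse is continuous because images of closed sets are compact. *)
  have cC : compact (Theta @` (~` W)).
    by apply: cim; apply: (subclosed_compact _ cQ) => //; exact: open_closedC.
  have clC : closed (Theta @` (~` W)) by apply: compact_closed => //; exact: norm_hausdorff.
  have : nbhs (Theta x) (~` (Theta @` (~` W))).
    apply: open_nbhs_nbhs; split; first exact: closed_openC.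
    by move=> [y nWy /injTheta yx]; apply: nWy; rewrite yx.
  apply: filterS => v nv [y _ yv]; apply: WB; rewrite -yv gK.
  by apply: contrapT => nWy; apply: nv; exists y.
- exact: affine.
Qed.
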